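(* For $R>0$ let $B(0,R)\subset\mathbb{R}^2$ be the disk of radius $R$ centered at the origin, and let $\lambda_k^R$, $k=0,1,2,\dots$, be the $k$-th eigenvalue of the localization operator $A_{B(0,R)}^{g_0}$. Then $$\left| \lambda_k^R - \frac{1}{2}\operatorname{erfc}\left( \frac{k-\pi R^2}{\sqrt{2\pi}\, R} \right) \right| = O\left( \frac{1}{R} \right)\quad\text{as } R\to\infty,$$ uniformly in $k$; that is, there exist constants $C,R_0>0$ such that for all $R\ge R_0$ and all integers $k\ge 0$ the left-hand side is at most $C/R$.
   Context: For $(x,\omega)\in\mathbb{R}^2$ and $f \in L^2(\mathbb{R})$, the time-frequency shift is $\pi(x,\omega)f(t) = e^{2\pi i \omega t} f(t-x)$. The short-time Fourier transform with window $g \in L^2(\mathbb{R})$ is $V_g f(x,\omega) = \langle f, \pi(x,\omega) g\rangle = \int_{\mathbb{R}} f(t)\overline{g(t-x)}e^{-2\pi i \omega t}\,dt$. For a bounded measurable set $\Omega\subset\mathbb{R}^2$, the localization operator $A_\Omega^g : L^2(\mathbb{R})\to L^2(\mathbb{R})$ is $$A_\Omega^g f = \int_\Omega V_g f(x,\omega)\,\pi(x,\omega) g \,dx\,d\omega$$ (understood weakly); it is a compact, positive, self-adjoint operator. The window is the standard Gaussian $g_0(t) = 2^{1/4}e^{-\pi t^2}$. Eigenvalues are listed in non-increasing order, counted with multiplicity, and here indexed starting from $k=0$. $\operatorname{erfc}(x) = \frac{2}{\sqrt{\pi}}\int_x^\infty e^{-s^2}\,ds$. *)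

(* Defs.v *)
From HB Require Import structures.
From mathcomp Require Import all_boot all_order all_algebra.
From mathcomp Require Import complex.
From mathcomp Require Import all_classical all_reals all_analysis.

Set Implicit Arguments.
Unset Strict Implicit.
Unset Printing Implicit Defensive.

Import Order.TTheory GRing.Theory Num.Theory.
Import numFieldNormedType.Exports.

Local Open Scope classical_set_scope.
Local Open Scope card_scope.
Local Open Scope complex_scope.
Local Open Scope ring_scope.

Definition mu1 (R : realType) : {measure set (measurableTypeR R) -> \bar R} :=
  @lebesgue_measure R.

Definition mu2 (R : realType) :
    {measure set (measurableTypeR R * measurableTypeR R) -> \bar R} :=
  (@lebesgue_measure R \x @lebesgue_measure R)%E.

Definition cintegral d (T : measurableType d) (R : realType)
    (mu : {measure set T -> \bar R}) (D : set T) (f : T -> R[i]) : R[i] :=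
  Rintegral mu D (fun t => complex.Re (f t)) +i*
  Rintegral mu D (fun t => complex.Im (f t)).

(* Elements of L^2(R) are represented by functions; the identification of
   functions that agree almost everywhere is explicit wherever it matters
   (see [ae_eq0], [has_dim]). *)
Definition L2 (R : realType) (f : R -> R[i]) : Prop :=
  (fun t => complex.Re (f t)) \in Lfun (mu1 R) 2%:E /\
  (fun t => complex.Im (f t)) \in Lfun (mu1 R) 2%:E.

Definition inner (R : realType) (f g : R -> R[i]) : R[i] :=
  cintegral (mu1 R) setT (fun t => f t * (g t)^*).

Definition expi (R : realType) (a : R) : R[i] := cos a +i* sin a.

Definition tf_shift (R : realType) (z : R * R) (f : R -> R[i]) : R -> R[i] :=
  fun t => expi (2 * pi * z.2 * t) * f (t - z.1).

Definition stft (R : realType) (g f : R -> R[i]) (z : R * R) : R[i] :=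
  inner f (tf_shift z g).

(* Graph of the localization operator: [localization g Omega f h] says that
   A_Omega^g f = h, the vector-valued integral of V_g f(z) pi(z) g over Omega
   being understood weakly, i.e. tested against every u in L^2(R). *)
Definition localization (R : realType) (g : R -> R[i]) (Omega : set (R * R))
    (f h : R -> R[i]) : Prop :=
  [/\ L2 f, L2 h &
    forall u, L2 u ->
      inner h u =
      cintegral (mu2 R) Omega (fun z => stft g f z * inner (tf_shift z g) u)].

Definition ae_eq0 (R : realType) (f : R -> R[i]) : Prop :=
  {ae mu1 R, forall t, f t = 0}.

(* [E], taken modulo almost everywhere equality, has a basis of n elements. *)
Definition has_dim (R : realType) (E : set (R -> R[i])) (n : nat) : Prop :=
  exists e : 'I_n -> R -> R[i],
    [/\ forall i, E (e i),
        forall c : 'I_n -> R[i],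
          ae_eq0 (fun t => \sum_i c i * e i t) -> forall i, c i = 0
      & forall f, E f -> exists c : 'I_n -> R[i],
          ae_eq0 (fun t => f t - \sum_i c i * e i t)].

(* Operators on L^2(R) are given by their graphs. *)
Definition eigenspace_L2 (R : realType) (A : (R -> R[i]) -> (R -> R[i]) -> Prop)
    (mu : R[i]) : set (R -> R[i]) :=
  [set f | L2 f /\ A f (fun t => mu * f t)].

(* [lam] lists the nonzero eigenvalues of the (compact, positive, self-adjoint)
   operator [A] in non-increasing order, each repeated according to its
   multiplicity.  The value 0 is exempt from the count: it occurs in the list
   only as padding, when [A] has finite rank. *)
Definition eigenvalue_listing (R : realType)
    (A : (R -> R[i]) -> (R -> R[i]) -> Prop) (lam : nat -> R) : Prop :=
  (forall j k, (j <= k)%N -> lam k <= lam j) /\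
  forall mu : R[i], mu != 0 ->
    exists n, [set k | (lam k)%:C = mu] #= `I_n /\ has_dim (eigenspace_L2 A mu) n.

(* [kth_eigenvalue A k] is the k-th eigenvalue, starting from k = 0.  A listing is
   unique when it exists, as it does for every compact positive operator; the
   default value 0 of [xget] is junk. *)
Definition kth_eigenvalue (R : realType) (A : (R -> R[i]) -> (R -> R[i]) -> Prop) :
    nat -> R :=
  xget (fun=> 0) [set lam | eigenvalue_listing A lam].

Definition gaussian_window (R : realType) (t : R) : R[i] :=
  (2 `^ (4^-1) * expR (- pi * t ^+ 2))%:C.

(* [ball] on the product type R * R would be a square. *)
Definition disk (R : realType) (r : R) : set (R * R) :=
  [set z | z.1 ^+ 2 + z.2 ^+ 2 < r ^+ 2].

Definition erfc (R : realType) (x : R) : R :=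
  2 / Num.sqrt pi * Rintegral (mu1 R) `[x, +oo[ (fun s => expR (- s ^+ 2)).

(* Main.v *)
Require Import Defs.
From mathcomp Require Import all_boot all_order all_algebra.
From mathcomp Require Import complex.
From mathcomp Require Import all_classical all_reals all_analysis.
From mathcomp Require Import measurable_realfun.
From mathcomp Require Import ring lra.

Set Implicit Arguments.
Unset Strict Implicit.
Unset Printing Implicit Defensive.

Import Order.TTheory GRing.Theory Num.Theory.
Import numFieldNormedType.Exports.

Local Open Scope classical_set_scope.
Local Open Scope complex_scope.
Local Open Scope ring_scope.

(* Write L = pi R^2.  In the coordinate w = x - i omega, the short-time Fourier
   transform of u is a Gaussian factor times an entire function whose Taylor
   coefficients are moments of u against exp (- pi t^2), and the Hermite
   functions H_k are sent to the monomials w^k.  Monomials are orthogonal on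
   every centered disk, so the H_k are eigenfunctions with eigenvalues
   1 - sum_(j <= k) L^j e^(-L) / j!, and since an L^2 function orthogonal to all
   of them has zero transform, there is no other nonzero eigenvalue.  It remains
   to compare the Poisson distribution function with the Gaussian one: the
   Gamma density s^k e^(-s) / k! is within O(1 / sqrt k) of the normal density of
   mean and variance k in L^1, by Stirling's lower bound for k! and the
   inequality ln (1 + y) <= y - y^2 / 2 + y^3 / 3, while Chebyshev's inequality
   covers the k that are small with respect to L. *)

(** The rate 1 / R rests on a cancellation. Stirling's bound and the cubic bound on [ln] control the
    ratio normal / Gamma from below only, by exp (- (s - k)^3 / (3 k^2)). As the normal mass of the
    half-line is at most the Gamma mass 1, this one-sided control already bounds the squared
    Hellinger distance. The cube enters with its sign, and its Gamma integral is only 5 k + 6, so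
    that distance is O(1 / k); the absolute cube, of order k^(3/2), would only lead to k^(-1/4) in
    L^1. The comparison has variance k, the theorem has variance L; [gauss_tail_rescale] exchanges
    them once k exceeds L / 2. On the analytic side all algebra is done on finite sums: the
    exponential kernel is replaced by a Taylor polynomial with error 2^-N K, uniform on a disk,
    orthogonality of monomials is applied to polynomials, and [geometric_bound_eq] removes the
    truncation. Since [kth_eigenvalue] is a choice among listings, exhibiting eigenvalues does not
    identify it: each eigenspace must be shown to be exactly one-dimensional, and the listing
    unique. *)

Section PointwiseDerivative.
Context {R : realType}.
Implicit Types (f g : R -> R) (x a b : R).

Lemma is_derive_mulf f g x a b : is_derive x 1 f a -> is_derive x 1 g b ->
  is_derive x 1 (fun y : R => f y * g y) (a * g x + f x * b).
Proof.
move=> hf hg; have h := is_deriveM hf hg.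
rewrite (_ : (fun y => _) = f * g)//; apply: is_derive_eq.
by rewrite /GRing.scale /=; ring.
Qed.

Lemma is_derive_addf f g x a b : is_derive x 1 f a -> is_derive x 1 g b ->
  is_derive x 1 (fun y : R => f y + g y) (a + b).
Proof. by move=> hf hg; exact: (is_deriveD hf hg). Qed.

Lemma is_derive_mulcf f x a c : is_derive x 1 f a ->
  is_derive x 1 (fun y : R => c * f y) (c * a).
Proof. by move=> hf; exact: (is_deriveZ c hf). Qed.

Lemma is_derive_expf f x a : is_derive x 1 f a ->
  is_derive x 1 (fun y : R => expR (f y)) (a * expR (f x)).
Proof.
move=> hf; rewrite mulrC.
exact: (@is_derive1_comp _ (@expR R) f x _ a (is_derive_expR (f x)) hf).
Qed.

Lemma is_derive_powf f n x a : is_derive x 1 f a ->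
  is_derive x 1 (fun y : R => f y ^+ n) (n%:R * f x ^+ n.-1 * a).
Proof.
move=> hf; have := is_deriveX n hf.
rewrite (_ : f ^+ n = (fun y : R => f y ^+ n)); last first.
  by apply/funext => y; rewrite exprfctE.
by [].
Qed.

End PointwiseDerivative.

(** * Fundamental theorem of calculus on unbounded intervals *)

Section FTC.
Context {R : realType}.
Notation mu := (@lebesgue_measure R).

Lemma derivable_FTC2 (f F : R -> R) (a b : R) : a < b ->
  (forall x : R, is_derive x 1 F (f x)) -> continuous f ->
  \int[mu]_(x in `[a, b]) f x = F b - F a.
Proof.
move=> ab dF cf.
have cF : continuous F.
  by move=> x; apply/differentiable_continuous/derivable1_diffP; case: (dF x).
rewrite /Rintegral (@continuous_FTC2 R f F a b) //.
- exact: continuous_subspaceT.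
- split=> [x _||]; first by case: (dF x).
  + by apply: cvg_at_right_filter; exact: cF.
  + by apply: cvg_at_left_filter; exact: cF.
- by move=> x _; rewrite derive1E; case: (dF x).
Qed.

(** Dominated convergence for the truncations [f \_ (E n)], with the absolute value of [f] as
    majorant: each point of [D] eventually lies in [E n], so the pointwise limit is stationary. *)
Lemma cvg_Rintegral_exhaust d (T : measurableType d) (nu : {measure set T -> \bar R})
    (f : T -> R) (D : set T) (E : nat -> set T) :
  measurable D -> (forall n, measurable (E n)) -> (forall n, E n `<=` D) ->
  (forall x, D x -> \forall n \near \oo, E n x) ->
  nu.-integrable D (EFin \o f) ->
  \int[nu]_(x in E n) f x @[n --> \oo] --> \int[nu]_(x in D) f x.
Proof.
move=> mD mE ED DE fi.
have fD n : \int[nu]_(x in E n) f x = fine (\int[nu]_(x in D) (EFin \o (f \_ (E n))) x)%E.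
  rewrite /Rintegral; congr fine.
  rewrite -(setIidr (ED n)) integral_mkcondr.
  by apply: eq_integral => x _ /=; rewrite /patch setIidr//; case: ifP.
rewrite (_ : (fun n => _) = fun n => fine (\int[nu]_(x in D) (EFin \o (f \_ (E n))) x)%E); last first.
  by apply/funext.
have mf : measurable_fun D f.
  by move/integrableP : (fi) => [/measurable_EFinP].
have := @dominated_convergence _ _ _ nu D mD (fun n => EFin \o (f \_ (E n)))
  (EFin \o f) (fun x => `|(f x)%:E|%E).
case.
- move=> n; apply/measurable_EFinP/measurable_restrict => //.
  by apply: measurable_funS mf => // x [].
- by apply/measurable_EFinP.
- apply: aeW => x Dx; apply/cvg_EFin; first exact: nearW.
  apply: cvg_near_cst; near=> n; rewrite /= /patch mem_set//.
  by near: n; exact: DE.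
- exact: integrable_abse.
- apply: aeW => x n Dx /=; rewrite lee_fin /patch; case: ifP => // _.
  by rewrite normr0.
- move=> _ _ h; apply: fine_cvg; rewrite /Rintegral fineK//.
  exact: integrable_fin_num.
Unshelve. all: by end_near. Qed.

Lemma derivable_FTC2y (f F : R -> R) (a l : R) :
  (forall x : R, is_derive x 1 F (f x)) -> continuous f ->
  mu.-integrable `[a, +oo[ (EFin \o f) -> F x @[x --> +oo] --> l ->
  \int[mu]_(x in `[a, +oo[) f x = l - F a.
Proof.
move=> dF cf fi Fl.
(* [n.+1] keeps the interval nondegenerate, as [derivable_FTC2] asks for [a < b]. *)
have h1 : \int[mu]_(x in `[a, a + n.+1%:R]) f x @[n --> \oo] -->
    \int[mu]_(x in `[a, +oo[) f x.
  apply: cvg_Rintegral_exhaust => //.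
  - by move=> n; apply: subset_itvl.
  - move=> x /=; rewrite in_itv/= andbT => ax; near=> n.
    rewrite /= in_itv/= ax/= -lerBlDl (@le_trans _ _ n%:R)//; last first.
      by rewrite ler_nat.
    by near: n; exact: nbhs_infty_ger.
apply: (cvg_unique _ h1) => //.
rewrite (_ : (fun n => _) = (fun n => F (a + n.+1%:R) - F a)); last first.
  by apply/funext => n; rewrite (derivable_FTC2 _ dF cf)// ltrDl.
apply: cvgB; last exact: cvg_cst.
apply: (cvg_comp _ F _ Fl).
apply/cvgryPge => r; near=> n.
rewrite -lerBlDl (@le_trans _ _ n%:R)//; last by rewrite ler_nat.
by near: n; exact: nbhs_infty_ger.
Unshelve. all: by end_near. Qed.

Lemma derivable_FTC2T (f F : R -> R) (l : R) :
  (forall x : R, is_derive x 1 F (f x)) -> continuous f ->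
  mu.-integrable setT (EFin \o f) -> F x @[x --> +oo] --> l ->
  F x @[x --> -oo] --> l ->
  \int[mu]_x f x = 0.
Proof.
move=> dF cf fi Fl Fl'.
have h1 : \int[mu]_(x in `[- n.+1%:R, n.+1%:R]) f x @[n --> \oo] -->
    \int[mu]_x f x.
  apply: cvg_Rintegral_exhaust => //.
  move=> x _; near=> n.
  rewrite /= in_itv/= -ler_norml (@le_trans _ _ n%:R)//; last by rewrite ler_nat.
  by near: n; exact: nbhs_infty_ger.
apply: (cvg_unique _ h1) => //.
rewrite (_ : (fun n => _) = (fun n => F n.+1%:R - F (- n.+1%:R))); last first.
  apply/funext => n; rewrite (derivable_FTC2 _ dF cf)//.
  by rewrite (@lt_trans _ _ 0) ?oppr_lt0.
rewrite -(subrr l); apply: cvgB.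
  apply: (cvg_comp _ F _ Fl).
  apply/cvgryPge => r; near=> n.
  rewrite (@le_trans _ _ n%:R)//; last by rewrite ler_nat.
  by near: n; exact: nbhs_infty_ger.
apply: (cvg_comp _ F _ Fl').
apply/cvgrNyPle => r; near=> n.
rewrite lerNl (@le_trans _ _ n%:R)//; last by rewrite ler_nat.
by near: n; exact: nbhs_infty_ger.
Unshelve. all: by end_near. Qed.

End FTC.

(** * Linearity and comparison of real integrals *)

Section Lin.
Context d (T : measurableType d) {R : realType} (nu : {measure set T -> \bar R}).
Context (D : set T) (mD : measurable D).

Lemma integrable_realD (f g : T -> R) : nu.-integrable D (EFin \o f) ->
  nu.-integrable D (EFin \o g) -> nu.-integrable D (EFin \o (fun x => f x + g x)).
Proof. by move=> fi gi; have := integrableD mD fi gi. Qed.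

Lemma integrable_realZ (f : T -> R) (c : R) : nu.-integrable D (EFin \o f) ->
  nu.-integrable D (EFin \o (fun x => c * f x)).
Proof. by move=> fi; have := integrableZl mD c fi. Qed.

Lemma integrable_realB (f g : T -> R) : nu.-integrable D (EFin \o f) ->
  nu.-integrable D (EFin \o g) -> nu.-integrable D (EFin \o (fun x => f x - g x)).
Proof. by move=> fi gi; have := integrableB mD fi gi. Qed.

Lemma integrable_normr (f : T -> R) : nu.-integrable D (EFin \o f) ->
  nu.-integrable D (EFin \o (fun x => `|f x|)).
Proof. by move=> fi; have := integrable_abse fi. Qed.

Lemma ge0_le_Rintegral_subset (E : set T) (f : T -> R) : measurable E -> E `<=` D ->
  (forall x, D x -> 0 <= f x) -> nu.-integrable D (EFin \o f) ->
  \int[nu]_(x in E) f x <= \int[nu]_(x in D) f x.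
Proof.
move=> mE ED f0 fi; rewrite -(setIidr ED) Rintegral_mkcondr.
apply: le_Rintegral => //.
- have h : nu.-integrable D ((EFin \o f) \_ E).
    by apply/integrable_restrict => //; rewrite setIidr//; exact: (integrableS _ _ _ fi).
  by rewrite restrict_EFin in h.
- by move=> x Dx; rewrite /patch; case: ifP => // _; exact: f0.
Qed.

Lemma integrable_lincomb I (s : seq I) (c : I -> R) (f : I -> T -> R) :
  (forall i, nu.-integrable D (EFin \o f i)) ->
  nu.-integrable D (EFin \o (fun x => \sum_(i <- s) c i * f i x)).
Proof.
move=> fi; elim: s => [|i s ih].
  rewrite (_ : _ \o _ = cst 0%E); first exact: integrable0.
  by apply/funext => x /=; rewrite big_nil.
rewrite (_ : _ \o _ = EFin \o (fun x => c i * f i x + \sum_(j <- s) c j * f j x)).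
  by apply: integrable_realD => //; exact: integrable_realZ.
by apply/funext => x /=; rewrite big_cons.
Qed.

Lemma Rintegral_lincomb I (s : seq I) (c : I -> R) (f : I -> T -> R) :
  (forall i, nu.-integrable D (EFin \o f i)) ->
  \int[nu]_(x in D) (\sum_(i <- s) c i * f i x) = \sum_(i <- s) c i * \int[nu]_(x in D) f i x.
Proof.
move=> fi; elim: s => [|i s ih].
  rewrite big_nil -[RHS](mul0r (fine (nu D))).
  under eq_Rintegral do rewrite big_nil.
  by rewrite /Rintegral integral0_eq// mul0r.
rewrite big_cons -ih -RintegralZl// -RintegralD//.
- by apply: eq_Rintegral => x _; rewrite big_cons.
- exact: integrable_realZ.
- exact: integrable_lincomb.
Qed.

Lemma le_integrable_real (f g : T -> R) : measurable_fun D f ->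
  (forall x, D x -> `|f x| <= g x) -> nu.-integrable D (EFin \o g) ->
  nu.-integrable D (EFin \o f).
Proof.
move=> mf fg; apply: le_integrable => //; first exact/measurable_EFinP.
move=> x Dx /=; rewrite lee_fin (le_trans (fg x Dx))//.
exact: ler_norm.
Qed.
End Lin.

(** * The Gamma density and the Poisson distribution function *)

Section Gamma.
Context {R : realType}.
Notation mu := (@lebesgue_measure R).

(** As a function of [s] this is the Gamma density of shape k + 1; as a function of [k] it is the
    Poisson weight of mean s. The sum [gamma_tail] is therefore both a Poisson distribution function
    and a Gamma tail. *)
Definition gamma_pdf (k : nat) (s : R) : R := s ^+ k * expR (- s) / k`!%:R.

Definition gamma_tail (k : nat) (s : R) : R := \sum_(j < k.+1) gamma_pdf j s.

Lemma gamma_pdf_ge0 k s : 0 <= s -> 0 <= gamma_pdf k s.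
Proof.
by move=> s0; rewrite /gamma_pdf divr_ge0// mulr_ge0 ?expR_ge0// exprn_ge0.
Qed.

(** A factor [s] only raises the shape, so every polynomial moment of a Gamma density becomes a
    combination of total masses. *)
Lemma gamma_pdfS k s : s * gamma_pdf k s = k.+1%:R * gamma_pdf k.+1 s.
Proof.
rewrite /gamma_pdf exprS factS natrM invfM.
have : k.+1%:R != 0 :> R by rewrite pnatr_eq0.
by move: (k.+1%:R) (k`!%:R^-1) => a b a0; field.
Qed.

Lemma is_derive_gamma_pdf0 (s : R) : is_derive s 1 (gamma_pdf 0) (- gamma_pdf 0 s).
Proof.
rewrite (_ : gamma_pdf 0 = fun s => expR (-1 * s)); last first.
  by apply/funext => x; rewrite /gamma_pdf expr0 mul1r fact0 divr1 mulN1r.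
apply: (is_derive_eq (is_derive_expf (is_derive_mulcf (-1) (is_derive_id s 1)))).
by rewrite mulr1 !mulN1r.
Qed.

Lemma is_derive_gamma_pdfS k (s : R) :
  is_derive s 1 (gamma_pdf k.+1) (gamma_pdf k s - gamma_pdf k.+1 s).
Proof.
rewrite (_ : gamma_pdf k.+1 = fun s => (k.+1)`!%:R^-1 * (s ^+ k.+1 * expR (-1 * s))).
  apply: (is_derive_eq (is_derive_mulcf _ (is_derive_mulf
    (is_derive_powf k.+1 (is_derive_id s 1))
    (is_derive_expf (is_derive_mulcf (-1) (is_derive_id s 1)))))).
  rewrite /= !mulN1r factS natrM invfM exprS.
  have : k.+1%:R != 0 :> R by rewrite pnatr_eq0.
  rewrite [gamma_pdf k s]/gamma_pdf; move: (k.+1%:R) (k`!%:R^-1) => a b a0.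
  by field.
by apply/funext => x; rewrite /gamma_pdf mulN1r mulrC.
Qed.

(** Each term contributes [gamma_pdf j.-1 - gamma_pdf j], and the sum telescopes. *)
Lemma is_derive_gamma_tail k (s : R) :
  is_derive s 1 (gamma_tail k) (- gamma_pdf k s).
Proof.
rewrite /gamma_tail; elim: k => [|k ih].
  rewrite (_ : (fun s => _) = gamma_pdf 0); first exact: is_derive_gamma_pdf0.
  by apply/funext => x; rewrite big_ord1.
rewrite (_ : (fun s => _) = fun s => (\sum_(j < k.+1) gamma_pdf j s) + gamma_pdf k.+1 s).
  apply: (is_derive_eq (is_derive_addf ih (is_derive_gamma_pdfS _ _))).
  by rewrite addrA addNr sub0r.
by apply/funext => x; rewrite big_ord_recr.
Qed.

Lemma continuous_gamma_pdf k : continuous (gamma_pdf k).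
Proof.
move=> x; apply/differentiable_continuous/derivable1_diffP.
by case: k => [|k]; [case: (is_derive_gamma_pdf0 x)|case: (is_derive_gamma_pdfS k x)].
Qed.

(** By [gamma_pdfS] the density is (k + 1) / s times [gamma_pdf k.+1 s], and the latter is at most
    1, being one term of the exponential series divided by its sum. *)
Lemma gamma_pdf_cvgy k : gamma_pdf k s @[s --> +oo] --> 0.
Proof.
have h : k.+1%:R / s @[s --> +oo] --> (0 : R).
  rewrite -(mulr0 k.+1%:R); apply: cvgM; first exact: cvg_cst.
  by apply/gtr0_cvgV0; [exact: nbhs_pinfty_gt|exact: cvg_id].
apply: (@squeeze_cvgr _ _ _ _ (cst 0) (fun s => k.+1%:R / s)) => //; last exact: cvg_cst.
near=> s.
have s0 : 0 < s by near: s; exact: nbhs_pinfty_gt.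
apply/andP; split; first by rewrite /= gamma_pdf_ge0// ltW.
rewrite ler_pdivlMr// mulrC gamma_pdfS ler_piMr//.
rewrite /gamma_pdf -mulrA mulrCA mulrC expRN ler_pdivrMr ?expR_gt0// mul1r.
by apply: le_trans (expR_ge1Dxn k (ltW s0)); rewrite lerDr.
Unshelve. all: by end_near. Qed.

Lemma gamma_tail_cvgy k : gamma_tail k s @[s --> +oo] --> 0.
Proof.
rewrite (_ : 0 = \sum_(j < k.+1) (0:R)); last by rewrite big1.
by apply: cvg_big => [|i _]; [exact: add_continuous|exact: gamma_pdf_cvgy].
Qed.

Lemma integral_gamma_pdfy k (a : R) : 0 <= a ->
  (\int[mu]_(s in `[a, +oo[) (gamma_pdf k s)%:E = (gamma_tail k a)%:E)%E.
Proof.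
move=> a0.
rewrite (@ge0_continuous_FTC2y _ (gamma_pdf k) (fun s => -1 * gamma_tail k s) a 0).
- by rewrite -EFinB sub0r mulN1r opprK.
- by move=> x ax; apply: gamma_pdf_ge0; exact: le_trans ax.
- exact/continuous_subspaceT/continuous_gamma_pdf.
- rewrite -(mulr0 (-1)); apply: cvgM; first exact: cvg_cst.
  exact: gamma_tail_cvgy.
- by move=> x _; case: (is_derive_mulcf (-1) (is_derive_gamma_tail k x)).
- apply: cvg_at_right_filter; apply: cvgM; first exact: cvg_cst.
  apply/differentiable_continuous/derivable1_diffP.
  by case: (is_derive_gamma_tail k a).
- move=> x _; rewrite derive1E.
  by case: (is_derive_mulcf (-1) (is_derive_gamma_tail k x)) => _ ->; rewrite mulN1r opprK.
Qed.

Lemma integrable_gamma_pdf k (a : R) : 0 <= a ->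
  mu.-integrable `[a, +oo[ (EFin \o gamma_pdf k).
Proof.
move=> a0; apply/integrableP; split.
  apply/measurable_EFinP; apply: measurable_funTS.
  by apply: continuous_measurable_fun; exact: continuous_gamma_pdf.
rewrite (_ : integral _ _ _ = (gamma_tail k a)%:E) ?ltry// -integral_gamma_pdfy//.
apply: eq_integral => x; rewrite inE /= in_itv /= andbT => ax.
by rewrite ger0_norm// gamma_pdf_ge0// (le_trans a0).
Qed.

Lemma Rintegral_gamma_pdfy k (a : R) : 0 <= a ->
  \int[mu]_(s in `[a, +oo[) gamma_pdf k s = gamma_tail k a.
Proof. by move=> a0; rewrite /Rintegral integral_gamma_pdfy. Qed.

Lemma gamma_tail0 k : gamma_tail k 0 = 1.
Proof.
rewrite /gamma_tail big_ord_recl big1 ?addr0 => [|i _].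
  by rewrite /gamma_pdf expr0 oppr0 expR0 fact0 mul1r divr1.
by rewrite /gamma_pdf /bump /= exprS !mul0r.
Qed.

Lemma Rintegral_gamma_pdf k (a : R) : 0 < a ->
  \int[mu]_(s in `[0, a]) gamma_pdf k s = 1 - gamma_tail k a.
Proof.
move=> a0.
have dF (x : R) : is_derive x 1 (fun s => -1 * gamma_tail k s) (gamma_pdf k x).
  apply: (is_derive_eq (is_derive_mulcf _ (is_derive_gamma_tail k x))).
  by rewrite mulN1r opprK.
rewrite (derivable_FTC2 a0 dF (@continuous_gamma_pdf k)).
by rewrite gamma_tail0 mulr1 opprK mulN1r addrC.
Qed.

(** The square is expanded in powers of s, which [gamma_pdfS] absorbs. The result is written as a
    sum over a list of pairs (coefficient, shape) so that [Rintegral_lincomb] integrates it in one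
    step. *)
Lemma sqr_gamma_pdf (k : nat) (s : R) : (s - k%:R) ^+ 2 * gamma_pdf k s =
  \sum_(c <- [:: ((k%:R + 1) * (k%:R + 2), k.+2); (- 2 * k%:R * (k%:R + 1), k.+1);
                 (k%:R ^+ 2, k)]) c.1 * gamma_pdf c.2 s.
Proof.
have h1 := gamma_pdfS k s; have h2 := gamma_pdfS k.+1 s.
rewrite -[k.+2%:R]natr1 -!natr1 in h1 h2.
rewrite !big_cons big_nil /= addr0.
have -> : (k%:R + 1) * (k%:R + 2) * gamma_pdf k.+2 s = s * (s * gamma_pdf k s).
  transitivity ((k%:R + 1) * (s * gamma_pdf k.+1 s)); first by rewrite h2; ring.
  by rewrite h1; ring.
have -> : - 2 * k%:R * (k%:R + 1) * gamma_pdf k.+1 s = - 2 * k%:R * (s * gamma_pdf k s).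
  by rewrite h1; ring.
ring.
Qed.

Lemma cube_gamma_pdf (k : nat) (s : R) : (s - k%:R) ^+ 3 * gamma_pdf k s =
  \sum_(c <- [:: ((k%:R + 1) * (k%:R + 2) * (k%:R + 3), k.+3);
                 (- 3 * k%:R * (k%:R + 1) * (k%:R + 2), k.+2);
                 (3 * k%:R ^+ 2 * (k%:R + 1), k.+1);
                 (- k%:R ^+ 3, k)]) c.1 * gamma_pdf c.2 s.
Proof.
have h1 := gamma_pdfS k s; have h2 := gamma_pdfS k.+1 s; have h3 := gamma_pdfS k.+2 s.
rewrite -!natr1 in h1 h2 h3.
rewrite !big_cons big_nil /= addr0.
have -> : (k%:R + 1) * (k%:R + 2) * (k%:R + 3) * gamma_pdf k.+3 s =
    s * (s * (s * gamma_pdf k s)).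
  transitivity ((k%:R + 1) * (k%:R + 2) * (s * gamma_pdf k.+2 s)); first by rewrite h3; ring.
  transitivity ((k%:R + 1) * s * (s * gamma_pdf k.+1 s)); first by rewrite h2; ring.
  by rewrite h1; ring.
have -> : - 3 * k%:R * (k%:R + 1) * (k%:R + 2) * gamma_pdf k.+2 s =
    - 3 * k%:R * (s * (s * gamma_pdf k s)).
  transitivity (- 3 * k%:R * (k%:R + 1) * (s * gamma_pdf k.+1 s)); first by rewrite h2; ring.
  by rewrite h1; ring.
have -> : 3 * k%:R ^+ 2 * (k%:R + 1) * gamma_pdf k.+1 s = 3 * k%:R ^+ 2 * (s * gamma_pdf k s).
  by rewrite h1; ring.
ring.
Qed.

(** All masses [gamma_tail j 0] are 1, so the moment is the sum of the coefficients. The center is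
    k, the mode and the mean of the normal density to be compared, whereas the Gamma mean is k +
    1. *)
Lemma gamma_pdf_moment2 (k : nat) :
  mu.-integrable `[0, +oo[ (EFin \o (fun s => (s - k%:R) ^+ 2 * gamma_pdf k s)) /\
  \int[mu]_(s in `[0, +oo[) ((s - k%:R) ^+ 2 * gamma_pdf k s) = k%:R + 2.
Proof.
have /funext E := sqr_gamma_pdf k; rewrite E.
have h (c : R * nat) : mu.-integrable `[0, +oo[ (EFin \o gamma_pdf c.2).
  exact: integrable_gamma_pdf.
split; first exact: integrable_lincomb.
rewrite Rintegral_lincomb// !big_cons big_nil /= !Rintegral_gamma_pdfy// !gamma_tail0.
ring.
Qed.

Lemma gamma_pdf_moment3 (k : nat) :
  mu.-integrable `[0, +oo[ (EFin \o (fun s => (s - k%:R) ^+ 3 * gamma_pdf k s)) /\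
  \int[mu]_(s in `[0, +oo[) ((s - k%:R) ^+ 3 * gamma_pdf k s) = 5 * k%:R + 6.
Proof.
have /funext E := cube_gamma_pdf k; rewrite E.
have h (c : R * nat) : mu.-integrable `[0, +oo[ (EFin \o gamma_pdf c.2).
  exact: integrable_gamma_pdf.
split; first exact: integrable_lincomb.
rewrite Rintegral_lincomb// !big_cons big_nil /= !Rintegral_gamma_pdfy// !gamma_tail0.
ring.
Qed.

End Gamma.

(** * Gaussian moments and the central binomial coefficient *)

Section GaussianMoments.
Context {R : realType}.
Notation mu := (@lebesgue_measure R).

Definition gauss_mono (c : R) (n : nat) (t : R) : R := t ^+ n * expR (- (c * t ^+ 2)).

Lemma is_derive_gauss_mono c n (t : R) : is_derive t 1 (gauss_mono c n)
  (n%:R * gauss_mono c n.-1 t - 2 * c * gauss_mono c n.+1 t).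
Proof.
rewrite (_ : gauss_mono c n = fun t => t ^+ n * expR (- c * t ^+ 2)); last first.
  by apply/funext => x; rewrite /gauss_mono mulNr.
apply: (is_derive_eq (is_derive_mulf (is_derive_powf n (is_derive_id t 1))
  (is_derive_expf (is_derive_mulcf (- c) (is_derive_powf 2 (is_derive_id t 1)))))).
by rewrite /gauss_mono mulNr (exprS t n) /= expr1; ring.
Qed.

Lemma continuous_gauss_mono c n : continuous (gauss_mono c n).
Proof.
move=> x; apply/differentiable_continuous/derivable1_diffP.
by case: (is_derive_gauss_mono c n x).
Qed.

Lemma integrable_gauss (c : R) : 0 < c ->
  mu.-integrable setT (EFin \o (fun t => expR (- (c * t ^+ 2)))).
Proof.
move=> c0; pose s := (Num.sqrt (c *+ 2))^-1.
have c20 : 0 < c *+ 2 by rewrite pmulrn_lgt0.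
have s0 : s != 0 by rewrite invr_eq0 gt_eqF// sqrtr_gt0.
have h : mu.-integrable setT (EFin \o normal_pdf 0 s) := integrable_normal_pdf 0 s.
have e : normal_pdf 0 s = fun t => normal_peak s * expR (- (c * t ^+ 2)).
  apply/funext => t; rewrite normal_pdfE//; congr (_ * expR _).
  rewrite subr0 /s exprVn sqr_sqrtr ?ltW// -[c *+ 2]mulr_natr -[_ *+ 2]mulr_natr.
  by field; rewrite gt_eqF.
rewrite e in h; move: h => /(integrable_realZ measurableT (normal_peak s)^-1).
rewrite (_ : (fun x => _) = (fun t => expR (- (c * t ^+ 2))))//.
by apply/funext => t; rewrite mulrA mulVf ?mul1r// gt_eqF// normal_peak_gt0.
Qed.

Lemma ler_pow_expR n (t : R) : 0 <= t -> t ^+ n <= n`!%:R * expR t.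
Proof.
move=> t0; case: n => [|n].
  by rewrite expr0 fact0 mul1r -[leLHS]expR0 ler_expR.
rewrite mulrC -ler_pdivrMr ?ltr0n ?fact_gt0//.
by apply: le_trans (expR_ge1Dxn n t0); rewrite lerDr.
Qed.

(** Completing the square: the sides differ by (b - c |t|)^2 / (2 c). Half of the Gaussian decay
    pays for any growth exp (b |t|). *)
Lemma gauss_linear_le (c b t : R) : 0 < c ->
  - (c * t ^+ 2) + b * `|t| <= b ^+ 2 / (2 * c) - c / 2 * t ^+ 2.
Proof.
move=> c0; rewrite -(real_normK (num_real t)); move: `|t| => u.
rewrite -subr_ge0.
have -> : b ^+ 2 / (2 * c) - c / 2 * u ^+ 2 - (- (c * u ^+ 2) + b * u)
   = (b - c * u) ^+ 2 / (2 * c) by field; rewrite gt_eqF.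
by rewrite divr_ge0 ?sqr_ge0// mulr_ge0// ltW.
Qed.

Lemma integrable_gauss_linear (c b : R) : 0 < c ->
  mu.-integrable setT (EFin \o (fun t => expR (- (c * t ^+ 2) + b * `|t|))).
Proof.
move=> c0; apply: (le_integrable_real measurableT _ _
  (integrable_realZ measurableT (expR (b ^+ 2 / (2 * c))) (@integrable_gauss (c / 2) _))).
- apply: measurableT_comp => //; apply: measurable_funD; last exact: measurable_funM.
  by apply: measurableT_comp => //; apply: measurable_funM => //; exact: measurable_funX.
- move=> x _; rewrite ger0_norm ?expR_ge0// -expRD ler_expR.
  exact: gauss_linear_le.
- by rewrite divr_gt0.
Qed.

Lemma integrable_gauss_mono (c b : R) n : 0 < c ->
  mu.-integrable setT (EFin \o (fun t => t ^+ n * expR (- (c * t ^+ 2) + b * `|t|))).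
Proof.
move=> c0; apply: (le_integrable_real measurableT _ _
  (integrable_realZ measurableT n`!%:R (@integrable_gauss_linear c (b + 1) c0))).
- apply: measurable_funM; first exact: measurable_funX.
  apply: measurableT_comp => //; apply: measurable_funD; last exact: measurable_funM.
  by apply: measurableT_comp => //; apply: measurable_funM => //; exact: measurable_funX.
- move=> x _; rewrite normrM normrX [X in _ * X]ger0_norm ?expR_ge0//.
  rewrite mulrDl mul1r addrA [X in _ <= _ * X]expRD.
  move: (expR (_ + b * _)) (expR_ge0 (- (c * x ^+ 2) + b * `|x|)).
  move=> E E0; rewrite (mulrC E) mulrA ler_wpM2r//.
  exact: ler_pow_expR.
Qed.

Lemma integrable_gauss_monoT (c : R) n : 0 < c ->
  mu.-integrable setT (EFin \o gauss_mono c n).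
Proof.
move=> c0; have := integrable_gauss_mono 0 n c0.
rewrite (_ : (fun t => _) = gauss_mono c n)//.
by apply/funext => t; rewrite mul0r addr0.
Qed.

(** [gauss_linear_le] with slope 1 puts the Gaussian below a multiple of exp (- t), so decay at
    infinity is inherited from [gamma_pdf_cvgy]. *)
Lemma gauss_mono_le (c t : R) n : 0 < c -> 0 <= t ->
  gauss_mono c n t <= n`!%:R * expR ((2 * c)^-1) * gamma_pdf n t.
Proof.
move=> c0 t0; rewrite /gamma_pdf /gauss_mono.
rewrite (_ : n`!%:R * _ * _ = t ^+ n * (expR ((2 * c)^-1) * expR (- t))); last first.
  by field; rewrite pnatr_eq0 -lt0n fact_gt0.
rewrite ler_wpM2l ?exprn_ge0// -expRD ler_expR.
have := gauss_linear_le 1 t c0.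
rewrite ger0_norm// expr1n mul1r mul1r lerBrDr => h.
rewrite lerBrDr; apply: le_trans h.
by rewrite lerDl mulr_ge0 ?sqr_ge0// divr_ge0// ltW.
Qed.

Lemma gauss_mono_cvgy (c : R) n : 0 < c -> gauss_mono c n t @[t --> +oo] --> 0.
Proof.
move=> c0; apply: (@squeeze_cvgr _ _ _ _ (cst 0)
  (fun t => n`!%:R * expR ((2 * c)^-1) * gamma_pdf n t)); last 2 first.
- exact: cvg_cst.
- rewrite -(mulr0 (n`!%:R * expR ((2 * c)^-1))); apply: cvgM; first exact: cvg_cst.
  exact: gamma_pdf_cvgy.
near=> t.
have t0 : 0 <= t by near: t; exact: nbhs_pinfty_ge.
apply/andP; split; last exact: gauss_mono_le.
by rewrite /= mulr_ge0 ?expR_ge0// exprn_ge0.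
Unshelve. all: by end_near. Qed.

Lemma gauss_monoN (c : R) n t : gauss_mono c n (- t) = (- 1) ^+ n * gauss_mono c n t.
Proof. have e : (- t) ^+ 2 = t ^+ 2 by rewrite sqrrN.
by rewrite /gauss_mono e (exprNn t n) -mulrA. Qed.

Lemma gauss_mono_cvgNy (c : R) n : 0 < c -> gauss_mono c n t @[t --> -oo] --> 0.
Proof.
move=> c0; apply/cvgyNP.
rewrite (_ : (fun t => _) = (fun t => (- 1) ^+ n * gauss_mono c n t)); last first.
  by apply/funext => t /=; rewrite gauss_monoN.
have : (- 1) ^+ n * gauss_mono c n t @[t --> +oo] --> (- 1) ^+ n * (0 : R).
  by apply: cvgM; [exact: cvg_cst|exact: gauss_mono_cvgy].
by rewrite mulr0.
Qed.

(** The derivative of [gauss_mono c n] integrates to 0 over the line. At n = 0 the truncated index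
    [n.-1] is multiplied by 0. *)
Lemma Rintegral_gauss_mono_rec (c : R) n : 0 < c ->
  2 * c * \int[mu]_t gauss_mono c n.+1 t = n%:R * \int[mu]_t gauss_mono c n.-1 t.
Proof.
move=> c0; apply/eqP; rewrite eq_sym -subr_eq0; apply/eqP.
rewrite -RintegralZl//; last exact: integrable_gauss_monoT.
rewrite -RintegralZl//; last exact: integrable_gauss_monoT.
rewrite -RintegralB//; [|exact/integrable_realZ/integrable_gauss_monoT..].
apply: (derivable_FTC2T (F := gauss_mono c n) (l := 0)).
- exact: is_derive_gauss_mono.
- move=> x; apply: cvgB; apply: cvgM; (try exact: cvg_cst); exact: continuous_gauss_mono.
- rewrite (_ : (fun x => _) = (fun x => n%:R * gauss_mono c n.-1 x + (- (2 * c)) * gauss_mono c n.+1 x)).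
    by apply: integrable_realD => //; apply/integrable_realZ => //; exact: integrable_gauss_monoT.
  by apply/funext => x; rewrite mulNr.
- exact: gauss_mono_cvgy.
- exact: gauss_mono_cvgNy.
Qed.

(** This is Gamma ((n + 1) / 2) / 2. Odd indices give factorials and even ones carry sqrt pi, so
    log-convexity between neighbours relates pi to factorials. *)
Definition half_moment n : R := \int[mu]_(t in `[0, +oo[) gauss_mono 1 n t.

Lemma integrable_half_moment n :
  mu.-integrable `[0, +oo[ (EFin \o gauss_mono 1 n).
Proof.
by apply: (integrableS measurableT) => //; exact: integrable_gauss_monoT.
Qed.

Lemma half_moment_rec n :
  2 * half_moment n.+1 = (n == 0)%:R + n%:R * half_moment n.-1.
Proof.
have h : \int[mu]_(t in `[0, +oo[) (n%:R * gauss_mono 1 n.-1 t + (- 2) * gauss_mono 1 n.+1 t) =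
    0 - gauss_mono 1 n 0.
  apply: (derivable_FTC2y (F := gauss_mono 1 n)).
  - by move=> x; apply: (is_derive_eq (is_derive_gauss_mono 1 n x)); ring.
  - move=> x; apply: cvgD; apply: cvgM; (try exact: cvg_cst); exact: continuous_gauss_mono.
  - by apply: integrable_realD => //; apply/integrable_realZ => //; exact: integrable_half_moment.
  - exact: gauss_mono_cvgy.
rewrite RintegralD// in h; [|exact/integrable_realZ/integrable_half_moment..].
rewrite !RintegralZl// in h; [|exact/integrable_half_moment..].
have e : gauss_mono 1 n 0 = (n == 0)%:R.
  by rewrite /gauss_mono expr0n expr0n mulr0 oppr0 expR0 mulr1.
rewrite e -!/(half_moment _) in h.
by move: h; rewrite mulNr => /eqP; rewrite subr_eq => /eqP ->; ring.
Qed.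

Lemma half_moment0 : half_moment 0 = Num.sqrt pi / 2.
Proof.
rewrite /half_moment /Rintegral -[RHS]/(fine (Num.sqrt pi / 2)%:E) -integral0y_gauss.
by congr fine; apply: eq_integral => t _; rewrite /gauss_mono expr0 !mul1r.
Qed.

Lemma half_moment_odd j : half_moment j.*2.+1 = j`!%:R / 2.
Proof.
elim: j => [|j ih]; first by have := half_moment_rec 0; rewrite /= mul0r addr0 double0 fact0 => h; lra.
have := half_moment_rec j.+1.*2; rewrite /= doubleS /= ih add0r factS natrM => h.
have e : (j.*2.+2)%:R = 2 * j.+1%:R :> R by rewrite -natrM mul2n doubleS.
by rewrite e in h; lra.
Qed.

Lemma half_moment_even j : half_moment j.*2 = Num.sqrt pi / 2 * (j.*2)`!%:R / (4 ^+ j * j`!%:R).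
Proof.
elim: j => [|j ih]; first by rewrite half_moment0 fact0 expr0 !mulr1 divr1.
have := half_moment_rec j.*2.+1; rewrite /= -doubleS ih add0r => h.
have -> : half_moment j.+1.*2 = (2 * half_moment j.+1.*2) / 2 by field.
rewrite h doubleS !factS !natrM exprS.
have e : (j.*2.+2)%:R = 2 * j.+1%:R :> R by rewrite -natrM mul2n doubleS.
rewrite e; field.
by rewrite pnatr_eq0 -lt0n fact_gt0 nat1r pnatr_eq0 /= expf_neq0// pnatr_eq0.
Qed.

(** The integral of (t - x)^2 t^n exp (- t^2) is nonnegative; [x] is chosen as the minimizer of this
    quadratic. *)
Lemma half_moment_logconvex n : 0 < half_moment n ->
  half_moment n.+1 ^+ 2 <= half_moment n * half_moment n.+2.
Proof.
move=> h0; pose x := half_moment n.+1 / half_moment n.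
have : 0 <= \int[mu]_(t in `[0, +oo[) (gauss_mono 1 n.+2 t + (- 2 * x * gauss_mono 1 n.+1 t
    + x ^+ 2 * gauss_mono 1 n t)).
  apply: Rintegral_ge0 => t; rewrite /= in_itv /= andbT => t0.
  rewrite (_ : _ + _ = (t - x) ^+ 2 * gauss_mono 1 n t).
    by rewrite mulr_ge0 ?sqr_ge0// mulr_ge0 ?expR_ge0// exprn_ge0.
  by rewrite /gauss_mono !exprS; ring.
have hi := integrable_half_moment.
rewrite RintegralD//; last first.
  by apply: integrable_realD => //; apply: integrable_realZ.
rewrite RintegralD//; [|by apply: integrable_realZ..].
rewrite !RintegralZl// -!/(half_moment _).
have -> : half_moment n.+2 + (- 2 * x * half_moment n.+1 + x ^+ 2 * half_moment n)
    = (half_moment n * half_moment n.+2 - half_moment n.+1 ^+ 2) / half_moment n.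
  by rewrite /x; field; rewrite gt_eqF.
by rewrite pmulr_lge0 ?invr_gt0// subr_ge0.
Qed.

(** Wallis's bound binomial (2 j, j) <= 4^j / sqrt (pi j), squared and cleared of denominators. It
    is log-convexity of the half-line moments at the indices 2 j - 1, 2 j, 2 j + 1. *)
Lemma central_binomial_le j : (0 < j)%N ->
  pi * j%:R * (j.*2)`!%:R ^+ 2 <= 16 ^+ j * j`!%:R ^+ 4 :> R.
Proof.
case: j => // m _.
have f0 (i : nat) : 0 < i`!%:R :> R by rewrite ltr0n fact_gt0.
have := @half_moment_logconvex m.*2.+1; rewrite -doubleS half_moment_odd half_moment_even.
rewrite half_moment_odd divr_gt0// => /(_ isT).
have -> : 16 ^+ m.+1 = (4 ^+ m.+1) ^+ 2 :> R by rewrite exprAC; congr (_ ^+ _); ring.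
have : 0 < 4 ^+ m.+1 :> R by rewrite exprn_gt0.
have m0 : 0 < m.+1%:R :> R by rewrite ltr0n.
move: (4 ^+ _) (m.+1.*2)`!%:R => q F q0.
rewrite factS natrM; have := f0 m; move: m`!%:R m.+1%:R m0 => a n n0 a0.
have -> : (Num.sqrt pi / 2 * F / (q * (n * a))) ^+ 2 =
   (Num.sqrt pi) ^+ 2 * F ^+ 2 / (2 * q * n * a) ^+ 2 :> R.
  by field; rewrite !gt_eqF.
rewrite sqr_sqrtr ?pi_ge0// ler_pdivrMr; last by rewrite exprn_gt0// !mulr_gt0.
move=> h; have := ler_wpM2l (ltW n0) h.
rewrite mulrA [n * pi]mulrC => /le_trans; apply.
by rewrite le_eqVlt; apply/orP; left; apply/eqP; field.
Qed.

End GaussianMoments.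

(** * Stirling's lower bound for the factorial *)

Section Stirling.
Context {R : realType}.

(** The logarithm of m! divided by sqrt (2 pi m) (m / e)^m. *)
Definition stirling_gap (m : nat) : R :=
  ln m`!%:R + m%:R - (m%:R + 2^-1) * ln m%:R - 2^-1 * ln (2 * pi).

Let f0 (i : nat) : 0 < i`!%:R :> R. Proof. by rewrite ltr0n fact_gt0. Qed.

(** The logarithm of [central_binomial_le]: the constant 2 pi in the gap is exactly the one for
    which the powers of 2 and pi cancel. *)
Lemma stirling_gap_double m : (0 < m)%N ->
  stirling_gap m.*2 <= 2 * stirling_gap m.
Proof.
move=> m0.
have m0' : 0 < m%:R :> R by rewrite ltr0n.
have pi0 := pi_gt0 R.
have := @central_binomial_le R m m0.
rewrite -ler_ln ?posrE; last 2 first.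
- by rewrite !mulr_gt0// exprn_gt0.
- by rewrite mulr_gt0// exprn_gt0.
rewrite !lnM ?posrE ?mulr_gt0 ?exprn_gt0//.
rewrite !lnXn ?f0// -[16]/((2 ^ 4)%N%:R) natrX !lnXn//.
rewrite /stirling_gap -mul2n natrM !lnM ?posrE//.
rewrite -[ln 2 *+ 4]mulr_natr -[_ * 4 *+ m]mulr_natr.
move: (ln m`!%:R) (ln (2 * m)`!%:R) (ln pi) (ln m%:R) (ln 2) => a b p l t h.
rewrite -subr_ge0.
have -> : 2 * (a + m%:R - (m%:R + 2^-1) * l - 2^-1 * (t + p)) -
  (b + 2 * m%:R - (2 * m%:R + 2^-1) * (t + l) - 2^-1 * (t + p)) =
  2^-1 * (t * 4 * m%:R + (a + (a + (a + a))) - (p + l + (b + b))) by field.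
by rewrite mulr_ge0// subr_ge0.
Qed.

(** One term of the series of exp m gives m^m <= m! e^m. The loss is logarithmic in m, which the
    doubling argument can afford. *)
Lemma stirling_gap_crude m : (0 < m)%N -> - (2^-1 * ln (2 * pi * m%:R)) <= stirling_gap m.
Proof.
move=> m0; have m0' : 0 < m%:R :> R by rewrite ltr0n.
have pi0 := pi_gt0 R.
have : ln (m%:R ^+ m) <= ln (m`!%:R * expR m%:R) :> R.
  by rewrite ler_ln ?posrE ?mulr_gt0 ?exprn_gt0 ?expR_gt0//; exact: ler_pow_expR.
rewrite lnXn// lnM ?posrE ?expR_gt0// expRK -[ln m%:R *+ m]mulr_natr /stirling_gap.
rewrite [ln (2 * pi * _)]lnM ?posrE ?mulr_gt0//.
move: (ln m%:R) (ln (2 * pi)) (ln m`!%:R) => a b c h.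
lra.
Qed.

(** A negative gap -d at m would be at most -2^i d at 2^i m by doubling, while [stirling_gap_crude]
    only allows it to decrease linearly in i. *)
Lemma stirling_gap_ge0 m : (0 < m)%N -> 0 <= stirling_gap m.
Proof.
move=> m0; have m0' : 0 < m%:R :> R by rewrite ltr0n.
have pi0 := pi_gt0 R.
have h i : stirling_gap (2 ^ i * m) <= 2 ^+ i * stirling_gap m.
  elim: i => [|i ih]; first by rewrite expn0 mul1n expr0 mul1r.
  rewrite expnS -mulnA mul2n exprS -mulrA.
  apply: le_trans (stirling_gap_double _) _; first by rewrite muln_gt0 expn_gt0.
  by rewrite ler_wpM2l.
rewrite leNgt; apply/negP => neg.
pose d := - stirling_gap m; have d0 : 0 < d by rewrite oppr_gt0.
pose c : R := ln 2 + `|ln (2 * pi * m%:R)|.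
(* Doubling 2 i times produces (2^i)^2 >= (i + 1)^2, which beats a bound linear in i using only i +
   1 <= 2^i. *)
have key i : i.+1%:R * d <= c.
  have := le_trans (stirling_gap_crude (_ : (0 < 2 ^ (i + i) * m)%N)) (h (i + i)%N).
  rewrite muln_gt0 expn_gt0 m0 => /(_ isT).
  rewrite natrM natrX mulrCA lnM ?posrE ?exprn_gt0 ?mulr_gt0// lnXn// -[ln 2 *+ _]mulr_natr.
  have -> : 2 ^+ (i + i) * stirling_gap m = - ((2 ^+ i) ^+ 2 * d).
    by rewrite /d exprD expr2; ring.
  rewrite lerN2 => h1.
  have h2 : i.+1%:R <= 2 ^+ i :> R by rewrite -natrX ler_nat ltn_expl.
  have h3 : i.+1%:R ^+ 2 * d <= (2 ^+ i) ^+ 2 * d.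
    by rewrite ler_wpM2r ?(ltW d0)// ler_pXn2r ?nnegrE.
  have h4 := ler_norm (ln (2 * pi * m%:R) : R).
  have l2 : 0 <= ln 2 :> R by rewrite ln_ge0// ler1n.
  have h5 : i.+1%:R * (i.+1%:R * d) <= i.+1%:R * c.
    rewrite mulrA -expr2; apply: (le_trans h3); apply: (le_trans h1).
    have aux (x y z w : R) : 0 <= x -> y <= z -> 0 <= w -> 0 <= z ->
        2^-1 * (x * (w + w) + y) <= (w + 1) * (x + z).
      move=> x0 yz w0 z0; have := mulr_ge0 w0 z0; nra.
    by rewrite (natrD _ i i) -(natr1 i); apply: aux.
  by rewrite ler_pM2l ?ltr0n// in h5.
have := archi_boundP (_ : 0 <= c / d).
have c0 : 0 <= c / d.
  by rewrite divr_ge0 ?(ltW d0)// addr_ge0// ln_ge0// ler1n.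
move=> /(_ c0); rewrite ltr_pdivrMr// => h1.
have := key (Num.bound (c / d)); rewrite leNgt => /negP; apply.
by apply: lt_le_trans h1 _; rewrite ler_pM2r// ler_nat.
Qed.

End Stirling.

(** * Gaussian tails and the complementary error function *)

Section Erfc.
Context {R : realType}.
Notation mu := (@lebesgue_measure R).

Definition gauss_tail (x : R) : R := \int[mu]_(s in `[x, +oo[) gauss_fun s.

Lemma erfcE (x : R) : erfc x = 2 / Num.sqrt pi * gauss_tail x.
Proof. by []. Qed.

Lemma integrable_gauss_fun (D : set R) : measurable D ->
  mu.-integrable D (EFin \o gauss_fun).
Proof. by move=> mD; apply: (integrableS measurableT) => //; exact: integrableT_gauss. Qed.

Lemma gauss_tail_ge0 x : 0 <= gauss_tail x.
Proof. by apply: Rintegral_ge0 => s _; exact: gauss_fun_ge0. Qed.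

Lemma gauss_tailB a b : a <= b ->
  gauss_tail a - gauss_tail b = \int[mu]_(s in `[a, b[) gauss_fun s.
Proof.
move=> ab; rewrite /gauss_tail.
have -> : `[a, +oo[%classic = `[a, b[ `|` `[b, +oo[ :> set R.
  by rewrite -itv_bndbnd_setU// bnd_simp.
rewrite Rintegral_setU//.
- by rewrite addrK.
- by apply: integrable_gauss_fun; exact: measurableU.
- apply/disj_setPS => x [] /=; rewrite !in_itv/= andbT => /andP[_ xb] bx.
  by move: xb; rewrite ltNge bx.
Qed.

Lemma gauss_tailB_bounds a b (M : R) : a <= b ->
  (forall s, a <= s <= b -> gauss_fun s <= M) ->
  0 <= gauss_tail a - gauss_tail b <= M * (b - a).
Proof.
move=> ab hM; rewrite gauss_tailB//; apply/andP; split.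
  by apply: Rintegral_ge0 => s _; exact: gauss_fun_ge0.
have -> : M * (b - a) = \int[mu]_(s in `[a, b[) (cst M) s.
  rewrite Rintegral_cst//; congr (_ * _); rewrite -[RHS]/(fine (lebesgue_measure _)).
  rewrite lebesgue_measure_itv /= lte_fin.
  by case: ltgtP ab => // -> _; rewrite subrr.
apply: le_Rintegral => //.
- exact: integrable_gauss_fun.
- apply: measurable_bounded_integrable => //.
  + by rewrite /= lebesgue_measure_itv /=; case: ifP => // _; rewrite -EFinB ltry.
  + exact: bounded_cst.
- by move=> s; rewrite /= in_itv/= => /andP[as_ /ltW sb]; apply: hM; rewrite as_ sb.
Qed.

Lemma gauss_tail_symm x : gauss_tail x + gauss_tail (- x) = Num.sqrt pi.
Proof.
have e : \int[mu]_x gauss_fun x = Num.sqrt pi by rewrite /Rintegral integralT_gauss.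
rewrite -e.
have -> : [set: R] = `]-oo, - x[ `|` `[- x, +oo[.
  apply/seteqP; split => // y _ /=; rewrite !in_itv/= andbT.
  by case: (ltP y (- x)) => h; [left|right].
rewrite Rintegral_setU//; last 2 first.
- by apply: integrable_gauss_fun; exact: measurableU.
- apply/disj_setPS => y [] /=; rewrite !in_itv/= andbT => yx xy.
  by move: yx; rewrite ltNge xy.
congr (_ + _).
rewrite Rintegral_itv_bndo_bndc; last by apply: (integrable_gauss_fun).
have := @ge0_integration_by_substitutionNy R gauss_fun x.
rewrite /gauss_tail /Rintegral => ->.
- by congr fine; apply: eq_integral => s _ /=; rewrite /gauss_fun /= sqrrN.
- by apply: continuous_subspaceT; exact: continuous_gauss_fun.
- by move=> s _; exact: gauss_fun_ge0.
Qed.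

(** Mills' bound: s / x >= 1 on the half-line, and s exp (- s^2) has an explicit primitive. *)
Lemma gauss_tail_le x : 0 < x -> gauss_tail x <= (2 * x)^-1.
Proof.
move=> x0.
have h : \int[mu]_(s in `[x, +oo[) (1 * gauss_mono 1 1 s) = 0 - (- 2^-1 * gauss_mono 1 0 x).
  apply: (@derivable_FTC2y _ (fun s => 1 * gauss_mono 1 1 s) (fun s => (- 2^-1 * gauss_mono 1 0 s)) x 0).
  - move=> s; apply: (is_derive_eq (is_derive_mulcf _ (is_derive_gauss_mono 1 0 s))).
    by field.
  - by move=> s; apply: cvgM; [exact: cvg_cst|exact: continuous_gauss_mono].
  - apply/integrable_realZ => //; apply: (integrableS measurableT) => //.
    exact: integrable_gauss_monoT.
  - have : - 2^-1 * gauss_mono 1 0 s @[s --> +oo] --> - 2^-1 * (0 : R).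
      by apply: cvgM; [exact: cvg_cst|exact: gauss_mono_cvgy].
    by rewrite mulr0.
have i1 : mu.-integrable `[x, +oo[ (EFin \o gauss_mono 1 1).
  by apply: (integrableS measurableT) => //; exact: integrable_gauss_monoT.
have : gauss_tail x <= \int[mu]_(s in `[x, +oo[) (x^-1 * gauss_mono 1 1 s).
  apply: le_Rintegral => //; first exact: integrable_gauss_fun.
    exact/integrable_realZ.
  move=> s; rewrite /= in_itv/= andbT => xs.
  rewrite /gauss_mono mul1r expr1 mulrA ler_peMl ?expR_ge0//.
  by rewrite ler_pdivlMl// mulr1.
rewrite RintegralZl//; move: h; rewrite RintegralZl// mul1r => ->.
move=> /le_trans; apply.
rewrite sub0r mulNr opprK invfM mulrC ler_wpM2r ?invr_ge0 ?(ltW x0)//.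
rewrite ler_piMr// /gauss_mono expr0 mul1r -[leRHS]expR0 ler_expR oppr_le0.
by rewrite mul1r sqr_ge0.
Qed.

Lemma Rintegral_normal_pdf_tail (m s a : R) : 0 < s ->
  \int[mu]_(x in `[a, +oo[) normal_pdf m s x =
  (Num.sqrt pi)^-1 * gauss_tail ((a - m) / (Num.sqrt 2 * s)).
Proof.
move=> s0; pose c := (Num.sqrt 2 * s)^-1.
have q0 : 0 < Num.sqrt 2 :> R by rewrite sqrtr_gt0.
have c0 : 0 < c by rewrite invr_gt0 mulr_gt0.
pose F : R -> R := fun x => c * (x + - m).
have dF (x : R) : is_derive x 1 F c.
  apply: (is_derive_eq (is_derive_mulcf c (is_derive_addf (is_derive_id x 1) (is_derive_cst (- m) x 1)))).
  by rewrite addr0 mulr1.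
have F'E : F^`()%classic = cst c by apply/funext => x; rewrite derive1E; case: (dF x).
have FaE : (a - m) / (Num.sqrt 2 * s) = F a by rewrite /F mulrC.
have pE x : normal_pdf m s x = (Num.sqrt pi)^-1 * ((gauss_fun \o F) * F^`()%classic) x.
  rewrite F'E normal_pdfE ?gt_eqF// /normal_peak fctE /= /gauss_fun /normal_fun /F /c.
  have e : Num.sqrt (s ^+ 2 * pi *+ 2) = Num.sqrt pi * (Num.sqrt 2 * s).
    rewrite -mulr_natr -mulrA mulrC sqrtrM ?mulr_ge0 ?pi_ge0// sqrtr_sqr gtr0_norm//.
    by rewrite sqrtrM ?pi_ge0// mulrA.
  rewrite e invfM -!mulrA; congr (_ * _); rewrite mulrC; congr (expR _ * _).
  rewrite exprMn exprVn exprMn sqr_sqrtr// -[_ *+ 2]mulr_natr; field.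
  by rewrite gt_eqF.
have h : (\int[mu]_(x in `[F a, +oo[) (gauss_fun x)%:E =
    \int[mu]_(x in `[a, +oo[) (((gauss_fun \o F) * F^`()%classic) x)%:E)%E.
  apply: increasing_ge0_integration_by_substitutiony.
  - by move=> x y _ _ xy; rewrite /F ltr_pM2l// ltrD2r.
  - by rewrite F'E => ? _; exact: cvg_cst.
  - by rewrite F'E; exact: is_cvg_cst.
  - by rewrite F'E; exact: is_cvg_cst.
  - split; first by move=> x _; case: (dF x).
    apply: cvg_at_right_filter; apply/differentiable_continuous/derivable1_diffP.
    by case: (dF a).
  - apply/cvgryPge => A; near=> x.
    rewrite /F -ler_pdivrMl// lerBrDr.
    by near: x; apply: nbhs_pinfty_ge; exact: num_real.
  - by apply: continuous_subspaceT; exact: continuous_gauss_fun.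
  - by move=> x _; exact: gauss_fun_ge0.
rewrite FaE /gauss_tail.
under eq_Rintegral do rewrite pE.
rewrite RintegralZl//; first by rewrite /Rintegral h.
have : mu.-integrable `[a, +oo[ (EFin \o (fun x => Num.sqrt pi * normal_pdf m s x)).
  apply: integrable_realZ => //; apply: (integrableS measurableT) => //.
  exact: integrable_normal_pdf.
rewrite (_ : (fun x => _ * _) = (gauss_fun \o F) * F^`()%classic)//.
by apply/funext => x; rewrite pE mulrA divff ?mul1r// gt_eqF// sqrtr_gt0 pi_gt0.
Unshelve. all: by end_near. Qed.

End Erfc.

(** * Normal approximation of the Gamma density *)

Section BerryEsseen.
Context {R : realType}.
Notation mu := (@lebesgue_measure R).

(** The right side minus the left has derivative (u - 1)^3 / u, hence its minimum, 0, at u = 1. *)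
Lemma ln_le_cubic (u : R) : 0 < u ->
  ln u <= (u - 1) - (u - 1) ^+ 2 / 2 + (u - 1) ^+ 3 / 3.
Proof.
move=> u0.
pose g (x : R) := (x - 1) - 2^-1 * (x - 1) ^+ 2 + 3^-1 * (x - 1) ^+ 3 + - 1 * ln x.
have dg (x : R) : 0 < x -> is_derive x 1 g ((x - 1) ^+ 3 / x).
  move=> x0.
  have d1 : is_derive x 1 (fun y : R => y - 1) 1.
    exact: is_derive_shift.
  have := is_derive_addf (is_derive_addf (is_derive_addf d1
    (is_derive_mulcf (- 2^-1) (is_derive_powf 2 d1)))
    (is_derive_mulcf 3^-1 (is_derive_powf 3 d1))) (is_derive_mulcf (-1) (is_derive1_ln x0)).
  rewrite (_ : (fun y => _) = g); last by apply/funext => y; rewrite /g -[in RHS]mulNr.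
  by move=> h; apply: (is_derive_eq h); rewrite /= expr1; field; rewrite gt_eqF.
have g1 : g 1 = 0 by rewrite /g subrr ln1 !expr0n /= !mulr0 subr0 !addr0.
suff : 0 <= g u - g 1.
  by rewrite g1 subr0 /g mulN1r subr_ge0 => /le_trans; apply; rewrite ![_^-1 * _]mulrC.
case: (leP 1 u) => u1.
- have [||c] := @MVT_segment _ g (fun x => (x - 1) ^+ 3 / x) 1 u u1.
  + by move=> x; rewrite in_itv/= => /andP[x1 _]; apply: dg; apply: lt_trans x1.
  + apply: derivable_within_continuous => x; rewrite in_itv/= => /andP[x1 _].
    by case: (dg x (lt_le_trans ltr01 x1)).
  + rewrite in_itv/= => /andP[c1 cu] ->.
    rewrite mulr_ge0 ?subr_ge0// divr_ge0 ?exprn_ge0 ?subr_ge0//.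
    exact: le_trans c1.
- have [||c] := @MVT_segment _ g (fun x => (x - 1) ^+ 3 / x) u 1 (ltW u1).
  + by move=> x; rewrite in_itv/= => /andP[x1 _]; apply: dg; apply: lt_trans x1.
  + apply: derivable_within_continuous => x; rewrite in_itv/= => /andP[x1 _].
    by case: (dg x (lt_le_trans u0 x1)).
  + rewrite in_itv/= => /andP[cu c1] h.
    rewrite -opprB h oppr_ge0 mulr_le0_ge0 ?subr_ge0 ?(ltW u1)//.
    rewrite mulr_le0_ge0 ?invr_ge0 ?(le_trans (ltW u0) cu)//.
    rewrite exprS mulr_le0_ge0 ?sqr_ge0// subr_le0//.
Qed.

(* Since y = sqrt (n / p) >= 1 + x / 2, the squared Hellinger distance
   p (1 - y)^2 is at most n - p - p x; AM-GM turns it into an L1 bound. *)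
Lemma density_gap_le (p x c K : R) : 0 <= p -> 0 < K -> - c <= x ->
  `|p - p * expR x| <=
  K / 2 * (p * expR x - p + p * c) + (p + p * expR x) / K.
Proof.
move=> p0 K0 cx.
have -> : expR x = expR (x / 2) ^+ 2 by rewrite -expRM_natl; congr expR; field.
have := expR_ge1Dx (x / 2); have := expR_gt0 (x / 2).
move: (expR _) => y y0 yx.
have -> : p - p * y ^+ 2 = p * (1 - y) * (1 + y) by ring.
rewrite !normrM (ger0_norm p0) (gtr0_norm (addr_gt0 ltr01 y0)).
have h1 : K * (`|1 - y| * (1 + y)) <= K / 2 * (K * (y ^+ 2 - 1 + c)) + (1 + y ^+ 2).
  have h2 := sqr_ge0 (K * `|1 - y| - (1 + y)).
  have h3 : `|1 - y| ^+ 2 <= y ^+ 2 - 1 + c by rewrite real_normK ?num_real//; nra.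
  have h4 := sqr_ge0 (1 - y).
  have h5 : K ^+ 2 * `|1 - y| ^+ 2 <= K ^+ 2 * (y ^+ 2 - 1 + c).
    by rewrite ler_wpM2l ?sqr_ge0.
  move: (`|1 - y|) h2 h3 h5 => a h2 h3 h5; nra.
rewrite -mulrA -subr_ge0.
have -> : K / 2 * (p * y ^+ 2 - p + p * c) + (p + p * y ^+ 2) / K - p * (`|1 - y| * (1 + y)) =
   p / K * (K / 2 * (K * (y ^+ 2 - 1 + c)) + (1 + y ^+ 2) - K * (`|1 - y| * (1 + y))).
  by field; rewrite gt_eqF.
by rewrite mulr_ge0 ?subr_ge0// divr_ge0// ltW.
Qed.

(** The exponent [x] is [stirling_gap k], which is nonnegative, plus terms in s that [ln_le_cubic]
    at s / k bounds below by the negative of the cubic term. *)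
Lemma normal_gamma_ratio (k : nat) (s : R) : (0 < k)%N -> 0 < s ->
  exists2 x, - ((s - k%:R) ^+ 3 / (3 * k%:R ^+ 2)) <= x &
    normal_pdf k%:R (Num.sqrt k%:R) s = gamma_pdf k s * expR x.
Proof.
move=> k0 s0; have k0' : 0 < k%:R :> R by rewrite ltr0n.
have f0 : 0 < k`!%:R :> R by rewrite ltr0n fact_gt0.
have sk : Num.sqrt k%:R != 0 :> R by rewrite gt_eqF// sqrtr_gt0.
have pi0 := pi_gt0 R.
exists (ln k`!%:R - k%:R * ln s + s - (s - k%:R) ^+ 2 / (2 * k%:R) - 2^-1 * (ln (2 * pi) + ln k%:R)).
  have := @stirling_gap_ge0 R k k0.
  have := @ln_le_cubic (s / k%:R) (divr_gt0 s0 k0').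
  rewrite ln_div ?posrE// /stirling_gap => h1.
  have := ler_wpM2l (ltW k0') h1.
  have -> : k%:R * (s / k%:R - 1 - (s / k%:R - 1) ^+ 2 / 2 + (s / k%:R - 1) ^+ 3 / 3) =
     s - k%:R - (s - k%:R) ^+ 2 / (2 * k%:R) + (s - k%:R) ^+ 3 / (3 * k%:R ^+ 2).
    by field; rewrite gt_eqF.
  move: (_ / (2 * _)) (_ / (3 * _)) (ln k`!%:R) (ln (2 * pi)) (ln k%:R) (ln s) => a b c d e g.
  by lra.
rewrite normal_pdfE// /normal_peak /normal_fun /gamma_pdf sqr_sqrtr ?ler0n//.
rewrite -!/(normal_fun _ _ _).
have -> : (Num.sqrt (k%:R * pi *+ 2))^-1 = expR (- (2^-1 * (ln (2 * pi) + ln k%:R))) :> R.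
  rewrite -lnM ?posrE ?mulr_gt0// expRN; congr (_^-1).
  rewrite -[LHS]lnK ?posrE ?sqrtr_gt0 ?pmulrn_lgt0 ?mulr_gt0//; congr expR.
  have e : k%:R * pi *+ 2 = 2 * pi * k%:R :> R by rewrite -mulr_natr; ring.
  have h0 : 0 < 2 * pi * k%:R :> R by rewrite !mulr_gt0.
  rewrite e -[in RHS](@sqr_sqrtr _ (2 * pi * k%:R)) ?(ltW h0)// lnXn ?sqrtr_gt0// -mulr_natr.
  by field.
have -> : s ^+ k = expR (k%:R * ln s) by rewrite expRM_natl lnK.
have -> : k`!%:R^-1 = expR (- ln k`!%:R) :> R by rewrite expRN lnK.
rewrite -!expRD; congr expR.
by rewrite -[_ *+ 2]mulr_natr; field; rewrite gt_eqF.
Qed.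

Lemma gamma_normal_tail (k : nat) (L : R) : (0 < k)%N -> 0 < L ->
  `|gamma_tail k L - (Num.sqrt pi)^-1 * gauss_tail ((L - k%:R) / (Num.sqrt 2 * Num.sqrt k%:R))|
  <= 4 / Num.sqrt k%:R.
Proof.
move=> k0 L0; have k0' : 0 < k%:R :> R by rewrite ltr0n.
set K := Num.sqrt k%:R; have K0 : 0 < K by rewrite sqrtr_gt0.
rewrite -Rintegral_normal_pdf_tail//.
have -> : gamma_tail k L = \int[mu]_(s in `[L, +oo[) gamma_pdf k s.
  by rewrite Rintegral_gamma_pdfy// ltW.
set p := gamma_pdf k; set n := normal_pdf k%:R K.
pose c (s : R) := (s - k%:R) ^+ 3 * p s.
have ip : mu.-integrable `[0, +oo[ (EFin \o p) by exact: integrable_gamma_pdf.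
have inT : mu.-integrable setT (EFin \o n) by exact: integrable_normal_pdf.
have in_ : mu.-integrable `[0, +oo[ (EFin \o n) by apply: (integrableS measurableT).
have [ic vc] := @gamma_pdf_moment3 R k.
(* The bound of [density_gap_le] with weight K = sqrt k, regrouped as a combination of the normal
   density, the Gamma density and the signed cube, whose integrals are bounded or known. *)
pose G (s : R) := \sum_(i < 3) [:: K / 2 + K^-1; K^-1 - K / 2; K / (6 * k%:R ^+ 2)]`_i *
   (nth p [:: n; p; c] i) s.
have GE s : G s = K / 2 * (n s - p s + c s / (3 * k%:R ^+ 2)) + (p s + n s) / K.
  by rewrite /G !big_ord_recl big_ord0 /=; field; rewrite !gt_eqF.
have iG : mu.-integrable `[0, +oo[ (EFin \o G).
  by apply: integrable_lincomb => //; case => -[|[|[|//]]].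
have sub : `[L, +oo[%classic `<=` `[0, +oo[%classic.
  by move=> s; rewrite /= !in_itv/= !andbT; apply: le_trans; exact: ltW.
have iS f : mu.-integrable `[0, +oo[ (EFin \o f) -> mu.-integrable `[L, +oo[ (EFin \o f).
  by move=> h; apply: (integrableS _ _ _ h).
have pn s : 0 < s -> `|p s - n s| <= G s.
  move=> s0; have [y hy] := normal_gamma_ratio k0 s0; rewrite -/K -/n => e.
  have := density_gap_le (gamma_pdf_ge0 k (ltW s0)) K0 hy.
  rewrite -/p -e GE (_ : c s / _ = p s * ((s - k%:R) ^+ 3 / (3 * k%:R ^+ 2)))//.
  by rewrite /c mulrAC mulrC.
rewrite -RintegralB//; [|exact: iS..].
apply: le_trans (le_normr_Rintegral _ _) _ => //.
  by apply: integrable_realB => //; exact: iS.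
apply: (@le_trans _ _ (\int[mu]_(s in `[L, +oo[) G s)).
  apply: le_Rintegral => //.
  - by apply: integrable_normr; apply: integrable_realB => //; exact: iS.
  - exact: iS.
  - move=> s; rewrite /= in_itv/= andbT => Ls; apply: pn; exact: lt_le_trans Ls.
(* The density ratio is available only for s > 0. At s = 0 both [p] and [c] vanish because k > 0,
   and nonnegativity is checked directly. *)
have G0 s : 0 <= s -> 0 <= G s.
  rewrite le_eqVlt => /predU1P[<-|s0]; last exact: le_trans (pn _ s0).
  rewrite GE /c /p /gamma_pdf expr0n gtn_eqF// !mul0r mulr0 mul0r subr0 addr0 add0r.
  by rewrite addr_ge0 ?divr_ge0 ?mulr_ge0 ?divr_ge0 ?normal_pdf_ge0// ltW.
have N1 : \int[mu]_(s in `[0, +oo[) n s <= 1.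
  have -> : 1 = \int[mu]_s n s by rewrite /Rintegral integral_normal_pdf.
  by apply: ge0_le_Rintegral_subset => // s _; exact: normal_pdf_ge0.
apply: (@le_trans _ _ (\int[mu]_(s in `[0, +oo[) G s)).
  apply: ge0_le_Rintegral_subset => // s; rewrite /= in_itv/= andbT; exact: G0.
rewrite /G Rintegral_lincomb//; last by case => -[|[|[|//]]].
rewrite !big_ord_recl big_ord0 /= vc Rintegral_gamma_pdfy// gamma_tail0 addr0 mulr1.
have k1 : 1 <= k%:R :> R by rewrite ler1n.
have KK : k%:R = K ^+ 2 by rewrite sqr_sqrtr// ltW.
move: (\int[mu]_(s in _) _) N1 => N N1.
rewrite -subr_ge0.
have -> : 4 / K - ((K / 2 + K^-1) * N + (K^-1 - K / 2 + K / (6 * k%:R ^+ 2) * (5 * k%:R + 6))) =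
   (K / 2 + K^-1) * (1 - N) + (7 * k%:R - 6) / (6 * k%:R ^+ 2) * K + (2 / K - 2 * K / k%:R).
  by field; rewrite !gt_eqF.
have -> : 2 / K - 2 * K / k%:R = 0 by rewrite KK; field; rewrite gt_eqF.
rewrite addr0 addr_ge0// mulr_ge0 ?subr_ge0 ?addr_ge0 ?invr_ge0 ?divr_ge0 ?(ltW K0)//.
by rewrite subr_ge0; nra.
Qed.

Lemma sqrt_pi_ge1 : 1 <= Num.sqrt pi :> R.
Proof. by rewrite -[leLHS]sqrtr1 ler_wsqrtr// (le_trans _ (pi_ge2 _))// ler1n. Qed.

Lemma mul_gauss_le (d c : R) : 0 < c -> d ^+ 2 * gauss_fun (d / c) <= c ^+ 2.
Proof.
move=> c0; rewrite /gauss_fun expRN ler_pdivrMr ?expR_gt0//.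
rewrite -ler_pdivrMl ?exprn_gt0// mulrC -expr_div_n.
by apply: le_trans (expR_ge1Dx _); rewrite lerDr.
Qed.

(** Applied with p^2 = k and q^2 = L, this trades the variance k for L. The two arguments differ by
    d^2 / (sqrt 2 p q (p + q)) with d = q^2 - p^2, and the Gaussian at the endpoint nearer to 0
    compensates the factor d^2 by [mul_gauss_le]. *)
Lemma gauss_tail_rescale (p q : R) : 0 < p -> 0 < q ->
  `|gauss_tail ((q ^+ 2 - p ^+ 2) / (Num.sqrt 2 * p)) -
    gauss_tail ((q ^+ 2 - p ^+ 2) / (Num.sqrt 2 * q))| <= Num.sqrt 2 / Num.min p q.
Proof.
move=> p0 q0; have w0 : 0 < Num.sqrt 2 :> R by rewrite sqrtr_gt0.
have w2 : Num.sqrt 2 ^+ 2 = 2 :> R by rewrite sqr_sqrtr.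
move: (Num.sqrt 2) w0 w2 => w w0 w2.
have wp : 0 < w * p by rewrite mulr_gt0.
have wq : 0 < w * q by rewrite mulr_gt0.
set d := q ^+ 2 - p ^+ 2.
have dE : d = (q - p) * (q + p) by rewrite /d; ring.
have M (x y : R) : x ^+ 2 <= y ^+ 2 -> gauss_fun y <= gauss_fun x.
  by move=> xy; rewrite ler_expR lerN2.
have pq0 : 0 < p + q by rewrite addr_gt0.
have key (c : R) : 0 < c -> gauss_fun (d / c) * (d ^+ 2 / (w * p * q * (p + q))) <=
    c ^+ 2 / (w * p * q * (p + q)).
  move=> c0; rewrite mulrA ler_wpM2r//; last by rewrite mulrC mul_gauss_le.
  by rewrite invr_ge0 ltW// !mulr_gt0.
have [qp|pq] := leP q p.
-   have d0 : d <= 0 by rewrite dE mulr_le0_ge0 ?subr_le0// ltW// addrC.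
  have ab : d / (w * q) <= d / (w * p).
    by rewrite ler_wnM2l// lef_pV2 ?posrE// ler_pM2l.
  have := @gauss_tailB_bounds R _ _ (gauss_fun (d / (w * p))) ab.
  have hM s : d / (w * q) <= s <= d / (w * p) -> gauss_fun s <= gauss_fun (d / (w * p)).
    move=> /andP[_ sb]; apply: M; rewrite -[leRHS]sqrrN -[leLHS]sqrrN ler_pXn2r ?nnegrE ?oppr_ge0//.
    + by rewrite lerN2.
    + by rewrite mulr_le0_ge0// invr_ge0 ltW.
    + by apply: (le_trans sb); rewrite mulr_le0_ge0// invr_ge0 ltW.
  move=> /(_ hM) /andP[h0 h]; rewrite distrC ger0_norm//; apply: (le_trans h).
  have -> : d / (w * p) - d / (w * q) = d ^+ 2 / (w * p * q * (p + q)).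
    by rewrite dE; field; rewrite !gt_eqF// addrC.
  apply: (le_trans (key _ wp)).
  have -> : (w * p) ^+ 2 / (w * p * q * (p + q)) = w / q * (p / (p + q)) by field; rewrite !gt_eqF.
  rewrite ler_piMr ?divr_ge0 ?(ltW w0) ?(ltW q0)//.
  by rewrite ler_pdivrMr// mul1r lerDl ltW.
- have d0 : 0 <= d by rewrite dE mulr_ge0 ?subr_ge0 ?(ltW pq)// addrC ltW.
  have ab : d / (w * q) <= d / (w * p).
    by rewrite ler_wpM2l// lef_pV2 ?posrE// ler_pM2l// ltW.
  have := @gauss_tailB_bounds R _ _ (gauss_fun (d / (w * q))) ab.
  have hM s : d / (w * q) <= s <= d / (w * p) -> gauss_fun s <= gauss_fun (d / (w * q)).
    move=> /andP[sb _]; apply: M; rewrite ler_pXn2r ?nnegrE//.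
    + by rewrite divr_ge0// ltW.
    + by apply: le_trans sb; rewrite divr_ge0// ltW.
  move=> /(_ hM) /andP[h0 h]; rewrite distrC ger0_norm//; apply: (le_trans h).
  have -> : d / (w * p) - d / (w * q) = d ^+ 2 / (w * p * q * (p + q)).
    by rewrite dE; field; rewrite !gt_eqF// addrC.
  apply: (le_trans (key _ wq)).
  have -> : (w * q) ^+ 2 / (w * p * q * (p + q)) = w / p * (q / (p + q)) by field; rewrite !gt_eqF.
  rewrite ler_piMr ?divr_ge0 ?(ltW w0) ?(ltW p0)//.
  by rewrite ler_pdivrMr// mul1r lerDr ltW.
Qed.

Lemma gamma_tail_chebyshev (k : nat) (L : R) : k%:R < L ->
  gamma_tail k L <= (k%:R + 2) / (L - k%:R) ^+ 2.
Proof.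
move=> kL; have L0 : 0 <= L by apply: le_trans (ltW kL).
have [im vm] := @gamma_pdf_moment2 R k.
have d0 : 0 < L - k%:R by rewrite subr_gt0.
rewrite -Rintegral_gamma_pdfy// ler_pdivlMr ?exprn_gt0// -vm mulrC -RintegralZl//; last exact: integrable_gamma_pdf.
apply: (@le_trans _ _ (\int[mu]_(s in `[L, +oo[) ((s - k%:R) ^+ 2 * gamma_pdf k s))).
  apply: le_Rintegral => //.
  - exact/integrable_realZ/integrable_gamma_pdf.
  - apply: (integrableS _ _ _ im) => // s; rewrite /= !in_itv/= !andbT.
    exact: le_trans.
  - move=> s; rewrite /= in_itv/= andbT => Ls.
    rewrite ler_wpM2r ?gamma_pdf_ge0 ?(le_trans L0)//.
    by rewrite ler_pXn2r ?nnegrE ?lerD2r// subr_ge0 ltW// (lt_le_trans kL).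
have sub : `[L, +oo[%classic `<=` `[0%R, +oo[%classic.
  by move=> s; rewrite /= !in_itv/= !andbT; exact: le_trans.
apply: ge0_le_Rintegral_subset => // s; rewrite /= in_itv/= andbT => s0.
by rewrite mulr_ge0 ?sqr_ge0 ?gamma_pdf_ge0.
Qed.

Lemma gamma_tail_ge0 k (L : R) : 0 <= L -> 0 <= gamma_tail k L.
Proof. by move=> L0; apply: sumr_ge0 => i _; exact: gamma_pdf_ge0. Qed.

Lemma gamma_tail_erfc (k : nat) (L : R) : 1 <= L ->
  `|gamma_tail k L - (Num.sqrt pi)^-1 * gauss_tail ((L - k%:R) / (Num.sqrt 2 * Num.sqrt L))|
  <= 12 / Num.sqrt L.
Proof.
move=> L1; have L0 : 0 < L by apply: lt_le_trans L1.
set q := Num.sqrt L; have q0 : 0 < q by rewrite sqrtr_gt0.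
have qL : L = q ^+ 2 by rewrite sqr_sqrtr// ltW.
have q1 : 1 <= q by rewrite -[leLHS]sqrtr1 ler_wsqrtr.
have w0 : 0 < Num.sqrt 2 :> R by rewrite sqrtr_gt0.
have w2 : Num.sqrt 2 ^+ 2 = 2 :> R by rewrite sqr_sqrtr.
have w32 : Num.sqrt 2 <= 3 / 2 :> R by nra.
have sp := sqrt_pi_ge1; have sp0 : 0 < Num.sqrt pi :> R by apply: lt_le_trans sp.
have spV : (Num.sqrt pi)^-1 <= 1 :> R by rewrite invf_le1.
(* For k <= L / 2 both terms are small on their own: Chebyshev gives 10 / q, Mills' bound 2 / q,
   whence the constant 12. For larger k, sqrt k is comparable to q, and the normal approximation and
   the change of variance cost 8 / q and 2 / q. *)
have [kL|kL] := leP (2 * k%:R) L.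
- have hk : k%:R <= L / 2 by lra.
  have d0 : 0 < L - k%:R by lra.
  have h1 : gamma_tail k L <= 10 / q.
    apply: (le_trans (@gamma_tail_chebyshev k L _)); first lra.
    rewrite ler_pdivrMr ?exprn_gt0// mulrAC ler_pdivlMr//.
    have h2 : (L / 2) ^+ 2 <= (L - k%:R) ^+ 2 by rewrite ler_pXn2r ?nnegrE//; lra.
    have h3 : q ^+ 4 / 4 <= (L - k%:R) ^+ 2 by move: h2; rewrite qL => h2; nra.
    apply: (@le_trans _ _ (10 * (q ^+ 4 / 4))); last by rewrite ler_wpM2l.
    apply: (@le_trans _ _ ((q ^+ 2 / 2 + 2) * q)).
      by rewrite ler_wpM2r ?(ltW q0)// lerD2r -qL.
    have h4 : 1 <= q ^+ 2 by rewrite exprn_ege1.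
    have h5 : q <= q ^+ 2 by nra.
    have h6 : q ^+ 2 <= q ^+ 4 by rewrite (exprD q 2 2) ler_peMl// sqr_ge0.
    have h7 : q ^+ 3 <= q ^+ 4 by rewrite exprS [leRHS]exprS ler_pM2l// [leRHS]exprS ler_peMl// sqr_ge0.
    have -> : (q ^+ 2 / 2 + 2) * q = q ^+ 3 / 2 + 2 * q by ring.
    lra.
  have x0 : 0 < (L - k%:R) / (Num.sqrt 2 * q) by rewrite divr_gt0// mulr_gt0.
  have h2 : (Num.sqrt pi)^-1 * gauss_tail ((L - k%:R) / (Num.sqrt 2 * q)) <= 2 / q.
    apply: (@le_trans _ _ (1 * gauss_tail ((L - k%:R) / (Num.sqrt 2 * q)))).
      by rewrite ler_wpM2r// gauss_tail_ge0.
    rewrite mul1r; apply: (le_trans (gauss_tail_le x0)).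
    rewrite invfM invf_div.
    have : q ^+ 2 / 2 <= L - k%:R by rewrite -qL; lra.
    move: (L - k%:R) d0 (Num.sqrt 2) w0 w32 => d d0 w w0' w32' hd.
    have -> : 2^-1 * (w * q / d) = (w * q / 2) / d by field; rewrite gt_eqF.
    rewrite ler_pdivrMr// [2 / q * d]mulrAC ler_pdivlMr//.
    nra.
  have h3 := @gamma_tail_ge0 k L (ltW L0).
  have h4 : 0 <= (Num.sqrt pi)^-1 * gauss_tail ((L - k%:R) / (Num.sqrt 2 * q)).
    by rewrite mulr_ge0 ?gauss_tail_ge0 ?invr_ge0// ltW.
  have e : 12 / q = 10 / q + 2 / q by rewrite -mulrDl; congr (_ / _); ring.
  rewrite e ler_norml; apply/andP; split; lra.
- have k0 : 0 < k%:R :> R by lra.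
  have k0' : (0 < k)%N by rewrite -(ltr0n R).
  pose p : R := Num.sqrt k%:R; have p0 : 0 < p by rewrite sqrtr_gt0.
  have pk : k%:R = p ^+ 2 by rewrite sqr_sqrtr// ltW.
  have pq : q / 2 <= Num.min p q / Num.sqrt 2.
    rewrite ler_pdivlMr// le_min; apply/andP; split; last by nra.
    rewrite -(@ler_pXn2r _ 2) ?nnegrE ?(ltW p0) ?mulr_ge0 ?(ltW w0) ?(ltW q0)// exprMn w2 -pk.
    by rewrite expr_div_n -qL; lra.
  have m0 : 0 < Num.min p q by rewrite lt_min p0.
  have h1 := gamma_normal_tail k0' L0; rewrite -/p in h1.
  have h2 := gauss_tail_rescale p0 q0; rewrite -qL -pk in h2.
  set A := gauss_tail _ in h1 h2 *; set B := gauss_tail _ in h2 *.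
  have h3 : Num.sqrt 2 / Num.min p q <= 2 / q.
    rewrite -[leLHS]invrK -[leRHS]invrK lef_pV2 ?posrE ?invr_gt0 ?divr_gt0//.
    by rewrite !invf_div.
  have h4 : 4 / p <= 8 / q.
    have : q / 2 <= p.
      apply: (le_trans pq); rewrite ler_pdivrMr//.
      apply: (@le_trans _ _ p); first by rewrite ge_min lexx.
      by rewrite ler_peMr ?(ltW p0)//; nra.
    by move=> h; rewrite ler_pdivrMr// mulrAC ler_pdivlMr//; lra.
  have e : gamma_tail k L - (Num.sqrt pi)^-1 * B =
     (gamma_tail k L - (Num.sqrt pi)^-1 * A) + (Num.sqrt pi)^-1 * (A - B) by ring.
  rewrite e; apply: (le_trans (ler_normD _ _)).
  have h5 : `|(Num.sqrt pi)^-1 * (A - B)| <= 2 / q.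
    rewrite normrM ger0_norm ?invr_ge0 ?(ltW sp0)//.
    apply: le_trans (le_trans h2 h3).
    by rewrite ler_piMl.
  have h6 : 12 / q = 8 / q + 2 / q + 2 / q by rewrite -!mulrDl; congr (_ / _); ring.
  have h7 : 0 <= 2 / q by rewrite divr_ge0// ltW.
  by rewrite h6; lra.
Qed.

End BerryEsseen.

(** * Complex-valued integrals and the complex exponential *)

Section ComplexIntegral.
Context {R : realType}.
Notation C := R[i].

Lemma cReM (z w : C) : complex.Re (z * w) =
  complex.Re z * complex.Re w - complex.Im z * complex.Im w.
Proof. by case: z w => [a b] [c d]. Qed.
Lemma cImM (z w : C) : complex.Im (z * w) =
  complex.Re z * complex.Im w + complex.Im z * complex.Re w.
Proof. by case: z w => [a b] [c d]. Qed.
Lemma cReD (z w : C) : complex.Re (z + w) = complex.Re z + complex.Re w.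
Proof. by case: z w => [a b] [c d]. Qed.
Lemma cImD (z w : C) : complex.Im (z + w) = complex.Im z + complex.Im w.
Proof. by case: z w => [a b] [c d]. Qed.
Lemma cReN (z : C) : complex.Re (- z) = - complex.Re z.
Proof. by case: z. Qed.
Lemma cImN (z : C) : complex.Im (- z) = - complex.Im z.
Proof. by case: z. Qed.
Lemma cReJ (z : C) : complex.Re (z^*) = complex.Re z.
Proof. by case: z. Qed.
Lemma cImJ (z : C) : complex.Im (z^*) = - complex.Im z.
Proof. by case: z. Qed.
Lemma complex_ext (z w : C) : complex.Re z = complex.Re w -> complex.Im z = complex.Im w -> z = w.
Proof. by case: z w => [a b] [c d] /= -> ->. Qed.

(* The l1 norm is submultiplicative and, unlike the modulus, splits into the
   integrals of the real and imaginary parts. *)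
Definition norm1 (z : C) : R := `|complex.Re z| + `|complex.Im z|.

Lemma norm1_ge0 z : 0 <= norm1 z. Proof. by rewrite addr_ge0. Qed.

Lemma norm11 : norm1 1 = 1. Proof. by rewrite /norm1 /= normr1 normr0 addr0. Qed.
Lemma norm1_eq0 z : norm1 z <= 0 -> z = 0.
Proof.
move=> h; apply: complex_ext => /=; apply/normr0_eq0/le_anti; rewrite normr_ge0 andbT;
  by apply: le_trans h; rewrite ?lerDl ?lerDr.
Qed.
Lemma norm1N z : norm1 (- z) = norm1 z.
Proof. by rewrite /norm1 cReN cImN !normrN. Qed.
Lemma norm1J z : norm1 (z^*) = norm1 z.
Proof. by rewrite /norm1 cReJ cImJ !normrN. Qed.
Lemma norm1D z w : norm1 (z + w) <= norm1 z + norm1 w.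
Proof. by rewrite /norm1 cReD cImD addrACA lerD// ler_normD. Qed.
Lemma norm1_real (x : R) : norm1 x%:C = `|x|.
Proof. by rewrite /norm1 /= normr0 addr0. Qed.
Lemma norm1M z w : norm1 (z * w) <= norm1 z * norm1 w.
Proof.
rewrite /norm1 cReM cImM; apply: (le_trans (lerD (ler_normB _ _) (ler_normD _ _))).
by rewrite !normrM le_eqVlt; apply/orP; left; apply/eqP; ring.
Qed.
Lemma norm1_realM (x : R) z : norm1 (x%:C * z) = `|x| * norm1 z.
Proof. by rewrite /norm1 cReM cImM /= !mul0r subr0 addr0 !normrM mulrDr. Qed.
Lemma norm1X z n : norm1 (z ^+ n) <= norm1 z ^+ n.
Proof.
elim: n => [|n ih]; first by rewrite !expr0 norm11.
by rewrite !exprS; apply: (le_trans (norm1M _ _)); rewrite ler_wpM2l// norm1_ge0.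
Qed.

Context d (T : measurableType d) (mu : {measure set T -> \bar R}).

Definition cmeasurable (D : set T) (f : T -> C) :=
  measurable_fun D (fun t => complex.Re (f t)) /\ measurable_fun D (fun t => complex.Im (f t)).

Definition cintegrable (D : set T) (f : T -> C) :=
  mu.-integrable D (EFin \o (fun t => complex.Re (f t))) /\
  mu.-integrable D (EFin \o (fun t => complex.Im (f t))).

Implicit Types (f g : T -> C) (D : set T).

Lemma cmeasurableM D f g : cmeasurable D f -> cmeasurable D g ->
  cmeasurable D (fun t => f t * g t).
Proof.
move=> [f1 f2] [g1 g2]; split.
  under eq_fun do rewrite cReM.
  by apply: measurable_funB; apply: measurable_funM.
under eq_fun do rewrite cImM.
by apply: measurable_funD; apply: measurable_funM.
Qed.

Lemma cmeasurableD D f g : cmeasurable D f -> cmeasurable D g ->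
  cmeasurable D (fun t => f t + g t).
Proof.
move=> [f1 f2] [g1 g2]; split.
  by under eq_fun do rewrite cReD; apply: measurable_funD.
by under eq_fun do rewrite cImD; apply: measurable_funD.
Qed.

Lemma cmeasurableJ D f : cmeasurable D f -> cmeasurable D (fun t => (f t)^*).
Proof.
move=> [f1 f2]; split; first by under eq_fun do rewrite cReJ.
by under eq_fun do rewrite cImJ; exact: measurableT_comp.
Qed.

Lemma cmeasurable_cst D (c : C) : cmeasurable D (fun=> c).
Proof. by split; exact: measurable_cst. Qed.

Lemma cmeasurable_real D (f : T -> R) : measurable_fun D f ->
  cmeasurable D (fun t => (f t)%:C).
Proof. by move=> mf; split => //=; exact: measurable_cst. Qed.

Lemma cmeasurableX D f n : cmeasurable D f -> cmeasurable D (fun t => f t ^+ n).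
Proof.
move=> mf; elim: n => [|n ih].
  by under eq_fun do rewrite expr0; exact: cmeasurable_cst.
by under eq_fun do rewrite exprS; exact: cmeasurableM.
Qed.

Lemma cmeasurable_sum D I (s : seq I) (F : I -> T -> C) :
  (forall i, cmeasurable D (F i)) -> cmeasurable D (fun t => \sum_(i <- s) F i t).
Proof.
move=> mF; elim: s => [|i s ih].
  by under eq_fun do rewrite big_nil; exact: cmeasurable_cst.
by under eq_fun do rewrite big_cons; exact: cmeasurableD.
Qed.

Lemma cintegrable_le D f (g : T -> R) : measurable D -> cmeasurable D f ->
  (forall t, D t -> norm1 (f t) <= g t) -> mu.-integrable D (EFin \o g) ->
  cintegrable D f.
Proof.
move=> mD [f1 f2] fg gi; split.
  apply: (le_integrable_real mD f1 _ gi) => t Dt.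
  by apply: le_trans (fg t Dt); rewrite lerDl.
apply: (le_integrable_real mD f2 _ gi) => t Dt.
by apply: le_trans (fg t Dt); rewrite lerDr.
Qed.

Lemma cintegrable_norm1 D f : measurable D -> cintegrable D f ->
  mu.-integrable D (EFin \o (fun t => norm1 (f t))).
Proof.
by move=> mD [f1 f2]; apply: integrable_realD => //; exact: integrable_normr.
Qed.

Lemma cintegrableD D f g : measurable D -> cintegrable D f -> cintegrable D g ->
  cintegrable D (fun t => f t + g t).
Proof.
move=> mD [f1 f2] [g1 g2]; split.
  by under eq_fun do rewrite cReD; exact: integrable_realD.
by under eq_fun do rewrite cImD; exact: integrable_realD.
Qed.

Lemma cintegrableZ D f (c : C) : measurable D -> cintegrable D f ->
  cintegrable D (fun t => c * f t).
Proof.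
move=> mD [f1 f2]; split.
  by under eq_fun do rewrite cReM; apply: integrable_realB => //; exact: integrable_realZ.
by under eq_fun do rewrite cImM; apply: integrable_realD => //; exact: integrable_realZ.
Qed.

Lemma eq_cintegral D f g : {in D, f =1 g} -> cintegral mu D f = cintegral mu D g.
Proof. by move=> fg; congr (_ +i* _); apply: eq_Rintegral => t tD; rewrite fg. Qed.

Lemma cintegral0 D : cintegral mu D (fun=> 0) = 0.
Proof. by rewrite /cintegral /= /Rintegral integral0. Qed.

Lemma cintegralD D f g : measurable D -> cintegrable D f -> cintegrable D g ->
  cintegral mu D (fun t => f t + g t) = cintegral mu D f + cintegral mu D g.
Proof.
move=> mD [f1 f2] [g1 g2]; apply: complex_ext; rewrite ?cReD ?cImD /= -RintegralD//;
  by apply: eq_Rintegral => t _; rewrite ?cReD ?cImD.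
Qed.

Lemma cintegralZ D f (c : C) : measurable D -> cintegrable D f ->
  cintegral mu D (fun t => c * f t) = c * cintegral mu D f.
Proof.
move=> mD [f1 f2]; apply: complex_ext.
  rewrite cReM /= -!RintegralZl// -RintegralB//; [|exact: integrable_realZ..].
  by apply: eq_Rintegral => t _; rewrite cReM.
rewrite cImM /= -!RintegralZl// -RintegralD//; [|exact: integrable_realZ..].
by apply: eq_Rintegral => t _; rewrite cImM.
Qed.

Lemma cintegrable0 D : cintegrable D (fun=> 0).
Proof. by split; exact: integrable0. Qed.

Lemma cintegrable_lincomb D I (s : seq I) (c : I -> C) (F : I -> T -> C) : measurable D ->
  (forall i, cintegrable D (F i)) -> cintegrable D (fun t => \sum_(i <- s) c i * F i t).
Proof.
move=> mD Fi; elim: s => [|i s ih].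
  by under eq_fun do rewrite big_nil; exact: cintegrable0.
under eq_fun do rewrite big_cons.
by apply: cintegrableD => //; exact: cintegrableZ.
Qed.

Lemma cintegral_lincomb D I (s : seq I) (c : I -> C) (F : I -> T -> C) : measurable D ->
  (forall i, cintegrable D (F i)) ->
  cintegral mu D (fun t => \sum_(i <- s) c i * F i t) =
  \sum_(i <- s) c i * cintegral mu D (F i).
Proof.
move=> mD Fi; elim: s => [|i s ih].
  by rewrite big_nil -[RHS](cintegral0 D); apply: eq_cintegral => t _; rewrite big_nil.
rewrite big_cons -ih -cintegralZ// -cintegralD//.
- by apply: eq_cintegral => t _; rewrite big_cons.
- exact: cintegrableZ.
- exact: cintegrable_lincomb.
Qed.

Lemma cintegralJ D f : measurable D -> cintegrable D f ->
  cintegral mu D (fun t => (f t)^*) = (cintegral mu D f)^*.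
Proof.
move=> mD [f1 f2]; apply: complex_ext.
  by rewrite cReJ /=; apply: eq_Rintegral => t _; rewrite cReJ.
rewrite cImJ /= -mulN1r -RintegralZl//.
by apply: eq_Rintegral => t _; rewrite cImJ mulN1r.
Qed.

Lemma cintegrableJ D f : measurable D -> cintegrable D f ->
  cintegrable D (fun t => (f t)^*).
Proof.
move=> mD [f1 f2]; split; first by under eq_fun do rewrite cReJ.
under eq_fun do rewrite cImJ -mulN1r; exact: integrable_realZ.
Qed.

Lemma le_norm1_cintegral D f : measurable D -> cintegrable D f ->
  norm1 (cintegral mu D f) <= \int[mu]_(t in D) norm1 (f t).
Proof.
move=> mD [f1 f2]; rewrite RintegralD//; [|exact: integrable_normr..].
by apply: lerD; exact: le_normr_Rintegral.
Qed.

End ComplexIntegral.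

Section ComplexExponential.
Context {R : realType}.
Notation C := R[i].

Definition cexp (z : C) : C := (expR (complex.Re z))%:C * expi (complex.Im z).

Lemma Re_cexp z : complex.Re (cexp z) = expR (complex.Re z) * cos (complex.Im z).
Proof. by rewrite cReM /= mul0r subr0. Qed.
Lemma Im_cexp z : complex.Im (cexp z) = expR (complex.Re z) * sin (complex.Im z).
Proof. by rewrite cImM /= mul0r addr0. Qed.

Lemma cexpD z w : cexp (z + w) = cexp z * cexp w.
Proof.
apply: complex_ext.
  by rewrite [RHS]cReM !Re_cexp !Im_cexp cReD cImD expRD cosD; ring.
by rewrite [RHS]cImM !Re_cexp !Im_cexp cReD cImD expRD sinD; ring.
Qed.

Lemma cexpJ z : cexp (z^*) = (cexp z)^*.
Proof. by apply: complex_ext; rewrite ?cReJ ?cImJ ?Re_cexp ?Im_cexp cReJ cImJ ?cosN ?sinN ?mulrN. Qed.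

Lemma cexp_real (x : R) : cexp x%:C = (expR x)%:C.
Proof. by apply: complex_ext; rewrite ?Re_cexp ?Im_cexp /= ?cos0 ?sin0 ?mulr1 ?mulr0. Qed.

Lemma norm1_cexp z : norm1 (cexp z) <= 2 * expR (norm1 z).
Proof.
rewrite /norm1 Re_cexp Im_cexp !normrM (ger0_norm (expR_ge0 _)).
have : expR (complex.Re z) <= expR (norm1 z).
  by rewrite ler_expR (le_trans (ler_norm _))// lerDl.
rewrite -/(norm1 z); move: (expR_ge0 (complex.Re z)) (cos_max (complex.Im z)) (sin_max (complex.Im z)).
move: (expR _) (expR _) `|cos _| `|sin _| => a b c e a0 hc he ab.
by rewrite -mulrDr; nra.
Qed.

(** Differentiation in a real variable, by components: the complex exponential is only
    differentiated along the lines y -> y z. *)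
Definition is_cderive (f : R -> C) (x : R) (df : C) :=
  is_derive x 1 (fun y : R => complex.Re (f y)) (complex.Re df) /\
  is_derive x 1 (fun y : R => complex.Im (f y)) (complex.Im df).

Lemma is_cderive_cexp (z : C) (x : R) :
  is_cderive (fun y => cexp (y%:C * z)) x (z * cexp (x%:C * z)).
Proof.
have dl (c : R) : is_derive x 1 (fun y : R => c * y) c.
  by apply: (is_derive_eq (is_derive_mulcf c (is_derive_id x 1))); rewrite mulr1.
case: z => a b; split.
- rewrite (_ : (fun y => _) = fun y => expR (a * y) * cos (b * y)); last first.
    by apply/funext => y; rewrite Re_cexp cReM cImM /= !mul0r subr0 addr0 ![y * _]mulrC.
  have h := is_derive_mulf (is_derive_expf (dl a)) (is_derive1_comp (is_derive_cos (b * x)) (dl b)).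
  apply: (is_derive_eq h).
  by rewrite cReM Re_cexp Im_cexp cReM cImM /= !mul0r subr0 addr0 ![x * _]mulrC; ring.
- rewrite (_ : (fun y => _) = fun y => expR (a * y) * sin (b * y)); last first.
    by apply/funext => y; rewrite Im_cexp cReM cImM /= !mul0r subr0 addr0 ![y * _]mulrC.
  have h := is_derive_mulf (is_derive_expf (dl a)) (is_derive1_comp (is_derive_sin (b * x)) (dl b)).
  apply: (is_derive_eq h).
  by rewrite cImM Re_cexp Im_cexp cReM cImM /= !mul0r subr0 addr0 ![x * _]mulrC; ring.
Qed.

Definition cexp_sum (N : nat) (z : C) : C := \sum_(n < N) z ^+ n / n`!%:R.

Lemma is_cderiveD f g x df dg : is_cderive f x df -> is_cderive g x dg ->
  is_cderive (fun y => f y + g y) x (df + dg).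
Proof.
move=> [f1 f2] [g1 g2]; split.
  by under eq_fun do rewrite cReD; rewrite cReD; exact: is_derive_addf.
by under eq_fun do rewrite cImD; rewrite cImD; exact: is_derive_addf.
Qed.

Lemma is_cderive_mono (n : nat) (c : C) (x : R) :
  is_cderive (fun y => (y ^+ n)%:C * c) x ((n%:R * x ^+ n.-1)%:C * c).
Proof.
have h (e : R) : is_derive x 1 (fun y : R => y ^+ n * e) ((n%:R * x ^+ n.-1) * e).
  apply: (is_derive_eq (is_derive_mulf (is_derive_powf n (is_derive_id x 1)) (is_derive_cst e x 1))).
  by rewrite mulr0 addr0 mulr1.
split.
  rewrite (_ : (fun y => _) = fun y => y ^+ n * complex.Re c); last first.
    by apply/funext => y; rewrite cReM /= mul0r subr0.
  by rewrite cReM /= mul0r subr0.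
rewrite (_ : (fun y => _) = fun y => y ^+ n * complex.Im c); last first.
  by apply/funext => y; rewrite cImM /= mul0r addr0.
by rewrite cImM /= mul0r addr0.
Qed.

Lemma is_cderive_cexp_sum N (z : C) (x : R) :
  is_cderive (fun y => cexp_sum N.+1 (y%:C * z)) x (z * cexp_sum N (x%:C * z)).
Proof.
have E n (y : R) : (y%:C * z) ^+ n / n`!%:R = (y ^+ n)%:C * (z ^+ n / n`!%:R).
  by rewrite exprMn rmorphXn mulrA.
have S (M : nat) (y : R) : cexp_sum M.+1 (y%:C * z) =
    cexp_sum M (y%:C * z) + (y ^+ M)%:C * (z ^+ M / M`!%:R).
  by rewrite /cexp_sum big_ord_recr /= E.
elim: N => [|N ih].
  rewrite (_ : (fun y => _) = (fun y => (y ^+ 0)%:C * 1)); last first.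
    by apply/funext => y; rewrite /cexp_sum big_ord1 !expr0 fact0 divr1 mul1r.
  rewrite /cexp_sum big_ord0 mulr0.
  have := is_cderive_mono 0 1 x; by rewrite mul0r rmorph0 mul0r.
rewrite (_ : (fun y => _) = (fun y => cexp_sum N.+1 (y%:C * z) +
    (y ^+ N.+1)%:C * (z ^+ N.+1 / (N.+1)`!%:R))); last by apply/funext => y; exact: S.
have -> : z * cexp_sum N.+1 (x%:C * z) = z * cexp_sum N (x%:C * z) +
    (N.+1%:R * x ^+ N)%:C * (z ^+ N.+1 / (N.+1)`!%:R).
  rewrite S mulrDr; congr (_ + _); rewrite exprS factS natrM rmorphM /= rmorph_nat.
  by field; rewrite !pnatr_eq0 -lt0n fact_gt0 nat1r pnatr_eq0.
exact: is_cderiveD ih (is_cderive_mono _ _ _).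
Qed.

(** The mean value theorem is applied to K y^(n+1) / (n+1) - e f y, whose derivative is nonnegative
    for each sign e. This is one step of a Taylor remainder estimate. *)
Lemma derive_pow_bound (f df : R -> R) (K : R) (n : nat) (x : R) : 0 <= x ->
  (forall y : R, is_derive y 1 f (df y)) -> f 0 = 0 ->
  (forall y, 0 <= y <= x -> `|df y| <= K * y ^+ n) ->
  `|f x| <= K * x ^+ n.+1 / n.+1%:R.
Proof.
move=> x0 dfP f0 hb.
have n0 : n.+1%:R != 0 :> R by rewrite pnatr_eq0.
have aux (e : R) : `|e| = 1 -> e * f x <= K * x ^+ n.+1 / n.+1%:R.
  move=> e1; pose g := fun y : R => (K / n.+1%:R) * y ^+ n.+1 + (- e) * f y.
  pose dg y := K * y ^+ n + (- e) * df y.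
  have dgP (y : R) : is_derive y 1 g (dg y).
    have h := is_derive_addf (is_derive_mulcf (K / n.+1%:R) (is_derive_powf n.+1 (is_derive_id y 1)))
      (is_derive_mulcf (- e) (dfP y)).
    by apply: (is_derive_eq h); rewrite /dg /= mulr1 mulrA divfK.
  have [|c] := @MVT_segment _ g dg 0 x x0 (fun y _ => dgP y).
    by apply: derivable_within_continuous => y _; case: (dgP y).
  rewrite in_itv /= => cx; rewrite {1 2}/g f0 expr0n /= !mulr0 addr0 !subr0 => h.
  suff : 0 <= K / n.+1%:R * x ^+ n.+1 + - e * f x.
    by rewrite mulNr subr_ge0 => /le_trans; apply; rewrite mulrAC.
  rewrite h mulr_ge0// /dg mulNr subr_ge0.
  apply: le_trans (hb c cx); apply: (le_trans (ler_norm _)).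
  by rewrite normrM e1 mul1r.
rewrite ler_norml lerNl; apply/andP; split.
  by have := aux (-1); rewrite normrN normr1 mulN1r; apply.
by have := aux 1; rewrite normr1 mul1r; apply.
Qed.

(** Along the ray x -> x z, the derivative of the remainder of order N + 1 is z times that of order
    N. Bounding real and imaginary parts separately costs a factor 2 per step, hence the power of 2
    [norm1 z]. *)
Lemma cexp_remainder (z : C) N (x : R) : 0 <= x <= 1 ->
  norm1 (cexp (x%:C * z) - cexp_sum N (x%:C * z)) <=
  2 * expR (norm1 z) * (2 * norm1 z) ^+ N * x ^+ N / N`!%:R.
Proof.
have n0 := norm1_ge0 z.
elim: N x => [|N ih] x /andP[x0 x1].
  rewrite /cexp_sum big_ord0 subr0 !expr0 fact0 divr1 !mulr1.
  apply: (le_trans (norm1_cexp _)); rewrite ler_wpM2l// ler_expR norm1_realM ger0_norm//.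
  by rewrite ler_piMl.
pose f y := cexp (y%:C * z) - cexp_sum N.+1 (y%:C * z).
pose df y := z * (cexp (y%:C * z) - cexp_sum N (y%:C * z)).
have dfP (y : R) : is_cderive f y (df y).
  rewrite /f /df mulrBr.
  have [a1 a2] := is_cderive_cexp z y; have [b1 b2] := is_cderive_cexp_sum N z y.
  split.
    rewrite (_ : (fun y => _) = (fun y => complex.Re (cexp (y%:C * z)) + (-1) * complex.Re (cexp_sum N.+1 (y%:C * z)))).
      apply: (is_derive_eq (is_derive_addf a1 (is_derive_mulcf (-1) b1))).
      by rewrite [RHS]cReD cReN mulN1r.
    by apply/funext => u; rewrite cReD cReN mulN1r.
  rewrite (_ : (fun y => _) = (fun y => complex.Im (cexp (y%:C * z)) + (-1) * complex.Im (cexp_sum N.+1 (y%:C * z)))).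
    apply: (is_derive_eq (is_derive_addf a2 (is_derive_mulcf (-1) b2))).
    by rewrite [RHS]cImD cImN mulN1r.
  by apply/funext => u; rewrite cImD cImN mulN1r.
have f0 : f 0 = 0.
  rewrite /f !mul0r cexp_real expR0 /cexp_sum big_ord_recl expr0 fact0 divr1 big1 ?addr0 ?subrr// => i _.
  by rewrite exprS !mul0r.
pose K := norm1 z * (2 * expR (norm1 z) * (2 * norm1 z) ^+ N / N`!%:R).
have hb y : 0 <= y <= x -> norm1 (df y) <= K * y ^+ N.
  move=> /andP[y0 yx]; rewrite /df; apply: (le_trans (norm1M _ _)).
  rewrite /K -mulrA ler_wpM2l// mulrAC; apply: ih.
  by rewrite y0 (le_trans yx).
have hR : `|complex.Re (f x)| <= K * x ^+ N.+1 / N.+1%:R.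
  apply: (@derive_pow_bound (fun y => complex.Re (f y)) (fun y => complex.Re (df y))) => //.
  - by move=> y; case: (dfP y).
  - by rewrite f0.
  - by move=> y hy; apply: le_trans (hb y hy); rewrite lerDl.
have hI : `|complex.Im (f x)| <= K * x ^+ N.+1 / N.+1%:R.
  apply: (@derive_pow_bound (fun y => complex.Im (f y)) (fun y => complex.Im (df y))) => //.
  - by move=> y; case: (dfP y).
  - by rewrite f0.
  - by move=> y hy; apply: le_trans (hb y hy); rewrite lerDr.
apply: (le_trans (lerD hR hI)); rewrite /K factS natrM [in leRHS]exprS.
rewrite le_eqVlt; apply/orP; left; apply/eqP.
by field; rewrite !pnatr_eq0 -lt0n fact_gt0 nat1r pnatr_eq0.
Qed.

(** Factorial decay is traded for a rate independent of z: (2 a)^N / N! = 2^-N (4 a)^N / N! <= 2^-N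
    exp (4 a). The price exp (5 a) is still integrable against a Gaussian when a is linear in
    |t|. *)
Lemma cexp_sum_approx (z : C) N :
  norm1 (cexp z - cexp_sum N z) <= 2^-1 ^+ N * (2 * expR (5 * norm1 z)).
Proof.
have := @cexp_remainder z N 1; rewrite !mul1r lexx ler01 => /(_ isT).
move=> /le_trans; apply.
rewrite expr1n mulr1.
have -> : (2 * norm1 z) ^+ N = 2^-1 ^+ N * (4 * norm1 z) ^+ N.
  by rewrite -exprMn; congr (_ ^+ _); field.
have n0 := norm1_ge0 z.
have h : (4 * norm1 z) ^+ N / N`!%:R <= expR (4 * norm1 z).
  by rewrite ler_pdivrMr ?ltr0n ?fact_gt0// [leRHS]mulrC; apply: ler_pow_expR; rewrite mulr_ge0.
have -> : expR (5 * norm1 z) = expR (norm1 z) * expR (4 * norm1 z).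
  by rewrite -expRD; congr expR; ring.
rewrite [leLHS](_ : _ = 2^-1 ^+ N * (2 * (expR (norm1 z) * ((4 * norm1 z) ^+ N / N`!%:R)))); last by ring.
by rewrite !ler_wpM2l ?exprn_ge0 ?expR_ge0.
Qed.

End ComplexExponential.

(** * Rotation invariance and radial integrals on disks *)

Section PlaneMeasure.
Context {R : realType}.
Notation RR := (measurableTypeR R).
Notation mu := (@lebesgue_measure R).
Local Open Scope ereal_scope.

Lemma lebesgue_measure_translation (c : R) (A : set RR) : measurable A ->
  mu ((fun x => x + c)%R @^-1` A) = mu A.
Proof.
move=> mA; have mf : measurable_fun [set: RR] (fun x : RR => (x + c)%R : RR).
  exact: measurable_funD.
apply/esym; apply: (@lebesgue_measure_unique R
  (@measure_function_pushforward__canonical__measure_function_Measure _ _ RR RR R mu _ mf)) => //.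
move=> _ [[a b] _ <-] /=; rewrite /pushforward.
rewrite (_ : _ @^-1` _ = `](a - c)%R, (b - c)%R]%classic); last first.
  by apply/seteqP; split => x /=; rewrite !in_itv/= ltrBlDr lerBrDr.
rewrite !lebesgue_measure_itv/= !lte_fin ltrD2r; case: ifP => // _.
by rewrite -!EFinB; congr (_%:E); ring.
Qed.

Definition plane_preserving (phi : RR * RR -> RR * RR) :=
  measurable_fun setT phi /\
  forall A, measurable A -> mu2 R (phi @^-1` A) = mu2 R A.

Lemma plane_preserving_comp phi psi : plane_preserving phi -> plane_preserving psi ->
  plane_preserving (phi \o psi).
Proof.
move=> [mp hp] [mq hq]; split; first exact: measurableT_comp.
move=> A mA; rewrite comp_preimage hq ?hp//.
by rewrite -[X in measurable X]setTI; exact: mp.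
Qed.

Lemma eq_plane_preserving phi psi : plane_preserving phi -> phi =1 psi -> plane_preserving psi.
Proof. by move=> h /funext <-. Qed.

Lemma mu2E (A : set (RR * RR)) : mu2 R A = \int[mu]_x mu (xsection A x).
Proof. by []. Qed.

Lemma mu2_ysectionE (A : set (RR * RR)) : measurable A ->
  mu2 R A = \int[mu]_y mu (ysection A y).
Proof.
move=> mA.
have h := @product_measure_unique _ _ RR RR R mu mu
  (@lebesgue_integral_fubini_product_measure2__canonical__measure_function_Measure _ _ RR RR R mu mu).
apply: h => // X Y mX mY; exact: product_measure2E.
Qed.

Lemma plane_preserving_shear2 (b : R) : plane_preserving (fun z => (z.1, z.2 + b * z.1)%R).
Proof.
have mf : measurable_fun [set: RR * RR] (fun z : RR * RR => (z.1 : RR, (z.2 + b * z.1)%R : RR)).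
  apply: measurable_fun_pair; first exact: measurable_fst.
  apply: measurable_funD; first exact: measurable_snd.
  by apply: measurable_funM => //; exact: measurable_fst.
split => // A mA.
have mA' : measurable ((fun z : RR * RR => (z.1 : RR, (z.2 + b * z.1)%R : RR)) @^-1` A).
  by rewrite -[X in measurable X]setTI; exact: mf.
rewrite !mu2E; apply: eq_integral => x _.
rewrite -[RHS](lebesgue_measure_translation (b * x)); last exact: measurable_xsection.
by congr (mu _); apply/seteqP; split => y; rewrite /xsection /= !inE.
Qed.

Lemma plane_preserving_shear1 (a : R) : plane_preserving (fun z => (z.1 + a * z.2, z.2)%R).
Proof.
have mf : measurable_fun [set: RR * RR] (fun z : RR * RR => ((z.1 + a * z.2)%R : RR, z.2 : RR)).
  apply: measurable_fun_pair; last exact: measurable_snd.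
  apply: measurable_funD; first exact: measurable_fst.
  by apply: measurable_funM => //; exact: measurable_snd.
split => // A mA.
have mA' : measurable ((fun z : RR * RR => ((z.1 + a * z.2)%R : RR, z.2 : RR)) @^-1` A).
  by rewrite -[X in measurable X]setTI; exact: mf.
rewrite !mu2_ysectionE//; apply: eq_integral => y _.
rewrite -[RHS](lebesgue_measure_translation (a * y)); last exact: measurable_ysection.
by congr (mu _); apply/seteqP; split => x; rewrite /ysection /= !inE.
Qed.

(* A rotation is a product of three shears. *)
Lemma plane_preserving_rotation (c s : R) : (c ^+ 2 + s ^+ 2 = 1)%R -> s != 0%R ->
  plane_preserving (fun z => (c * z.1 + s * z.2, c * z.2 - s * z.1)%R).
Proof.
move=> cs s0; pose a := ((1 - c) / s)%R.
have := plane_preserving_comp (plane_preserving_shear1 a)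
  (plane_preserving_comp (plane_preserving_shear2 (- s)) (plane_preserving_shear1 a)).
move=> /eq_plane_preserving; apply => -[x y] /=.
have e1 : (y + - s * (x + a * y) = c * y - s * x)%R by rewrite /a; field.
rewrite e1; congr (_, _).
have -> : (x + a * y + a * (c * y - s * x) = (x - a * s * x) + a * (1 + c) * y)%R by ring.
have -> : (a * (1 + c) = s)%R.
  have e2 : ((1 - c) * (1 + c) = s ^+ 2)%R.
    transitivity (1 - c ^+ 2)%R; first by ring.
    by rewrite -cs addrAC subrr add0r.
  rewrite /a mulrAC e2.
  by field.
by rewrite /a divfK//; ring.
Qed.

Lemma Rintegral_plane_preserving phi (D : set (RR * RR)) (f : RR * RR -> R) :
  plane_preserving phi -> measurable D -> measurable_fun setT f ->
  phi @^-1` D = D -> (mu2 R).-integrable D (EFin \o (f \o phi)) ->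
  (\int[mu2 R]_(z in D) f (phi z) = \int[mu2 R]_(z in D) f z)%R.
Proof.
move=> [mp hp] mD mf phiD fi; rewrite /Rintegral; congr fine.
have := @integral_pushforward _ _ _ _ R phi mp (mu2 R) D (EFin \o f) _ _ mD.
rewrite phiD => <-; [|exact/measurable_EFinP|exact: fi].
by apply: eq_measure_integral => A mA _; exact: hp.
Qed.

Lemma measurable_sqnorm : measurable_fun [set: RR * RR] (fun z : RR * RR => (z.1 ^+ 2 + z.2 ^+ 2)%R : RR).
Proof.
apply: measurable_funD; apply: measurable_funX; [exact: measurable_fst|exact: measurable_snd].
Qed.

Lemma measurable_disk (r : R) : measurable (disk r : set (RR * RR)).
Proof.
have := measurable_sqnorm measurableT (measurable_itv `]-oo, (r ^+ 2)%R[).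
by rewrite setTI (_ : _ @^-1` _ = disk r).
Qed.

Lemma Rintegral_half_disk (rho : R) : (0 < rho)%R ->
  \int[mu]_(x in `[(- rho)%R, rho]) (2 * Num.sqrt (rho ^+ 2 - x ^+ 2))%:E = (pi * rho ^+ 2)%:E.
Proof.
move=> rho0.
pose F : R -> R := fun x => (rho * sin x)%R.
have dF (x : R) : is_derive x 1%R F (rho * cos x)%R.
  exact: is_derive_mulcf (is_derive_sin x).
have F'E : (F^`()%classic = fun x => rho * cos x)%R.
  by apply/funext => x; rewrite derive1E; case: (dF x).
have ccos : continuous (fun x : R => rho * cos x)%R.
  by move=> x; apply: cvgM; [exact: cvg_cst|exact: continuous_cos].
have pi2 : (- (pi / 2) <= pi / 2 :> R)%R by rewrite (@le_trans _ _ 0%R) ?oppr_le0 ?divr_ge0 ?pi_ge0.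
have Fa : F (- (pi / 2))%R = (- rho)%R by rewrite /F sinN sin_pihalf mulrN1.
have Fb : F (pi / 2)%R = rho by rewrite /F sin_pihalf mulr1.
have := @integration_by_substitution_increasing R F (fun x => 2 * Num.sqrt (rho ^+ 2 - x ^+ 2))%R (- (pi / 2)) (pi / 2) pi2.
rewrite Fa Fb F'E => ->; last 6 first.
- by move=> x y xi yi xy; rewrite /F ltr_pM2l// ltr_sin.
- by move=> x _; exact: ccos.
- by apply/cvg_ex; eexists; apply: cvg_at_right_filter; exact: ccos.
- by apply/cvg_ex; eexists; apply: cvg_at_left_filter; exact: ccos.
- have cF : continuous F.
    by move=> x; apply/differentiable_continuous/derivable1_diffP; case: (dF x).
  split; first by move=> x _; case: (dF x).
  + by apply: cvg_at_right_filter; exact: cF.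
  + by apply: cvg_at_left_filter; exact: cF.
- apply: continuous_subspaceT => x; apply: cvgM; first exact: cvg_cst.
  apply: (cvg_comp (fun y : R => rho ^+ 2 - y ^+ 2)%R Num.sqrt); last exact: sqrt_continuous.
  by apply: cvgB; [exact: cvg_cst|exact: exprn_continuous].
pose G : R -> R := fun x => (rho ^+ 2 * (x + sin x * cos x))%R.
have dG (x : R) : is_derive x 1%R G (2 * (rho ^+ 2 * cos x ^+ 2))%R.
  have h := is_derive_mulcf (rho ^+ 2) (is_derive_addf (is_derive_id x 1%R)
     (is_derive_mulf (is_derive_sin x) (is_derive_cos x))).
  apply: (is_derive_eq h).
  by rewrite -{1}(cos2Dsin2 x); ring.
have cG : continuous (fun x : R => 2 * (rho ^+ 2 * cos x ^+ 2))%R.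
  move=> x; apply: cvgM; first exact: cvg_cst.
  apply: cvgM; first exact: cvg_cst.
  apply: (cvg_comp cos (fun y : R => y ^+ 2)%R); last exact: exprn_continuous.
  exact: continuous_cos.
have piL : (- (pi / 2) < pi / 2 :> R)%R.
  by rewrite (@lt_trans _ _ 0%R) ?oppr_lt0 ?divr_gt0 ?pi_gt0.
have := @derivable_FTC2 R _ G (- (pi / 2)) (pi / 2) piL dG cG.
rewrite /G sinN sin_pihalf cosN cos_pihalf !mulr0 !addr0 mulrN opprK => h.
have e : (rho ^+ 2 * (pi / 2) + rho ^+ 2 * (pi / 2) = pi * rho ^+ 2)%R by field.
rewrite e in h; rewrite -h.
rewrite /Rintegral fineK; last first.
  apply: integrable_fin_num => //.
  apply: continuous_compact_integrable; first exact: segment_compact.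
  exact: continuous_subspaceT.
apply: eq_integral => x; rewrite inE/= in_itv/= => xi; congr (_%:E).
rewrite !fctE /F /=.
have -> : (rho ^+ 2 - (rho * sin x) ^+ 2 = (rho * cos x) ^+ 2)%R.
  by rewrite !exprMn -[X in (X - _)%R]mulr1 -{1}(cos2Dsin2 x); ring.
rewrite sqrtr_sqr ger0_norm; last by rewrite mulr_ge0 ?(ltW rho0)// cos_ge0_pihalf.
ring.
Qed.

(** The parameter is the squared radius and may be negative: these are the sublevel sets that
    determine the image of plane measure under [pi_sqnorm]. *)
Definition closed_disk2 (b : R) : set (RR * RR) := [set z | z.1 ^+ 2 + z.2 ^+ 2 <= b]%R.

Lemma mu2_closed_disk2 (b : R) : mu2 R (closed_disk2 b) = (pi * Num.max b 0)%:E.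
Proof.
have sec x : mu (xsection (closed_disk2 b) x) = (2 * Num.sqrt (b - x ^+ 2))%:E.
  have [xb|xb] := leP (x ^+ 2)%R b.
    have -> : xsection (closed_disk2 b) x =
        `[(- Num.sqrt (b - x ^+ 2))%R, (Num.sqrt (b - x ^+ 2))%R]%classic.
      apply/seteqP; split => y; rewrite /xsection /=.
        rewrite inE /closed_disk2 /= in_itv/= -ler_norml.
        by rewrite addrC -lerBrDr => h; rewrite -sqrtr_sqr ler_wsqrtr.
      rewrite in_itv/= -ler_norml inE /closed_disk2 /= => h.
      rewrite addrC -lerBrDr.
      rewrite -[leRHS]sqr_sqrtr ?subr_ge0// -(real_normK (num_real y)).
      by rewrite ler_pXn2r ?nnegrE// sqrtr_ge0.
    rewrite lebesgue_measure_itv/= lte_fin.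
    have := sqrtr_ge0 (b - x ^+ 2); rewrite le_eqVlt => /predU1P[<-|s0].
      by rewrite oppr0 ltxx mulr0.
    by rewrite (@lt_trans _ _ 0%R) ?oppr_lt0// -EFinB; congr (_%:E); ring.
  have -> : xsection (closed_disk2 b) x = set0.
    apply/seteqP; split => // y; rewrite /xsection /= !inE /closed_disk2 /= => h.
    by move: xb; rewrite ltNge (le_trans _ h)// lerDl sqr_ge0.
  by rewrite measure0 ler0_sqrtr ?mulr0// subr_le0 ltW.
rewrite mu2E; under eq_integral do rewrite sec.
have [b0|b0] := leP b 0%R.
  rewrite mulr0 integral0_eq// => x _; rewrite ler0_sqrtr ?mulr0//.
  by rewrite subr_le0 (le_trans b0)// sqr_ge0.
have bE : b = (Num.sqrt b ^+ 2)%R by rewrite sqr_sqrtr// ltW.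
have s0 : (0 < Num.sqrt b)%R by rewrite sqrtr_gt0.
rewrite {2}bE -Rintegral_half_disk// -bE [RHS]integral_mkcond.
apply: eq_integral => x _; rewrite /patch; case: ifPn => //.
rewrite notin_setE /= in_itv/= -ler_norml => /negP; rewrite -ltNge => h.
rewrite ler0_sqrtr ?mulr0// subr_le0 bE -(real_normK (num_real x)).
by rewrite ler_pXn2r ?nnegrE ?(ltW s0) ?(ltW h).
Qed.

Lemma mu2_disk_lty (r : R) : mu2 R (disk r) < +oo.
Proof.
apply: (@le_lt_trans _ _ (mu2 R (closed_disk2 (r ^+ 2)))).
  apply: le_measure; rewrite ?inE.
  - exact: measurable_disk.
  - have := measurable_sqnorm measurableT (measurable_itv `]-oo, (r ^+ 2)%R]).
    by rewrite setTI (_ : _ @^-1` _ = closed_disk2 (r ^+ 2)).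
  - by move=> z; rewrite /disk /closed_disk2 /= => /ltW.
by rewrite mu2_closed_disk2 ltry.
Qed.

Definition pi_sqnorm (z : RR * RR) : RR := (pi * (z.1 ^+ 2 + z.2 ^+ 2))%R.

Lemma measurable_pi_sqnorm : measurable_fun [set: RR * RR] pi_sqnorm.
Proof. by apply: measurable_funM => //; exact: measurable_sqnorm. Qed.

(** Polar coordinates without the angle: the region pi |z|^2 <= b has area max (b, 0), so the image
    of plane measure is Lebesgue measure on the half-line. Adding Lebesgue measure of the negative
    axis gives [nu], a measure on the whole line to which uniqueness on half-open intervals
    applies. *)
Lemma pushforward_pi_sqnorm (A : set RR) : measurable A ->
  A `<=` `[0%R, +oo[%classic -> mu2 R (pi_sqnorm @^-1` A) = mu A.
Proof.
move=> mA A0.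
have mN : measurable (`]-oo, 0%R[%classic : set RR) by exact: measurable_itv.
pose nu1 := @measure_function_pushforward__canonical__measure_function_Measure _ _ _ RR R (mu2 R) _ measurable_pi_sqnorm.
pose nu2 : {measure set RR -> \bar R} := mrestr mu mN.
pose nu := measure_add nu1 nu2.
have nuE X : nu X = mu2 R (pi_sqnorm @^-1` X) + mu (X `&` `]-oo, 0%R[) by rewrite /nu measure_addE.
have h : forall X, ocitv X -> mu X = nu X.
  move=> _ [[a b] _ <-]; rewrite nuE [(a, b).1]/= [(a, b).2]/=.
  have pi0 := pi_gt0 R.
  have mcd (e : R) : measurable (closed_disk2 e).
    have := measurable_sqnorm measurableT (measurable_itv `]-oo, e]).
    by rewrite setTI (_ : _ @^-1` _ = closed_disk2 e).
  have -> : pi_sqnorm @^-1` `]a, b] = closed_disk2 (b / pi) `\` closed_disk2 (a / pi).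
    apply/seteqP; split => z; rewrite /pi_sqnorm /closed_disk2 /= in_itv/=.
      move=> /andP[az zb]; split; first by rewrite ler_pdivlMr// mulrC.
      by apply/negP; rewrite -ltNge ltr_pdivrMr// mulrC.
    move=> [zb /negP]; rewrite -ltNge => az.
    by rewrite mulrC -ltr_pdivrMr// az -ler_pdivlMr.
  have [ab|ba] := ltP a b; last first.
    rewrite set_itv_ge ?bnd_simp -?leNgt// set0I !measure0 adde0.
    rewrite (_ : _ `\` _ = set0) ?measure0//.
    apply/seteqP; split => // z [/= h1]; apply.
    by apply: (le_trans h1); rewrite ler_pM2r ?invr_gt0.
  have fin (e : R) : mu2 R (closed_disk2 e) < +oo by rewrite mu2_closed_disk2 ltry.
  have E (U V : set (RR * RR)) : measurable U -> measurable V -> mu2 R U < +oo ->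
    mu2 R (U `\` V) = mu2 R U - mu2 R (U `&` V) by exact: measureD.
  rewrite E//.
  rewrite setIidr; last first.
    by move=> z /= h1; apply: (le_trans h1); rewrite ler_pM2r ?invr_gt0// ltW.
  have mx (e : R) : (pi * Num.max (e / pi) 0 = Num.max e 0)%R.
    by rewrite maxr_pMr ?(ltW pi0)// mulr0 mulrCA divff ?mulr1// gt_eqF.
  rewrite !mu2_closed_disk2 !mx -EFinB.
  have [b0|b0] := ltP b 0%R.
    rewrite (_ : _ `&` _ = `]a, b]%classic); last first.
      rewrite setIidl// => x /=; rewrite !in_itv/= => /andP[_ xb]; exact: le_lt_trans b0.
    by rewrite max_r ?(ltW (lt_trans ab b0))// subr0 add0e.
  have [a0|a0] := ltP a 0%R.
    rewrite (_ : _ `&` _ = `]a, 0%R[%classic); last first.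
      apply/seteqP; split => x /=; rewrite !in_itv/=.
        by move=> [/andP[-> _] ->].
      by move=> /andP[-> x0]; rewrite x0 (le_trans (ltW x0)).
    by rewrite !lebesgue_measure_itv/= !lte_fin ab a0 subr0 -!EFinB -EFinD; congr (_%:E); ring.
  rewrite (_ : _ `&` _ = set0) ?measure0 ?adde0; last first.
    by apply/seteqP; split => // x /=; rewrite !in_itv/= => -[/andP[ax _] /(lt_trans (le_lt_trans a0 ax))]; rewrite ltxx.
  by rewrite lebesgue_measure_itv/= lte_fin ab -EFinB.
have E : mu A = nu A := lebesgue_measure_unique h mA; rewrite E nuE.
rewrite (_ : A `&` _ = set0) ?measure0 ?adde0//.
apply/seteqP; split => // x [/A0] /=; rewrite !in_itv/= andbT => x0 /(le_lt_trans x0).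
by rewrite ltxx.
Qed.

Lemma Rintegral_disk_radial (r : R) (f : R -> R) : (0 < r)%R ->
  measurable_fun setT f ->
  (mu2 R).-integrable (disk r) (EFin \o (f \o pi_sqnorm)) ->
  mu.-integrable `[0%R, (pi * r ^+ 2)%R[ (EFin \o f) ->
  (\int[mu2 R]_(z in disk r) f (pi_sqnorm z) = \int[mu]_(s in `[0, pi * r ^+ 2]) f s)%R.
Proof.
move=> r0 mf fi fi'; have pi0 := pi_gt0 R.
have dE : pi_sqnorm @^-1` `[0%R, (pi * r ^+ 2)%R[ = disk r.
  apply/seteqP; split => z; rewrite /pi_sqnorm /disk /= in_itv/= ltr_pM2l//.
    by move=> /andP[].
  by move=> ->; rewrite mulr_ge0 ?pi_ge0// addr_ge0 ?sqr_ge0.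
have h := @integral_pushforward _ _ _ _ R _ measurable_pi_sqnorm (mu2 R)
  `[0%R, (pi * r ^+ 2)%R[%classic (EFin \o f).
rewrite dE in h.
rewrite -Rintegral_itv_bndo_bndc// /Rintegral; congr fine.
rewrite -[LHS]h//; last exact/measurable_EFinP.
apply: (eq_measure_integral mu (m1 := @measure_function_pushforward__canonical__measure_function_Measure _ _ _ RR R (mu2 R) _ measurable_pi_sqnorm)) => A mA A0.
rewrite -[LHS]/(mu2 R (pi_sqnorm @^-1` A)) pushforward_pi_sqnorm// => x /A0 /=.
by rewrite !in_itv/= andbT => /andP[].
Qed.

End PlaneMeasure.

(** * Gaussian-weighted monomials on a disk *)

Section DiskMonomials.
Context {R : realType}.
Notation C := R[i].
Notation RR := (measurableTypeR R).

Lemma expiD (a b : R) : expi (a + b) = expi a * expi b.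
Proof. by apply: complex_ext; rewrite ?cReM ?cImM /= ?cosD ?sinD// addrC. Qed.

Lemma expi0 : expi 0 = 1 :> C.
Proof. by rewrite /expi cos0 sin0. Qed.

Lemma expiX (a : R) n : expi a ^+ n = expi (n%:R * a).
Proof.
elim: n => [|n ih]; first by rewrite expr0 mul0r expi0.
by rewrite exprS ih -expiD -natr1 mulrDl mul1r addrC.
Qed.

Lemma expiJ (a : R) : (expi a)^* = expi (- a).
Proof. by apply: complex_ext; rewrite ?cReJ ?cImJ /= ?cosN ?sinN. Qed.

(* Identifies the plane with C through (x, omega) |-> x - i omega, for which the
   Bargmann transform is holomorphic. *)
Definition conj_point (z : R * R) : C := z.1 -i* z.2.

Definition gauss_weight (z : R * R) : R := expR (- pi_sqnorm z).

Definition disk_mono (m n : nat) (z : R * R) : C :=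
  conj_point z ^+ m * (conj_point z)^* ^+ n * (gauss_weight z)%:C.

Lemma cmeasurable_conj_point : cmeasurable [set: RR * RR] (fun z => conj_point z).
Proof.
split; first exact: measurable_fst.
by apply: measurableT_comp => //; exact: measurable_snd.
Qed.

Lemma measurable_gauss_weight : measurable_fun [set: RR * RR] (fun z => gauss_weight z).
Proof.
rewrite (_ : (fun z => _) = @expR R \o (\- pi_sqnorm))//.
apply: measurableT_comp => //; apply: measurable_funN.
exact: measurable_pi_sqnorm.
Qed.

Lemma cmeasurable_disk_mono m n : cmeasurable [set: RR * RR] (fun z => disk_mono m n z).
Proof.
have h := cmeasurable_conj_point.
apply: cmeasurableM; last by apply: cmeasurable_real; exact: measurable_gauss_weight.
apply: cmeasurableM; first exact: cmeasurableX.
by apply: cmeasurableX; exact: cmeasurableJ.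
Qed.

Lemma norm1_conj_point (r : R) z : 0 < r -> disk r z -> norm1 (conj_point z) <= 2 * r.
Proof.
move=> r0; rewrite /disk /= => h; rewrite /norm1 /= normrN mulr_natl mulr2n.
have aux (x y : R) : x ^+ 2 + y ^+ 2 < r ^+ 2 -> `|x| <= r.
  move=> xy; rewrite -(@ler_pXn2r _ 2) ?nnegrE ?(ltW r0)// real_normK ?num_real//.
  by apply: ltW; apply: le_lt_trans xy; rewrite lerDl sqr_ge0.
by apply: lerD; [exact: (aux _ z.2)|apply: (aux _ z.1); rewrite addrC].
Qed.

Lemma gauss_weight_le1 z : 0 <= gauss_weight z <= 1.
Proof.
rewrite expR_ge0 -[leRHS]expR0 ler_expR oppr_le0 mulr_ge0 ?pi_ge0//.
by rewrite addr_ge0 ?sqr_ge0.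
Qed.

Lemma integrable_disk_cst (r M : R) : (mu2 R).-integrable (disk r) (EFin \o (fun=> M)).
Proof.
apply: (@measurable_bounded_integrable _ _ R (mu2 R) (fun=> M)) => //.
- exact: measurable_disk.
- exact: mu2_disk_lty.
- exact: bounded_cst.
Qed.

Lemma cmeasurableS d (T : measurableType d) (D E : set T) (f : T -> C) :
  measurable E -> D `<=` E -> cmeasurable E f -> cmeasurable D f.
Proof. by move=> mE DE [f1 f2]; split; apply: (measurable_funS mE DE). Qed.

Lemma cintegrable_disk_bounded (r M : R) (f : R * R -> C) :
  cmeasurable (disk r : set (RR * RR)) f ->
  (forall z, disk r z -> norm1 (f z) <= M) -> cintegrable (mu2 R) (disk r) f.
Proof.
move=> mf fM; apply: (cintegrable_le (measurable_disk r) mf fM).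
exact: integrable_disk_cst.
Qed.

Lemma norm1_disk_mono (r : R) m n z : 0 < r -> disk r z ->
  norm1 (disk_mono m n z) <= (2 * r) ^+ m * (2 * r) ^+ n.
Proof.
move=> r0 zr; have w := norm1_conj_point r0 zr; have w0 := norm1_ge0 (conj_point z).
have /andP[g0 g1] := gauss_weight_le1 z.
have r20 : 0 <= 2 * r by rewrite mulr_ge0 ?ltW.
rewrite /disk_mono mulrC norm1_realM ger0_norm//.
apply: (@le_trans _ _ (norm1 (conj_point z ^+ m * (conj_point z)^* ^+ n))).
  by rewrite ler_piMl// norm1_ge0.
apply: (le_trans (norm1M _ _)); apply: ler_pM; rewrite ?norm1_ge0//.
  apply: (le_trans (norm1X _ _)).
  by case: m => [//|m]; rewrite ler_pXn2r ?nnegrE.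
apply: (le_trans (norm1X _ _)); rewrite norm1J.
by case: n => [//|n]; rewrite ler_pXn2r ?nnegrE.
Qed.

Lemma cintegrable_disk_mono (r : R) m n : 0 < r ->
  cintegrable (mu2 R) (disk r) (fun z => disk_mono m n z).
Proof.
move=> r0; apply: (@cintegrable_disk_bounded _ ((2 * r) ^+ m * (2 * r) ^+ n)).
  by apply: cmeasurableS (cmeasurable_disk_mono m n).
by move=> z zr; exact: norm1_disk_mono.
Qed.

Lemma cintegral_plane_preserving phi (D : set (RR * RR)) (f : RR * RR -> C) :
  plane_preserving phi -> measurable D -> cmeasurable setT f ->
  phi @^-1` D = D -> cintegrable (mu2 R) D (fun z => f (phi z)) ->
  cintegral (mu2 R) D (fun z => f (phi z)) = cintegral (mu2 R) D f.
Proof.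
move=> hp mD [f1 f2] phiD [i1 i2].
rewrite /cintegral; congr (_ +i* _).
  exact: (Rintegral_plane_preserving hp mD f1 phiD i1).
exact: (Rintegral_plane_preserving hp mD f2 phiD i2).
Qed.

(** Rotation by phi preserves the disk and multiplies the integrand by exp (i (m - n) phi), so the
    integral is fixed by a factor that can be chosen different from 1. *)
Lemma cintegral_disk_mono_neq (r : R) m n : 0 < r -> m != n ->
  cintegral (mu2 R) (disk r) (disk_mono m n) = 0.
Proof.
move=> r0 mn.
(* With truncated subtraction this is |m - n|. The angle pi / (2 d) lies strictly between 0 and pi,
   as the rotation lemma requires of its sine, and makes [zeta] equal to i or -i. *)
pose d := ((m - n) + (n - m))%N.
have d0 : (0 < d)%N by rewrite /d addn_gt0 !subn_gt0 -neq_ltn eq_sym.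
have d0' : 0 < d%:R :> R by rewrite ltr0n.
pose phi : R := pi / 2 / d%:R.
have pi0 := pi_gt0 R.
have phi0 : 0 < phi by rewrite /phi !divr_gt0.
have phipi : phi < pi.
  rewrite /phi ltr_pdivrMr//; apply: (@lt_le_trans _ _ pi).
    by rewrite ltr_pdivrMr// ltr_pMr// ltr1n.
  by rewrite ler_peMr ?(ltW pi0)// ler1n.
have s0 : sin phi != 0 by rewrite gt_eqF// sin_gt0_pi// phi0.
have hp := plane_preserving_rotation (cos2Dsin2 phi) s0.
set rot := (fun z => _) in hp.
have hw z : conj_point (rot z) = expi phi * conj_point z.
  by apply: complex_ext; rewrite ?cReM ?cImM /=; ring.
have hq z : (rot z).1 ^+ 2 + (rot z).2 ^+ 2 = z.1 ^+ 2 + z.2 ^+ 2.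
  rewrite /rot /=.
  rewrite -[z.1 ^+ 2]mul1r -[z.2 ^+ 2]mul1r -(cos2Dsin2 phi); ring.
have hD : rot @^-1` (disk r) = disk r.
  by apply/seteqP; split => z; rewrite /disk /= hq.
pose zeta : C := expi phi ^+ m * (expi phi)^* ^+ n.
have hf z : disk_mono m n (rot z) = zeta * disk_mono m n z.
  rewrite /disk_mono /gauss_weight /pi_sqnorm hq hw rmorphM !exprMn /zeta.
  by ring.
have iI := cintegrable_disk_mono m n r0.
have mD := @measurable_disk R r.
have : cintegral (mu2 R) (disk r) (disk_mono m n) = zeta * cintegral (mu2 R) (disk r) (disk_mono m n).
  rewrite -cintegralZ//.
  rewrite -[LHS](cintegral_plane_preserving hp mD (cmeasurable_disk_mono m n) hD).
    by apply: eq_cintegral => z _; rewrite hf.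
  have := cintegrableZ zeta mD iI.
  by congr (cintegrable _ _ _); apply/funext => z; rewrite hf.
move: (cintegral _ _ _) => I hI.
have : (1 - zeta) * I = 0 by rewrite mulrBl mul1r -hI subrr.
move/eqP; rewrite mulf_eq0 => /orP[|/eqP//]; rewrite subr_eq0 => /eqP z1.
have zE : zeta = expi ((m%:R - n%:R) * phi).
  by rewrite /zeta expiJ !expiX -expiD; congr expi; ring.
exfalso; move: z1; rewrite zE.
have [mn'|nm] := ltnP n m.
  have -> : (m%:R - n%:R) * phi = pi / 2.
    rewrite /phi /d -natrB ?(ltnW mn')// (_ : (n - m = 0)%N); last by apply/eqP; rewrite subn_eq0 ltnW.
    rewrite addn0; field; rewrite pnatr_eq0 -lt0n subn_gt0 mn'//.
  by rewrite /expi cos_pihalf => -[/eqP]; rewrite oner_eq0.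
have mn' : (m < n)%N by rewrite ltn_neqAle mn.
have -> : (m%:R - n%:R) * phi = - (pi / 2).
  rewrite /phi /d -opprB -natrB ?(ltnW mn')// (_ : (m - n = 0)%N); last by apply/eqP; rewrite subn_eq0 ltnW.
  by rewrite add0n; field; rewrite pnatr_eq0 -lt0n subn_gt0 mn'.
by rewrite /expi cosN cos_pihalf => -[/eqP]; rewrite oner_eq0.
Qed.

(** The modulus is radial and becomes a Gamma density in the variable pi |z|^2: this is the origin
    of the Poisson sums in the eigenvalues. *)
Lemma disk_mono_diag n z : disk_mono n n z = (n`!%:R / pi ^+ n * gamma_pdf n (pi_sqnorm z))%:C.
Proof.
have pi0 : pi != 0 :> R by rewrite gt_eqF// pi_gt0.
have f0 : n`!%:R != 0 :> R by rewrite pnatr_eq0 -lt0n fact_gt0.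
rewrite /disk_mono -exprMn.
have -> : conj_point z * (conj_point z)^* = (z.1 ^+ 2 + z.2 ^+ 2)%:C.
  by apply: complex_ext; rewrite ?cReM ?cImM ?cReJ ?cImJ /=; ring.
rewrite -rmorphXn -rmorphM; congr (_%:C).
rewrite /gamma_pdf /gauss_weight /pi_sqnorm exprMn; field.
by rewrite f0 expf_neq0.
Qed.

Lemma cintegral_disk_mono_diag (r : R) n : 0 < r ->
  cintegral (mu2 R) (disk r) (disk_mono n n) =
  (n`!%:R / pi ^+ n * (1 - gamma_tail n (pi * r ^+ 2)))%:C.
Proof.
move=> r0.
have pr0 : 0 < pi * r ^+ 2 :> R by rewrite mulr_gt0 ?pi_gt0 ?exprn_gt0.
pose f : R -> R := fun s => n`!%:R / pi ^+ n * gamma_pdf n s.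
have cf : continuous f.
  by move=> s; apply: cvgM; [exact: cvg_cst|exact: continuous_gamma_pdf].
have [i1 _] := cintegrable_disk_mono n n r0.
have e1 : (fun z => complex.Re (disk_mono n n z)) = f \o pi_sqnorm.
  by apply/funext => z; rewrite disk_mono_diag.
rewrite e1 in i1.
apply: complex_ext.
  rewrite /cintegral e1 [LHS]/=.
  rewrite (@Rintegral_disk_radial R r f r0 _ i1); last 2 first.
  - exact: continuous_measurable_fun.
  - have h : (@lebesgue_measure R).-integrable `[0, pi * r ^+ 2] (EFin \o f).
      apply: continuous_compact_integrable; first exact: segment_compact.
      exact: continuous_subspaceT.
    by apply: (integrableS _ _ _ h) => //; exact: subset_itv_co_cc.
  rewrite /f RintegralZl//; last first.
    apply: continuous_compact_integrable; first exact: segment_compact.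
    by apply: continuous_subspaceT; exact: continuous_gamma_pdf.
  by rewrite Rintegral_gamma_pdf.
rewrite /cintegral [LHS]/= (_ : (fun t => complex.Im _) = cst 0); last first.
  by apply/funext => z; rewrite disk_mono_diag.
by rewrite /Rintegral integral0.
Qed.

End DiskMonomials.

(** * The short-time Fourier transform with Gaussian window *)

Section Bargmann.
Context {R : realType}.
Notation C := R[i].
Notation RR := (measurableTypeR R).

Lemma L2_cmeasurable (f : R -> C) : L2 f -> cmeasurable [set: RR] f.
Proof.
by move=> []; rewrite !inE => /andP[/[!inE] h1 _] /andP[/[!inE] h2 _].
Qed.

Lemma L2_integrable_sqr (f : R -> C) : L2 f ->
  (mu1 R).-integrable setT (EFin \o (fun t => norm1 (f t) ^+ 2)).
Proof.
move=> lf; have [m1 m2] := L2_cmeasurable lf; have [/Lfun2_integrable_sqr h1 /Lfun2_integrable_sqr h2] := lf.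
apply: (le_integrable_real measurableT _ _ (integrable_realZ measurableT 2 (integrable_realD measurableT h1 h2))).
  by apply: measurable_funX; apply: measurable_funD; apply: measurableT_comp.
move=> t _; rewrite ger0_norm ?sqr_ge0// /norm1.
rewrite -(real_normK (num_real (complex.Re (f t)))) -(real_normK (num_real (complex.Im (f t)))).
move: `|_| `|_| => a b; have := sqr_ge0 (a - b); nra.
Qed.

Lemma L2_norm1_sqr (f : R -> C) : cmeasurable [set: RR] f ->
  (mu1 R).-integrable setT (EFin \o (fun t => norm1 (f t) ^+ 2)) -> L2 f.
Proof.
move=> [m1 m2] fi.
have aux (g : R -> R) : measurable_fun [set: RR] g -> (forall t, `|g t| <= norm1 (f t)) ->
    g \in Lfun (mu1 R) 2%:E.
  move=> mg gf; rewrite inE; apply/andP; split; rewrite inE//=.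
  rewrite /finite_norm unlock /Lnorm poweR_lty//.
  have gi : (mu1 R).-integrable setT (EFin \o (fun t => g t ^+ 2)).
    apply: (le_integrable_real measurableT _ _ fi); first exact: measurable_funX.
    by move=> t _; rewrite normrX ler_pXn2r ?nnegrE ?norm1_ge0.
  move/integrableP: gi => [_]; apply: le_lt_trans.
  rewrite le_eqVlt; apply/orP; left; apply/eqP; apply: eq_integral => t _ /=.
  by rewrite powR_mulrn// normrX.
by split; apply: aux => // t; rewrite ?lerDl ?lerDr.
Qed.

(** From a b <= a^2 + b^2, the squared weight being again a Gaussian with a linear term. The
    parameter [B] leaves room for the exponential kernels of the transform. *)
Lemma integrable_L2_weight (u : R -> C) (B : R) : L2 u ->
  (mu1 R).-integrable setT (EFin \o (fun t => norm1 (u t) * expR (- (pi * t ^+ 2) + B * `|t|))).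
Proof.
move=> lu; have [m1 m2] := L2_cmeasurable lu.
have pi0 := pi_gt0 R.
have p20 : 0 < 2 * pi :> R by rewrite mulr_gt0.
have i2 := integrable_gauss_linear (2 * B) p20.
apply: (le_integrable_real measurableT _ _ (integrable_realD measurableT (L2_integrable_sqr lu) i2)).
  apply: measurable_funM; first by apply: measurable_funD; apply: measurableT_comp.
  apply: measurableT_comp => //; apply: measurable_funD; last exact: measurable_funM.
  by apply: measurableT_comp => //; apply: measurable_funM => //; exact: measurable_funX.
move=> t _; rewrite ger0_norm ?mulr_ge0 ?norm1_ge0 ?expR_ge0//.
have -> : expR (- (2 * pi * t ^+ 2) + 2 * B * `|t|) = expR (- (pi * t ^+ 2) + B * `|t|) ^+ 2.
  by rewrite -expRM_natl; congr expR; ring.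
move: (norm1 _) (expR _) => a b; have := sqr_ge0 (a - b); have := sqr_ge0 a; have := sqr_ge0 b; nra.
Qed.

Definition gauss_half (t : R) : R := expR (- (pi * t ^+ 2)).

Lemma measurable_gauss_half : measurable_fun [set: RR] gauss_half.
Proof.
apply: measurableT_comp => //; apply: measurableT_comp => //.
by apply: measurable_funM => //; exact: measurable_funX.
Qed.

Lemma L2_cintegrable (u h : R -> C) (K B : R) : L2 u -> cmeasurable [set: RR] h ->
  (forall t, norm1 (h t) <= K * expR (- (pi * t ^+ 2) + B * `|t|)) ->
  cintegrable (mu1 R) setT (fun t => u t * h t).
Proof.
move=> lu mh hb.
apply: (cintegrable_le measurableT _ _ (integrable_realZ measurableT K (integrable_L2_weight B lu))).
  by apply: cmeasurableM => //; exact: L2_cmeasurable.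
move=> t _; apply: (le_trans (norm1M _ _)).
by rewrite mulrCA ler_wpM2l ?norm1_ge0.
Qed.

Definition moment (u : R -> C) (n : nat) : C :=
  cintegral (mu1 R) setT (fun t => u t * (t ^+ n * gauss_half t)%:C).

Lemma cintegrable_moment u n : L2 u ->
  cintegrable (mu1 R) setT (fun t => u t * (t ^+ n * gauss_half t)%:C).
Proof.
move=> lu; apply: (@L2_cintegrable _ _ n`!%:R 1) => //.
  apply: cmeasurable_real; apply: measurable_funM; last exact: measurable_gauss_half.
  exact: measurable_funX.
move=> t; rewrite norm1_real normrM normrX [`|gauss_half t|]ger0_norm ?expR_ge0//.
rewrite expRD mul1r mulrCA [leLHS]mulrC ler_wpM2l ?expR_ge0//.
exact: ler_pow_expR.
Qed.

(* Up to a Gaussian factor, the Bargmann transform of [u]; its Taylor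
   coefficients are the moments of [u] against the Gaussian. *)
Definition laplace_gauss (u : R -> C) (w : C) : C :=
  cintegral (mu1 R) setT (fun t => u t * ((gauss_half t)%:C * cexp ((2 * pi * t)%:C * w))).

Lemma cmeasurable_cexp d (T : measurableType d) (D : set T) (f : T -> C) :
  cmeasurable D f -> cmeasurable D (fun t => cexp (f t)).
Proof.
move=> [f1 f2]; split.
  under eq_fun do rewrite Re_cexp.
  by apply: measurable_funM; apply: measurableT_comp => //; apply: continuous_measurable_fun; exact: continuous_cos.
under eq_fun do rewrite Im_cexp.
by apply: measurable_funM; apply: measurableT_comp => //; apply: continuous_measurable_fun; exact: continuous_sin.
Qed.

Lemma norm1_scale_le (t B : R) (w : C) : norm1 w <= B ->
  norm1 ((2 * pi * t)%:C * w) <= 2 * pi * B * `|t|.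
Proof.
move=> wB; rewrite norm1_realM !normrM (ger0_norm (pi_ge0 R)) ger0_norm//.
by rewrite mulrAC ler_wpM2r// ler_wpM2l// mulr_ge0 ?pi_ge0.
Qed.

Lemma cmeasurable_scale (w : C) : cmeasurable [set: RR] (fun t => (2 * pi * t)%:C * w).
Proof.
by apply: cmeasurableM; [apply: cmeasurable_real; exact: measurable_funM|exact: cmeasurable_cst].
Qed.

Lemma cintegrable_laplace_gauss u (w : C) : L2 u ->
  cintegrable (mu1 R) setT (fun t => u t * ((gauss_half t)%:C * cexp ((2 * pi * t)%:C * w))).
Proof.
move=> lu; apply: (@L2_cintegrable _ _ 2 (2 * pi * norm1 w)) => //.
  apply: cmeasurableM; first by apply: cmeasurable_real; exact: measurable_gauss_half.
  by apply: cmeasurable_cexp; exact: cmeasurable_scale.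
move=> t; rewrite norm1_realM ger0_norm ?expR_ge0// expRD mulrCA ler_wpM2l ?expR_ge0//.
apply: (le_trans (norm1_cexp _)); rewrite ler_wpM2l// ler_expR.
exact: norm1_scale_le.
Qed.

Definition laplace_gauss_sum (N : nat) (u : R -> C) (w : C) : C :=
  \sum_(n < N) ((2 * pi)%:C * w) ^+ n / n`!%:R * moment u n.

Lemma laplace_gauss_sumE N u w : L2 u -> laplace_gauss_sum N u w =
  cintegral (mu1 R) setT (fun t => u t * ((gauss_half t)%:C * cexp_sum N ((2 * pi * t)%:C * w))).
Proof.
move=> lu; rewrite /laplace_gauss_sum -cintegral_lincomb//; last by move=> i; exact: cintegrable_moment.
apply: eq_cintegral => t _; rewrite /cexp_sum !mulr_sumr; apply: eq_bigr => i _.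
by rewrite !rmorphM !rmorphXn !exprMn; ring.
Qed.

(** [K] is chosen before [w] and [N]: uniformity on bounded sets is what allows integration of the
    error over a disk. *)
Lemma laplace_gauss_approx u (B : R) : L2 u -> exists2 K : R, 0 <= K &
  forall w N, norm1 w <= B -> norm1 (laplace_gauss u w - laplace_gauss_sum N u w) <= 2^-1 ^+ N * K.
Proof.
move=> lu.
(* The rate 10 pi B is 5 times 2 pi B, from the exp (5 |z|) of [cexp_sum_approx] at z = 2 pi t w. *)
pose k (t : R) := norm1 (u t) * expR (- (pi * t ^+ 2) + 10 * pi * B * `|t|).
exists (\int[mu1 R]_t (2 * k t)).
  by apply: Rintegral_ge0 => t _; rewrite !mulr_ge0 ?norm1_ge0 ?expR_ge0.
move=> w N wB.
pose D (t : R) := u t * ((gauss_half t)%:C * (cexp ((2 * pi * t)%:C * w) - cexp_sum N ((2 * pi * t)%:C * w))).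
have hD t : norm1 (D t) <= 2^-1 ^+ N * (2 * k t).
  apply: (le_trans (norm1M _ _)); rewrite /k.
  rewrite expRD -/(gauss_half t).
  rewrite [leRHS](_ : _ = norm1 (u t) * (gauss_half t * (2^-1 ^+ N * (2 * expR (10 * pi * B * `|t|))))); last by ring.
  rewrite ler_wpM2l ?norm1_ge0// norm1_realM ger0_norm ?expR_ge0// ler_wpM2l ?expR_ge0//.
  apply: (le_trans (cexp_sum_approx _ _)).
  rewrite ler_wpM2l ?exprn_ge0// ler_wpM2l// ler_expR.
  have := norm1_scale_le t wB; lra.
have ik := integrable_realZ measurableT 2 (integrable_L2_weight (10 * pi * B) lu).
have ik' := integrable_realZ measurableT (2^-1 ^+ N) ik.
have mD : cmeasurable [set: RR] D.
  apply: cmeasurableM; first exact: L2_cmeasurable.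
  apply: cmeasurableM; first by apply: cmeasurable_real; exact: measurable_gauss_half.
  apply: cmeasurableD; first by apply: cmeasurable_cexp; exact: cmeasurable_scale.
  under eq_fun do rewrite -mulN1r.
  apply: cmeasurableM; first exact: cmeasurable_cst.
  rewrite /cexp_sum; apply: cmeasurable_sum => i.
  by apply: cmeasurableM; [apply: cmeasurableX; exact: cmeasurable_scale|exact: cmeasurable_cst].
have iD : cintegrable (mu1 R) setT D by apply: (cintegrable_le measurableT mD _ ik').
have iF := cintegrable_laplace_gauss w lu.
have e : laplace_gauss u w - laplace_gauss_sum N u w = cintegral (mu1 R) setT D.
  apply/eqP; rewrite subr_eq; apply/eqP.
  have iS : cintegrable (mu1 R) setT (fun t => u t * ((gauss_half t)%:C * cexp_sum N ((2 * pi * t)%:C * w))).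
    have := cintegrableD measurableT iF (cintegrableZ (-1) measurableT iD).
    congr (cintegrable _ _ _); apply/funext => t; rewrite /D; ring.
  rewrite laplace_gauss_sumE// -cintegralD//.
  by apply: eq_cintegral => t _; rewrite /D; ring.
rewrite e; apply: (le_trans (le_norm1_cintegral measurableT iD)).
rewrite -RintegralZl//.
apply: le_Rintegral => //; first exact: cintegrable_norm1.
Qed.

Lemma cvg_geometric_bound (v : nat -> R) (l K : R) :
  (forall N, `|l - v N| <= 2^-1 ^+ N * K) -> v N @[N --> \oo] --> l.
Proof.
move=> h; apply/cvgrPdist_le => e e0.
have c0 : 2^-1 ^+ N * K @[N --> \oo] --> (0 : R).
  rewrite -(mul0r K); apply: cvgM; last exact: cvg_cst.
  by apply: cvg_expr; rewrite ger0_norm// invf_lt1// ltr1n.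
move/cvgrPdist_le : c0 => /(_ e e0); apply: filterS => N.
rewrite sub0r normrN => hN; apply: (le_trans (h N)).
exact: le_trans (ler_norm _) hN.
Qed.

(** The device that passes from truncations to the limit: an identity between transforms is verified
    up to 2^-N K for every N. *)
Lemma geometric_bound_eq (a b : C) (K : R) :
  (forall N, norm1 (a - b) <= 2^-1 ^+ N * K) -> a = b.
Proof.
move=> h; apply/eqP; rewrite -subr_eq0; apply/eqP; apply: norm1_eq0.
have := @cvg_geometric_bound (fun=> 0) (norm1 (a - b)) K.
move=> hc; have : (fun=> 0 : R) n @[n --> \oo] --> norm1 (a - b).
  by apply: hc => N; rewrite subr0 ger0_norm ?norm1_ge0.
move=> hc'; rewrite le_eqVlt; apply/orP; left; apply/eqP.
exact: (cvg_unique _ hc' (cvg_cst _)).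
Qed.

(** Makes the transform measurable in the phase-space variable, as a limit of polynomials. *)
Lemma cmeasurable_geometric_limit d (T : measurableType d) (D : set T) (f : T -> C)
    (F : nat -> T -> C) (K : R) : measurable D -> (forall N, cmeasurable D (F N)) ->
  (forall t N, D t -> norm1 (f t - F N t) <= 2^-1 ^+ N * K) -> cmeasurable D f.
Proof.
move=> mD mF h; split.
  apply: (@measurable_fun_cvg _ _ _ _ (fun N t => complex.Re (F N t))) => [N|t Dt].
    by have [] := mF N.
  apply: (@cvg_geometric_bound _ _ K) => N; apply: le_trans (h t N Dt).
  by rewrite /norm1 cReD cReN lerDl.
apply: (@measurable_fun_cvg _ _ _ _ (fun N t => complex.Im (F N t))) => [N|t Dt].
  by have [] := mF N.
apply: (@cvg_geometric_bound _ _ K) => N; apply: le_trans (h t N Dt).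
by rewrite /norm1 cImD cImN lerDr.
Qed.

Definition gauss_const : R := 2 `^ (4^-1).

Lemma gauss_const_gt0 : 0 < gauss_const.
Proof. exact: powR_gt0. Qed.

Lemma gauss_const_sqr : gauss_const ^+ 2 = Num.sqrt 2.
Proof.
rewrite /gauss_const -powR_mulrn ?powR_ge0// -powRrM -powR12_sqrt//.
by congr (_ `^ _); field.
Qed.

(** Expanding (t - x)^2 leaves the cross term 2 pi t x, which joins the phase - 2 pi i omega t into
    2 pi t (x - i omega). *)
Lemma tf_shift_kernel (z : R * R) (t : R) : (tf_shift z (@gaussian_window R) t)^* =
  (gauss_const * expR (- (pi * z.1 ^+ 2)))%:C * ((gauss_half t)%:C * cexp ((2 * pi * t)%:C * conj_point z)).
Proof.
have -> : cexp ((2 * pi * t)%:C * conj_point z) = (expR (2 * pi * t * z.1))%:C * expi (- (2 * pi * z.2 * t)).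
  rewrite /cexp cReM cImM /= !mul0r subr0 addr0; congr (_ * expi _); ring.
rewrite /tf_shift rmorphM /= expiJ /gaussian_window.
have -> x : (x%:C : C)^* = x%:C by apply: complex_ext; rewrite ?cReJ ?cImJ /= ?oppr0.
rewrite mulrC !mulrA -!rmorphM; congr (_%:C * _).
rewrite -/gauss_const -!mulrA; congr (_ * _); rewrite -!expRD; congr expR; ring.
Qed.

Lemma stftE u z : L2 u -> stft (@gaussian_window R) u z =
  (gauss_const * expR (- (pi * z.1 ^+ 2)))%:C * laplace_gauss u (conj_point z).
Proof.
move=> lu; rewrite /stft /inner /laplace_gauss -cintegralZ//; last exact: cintegrable_laplace_gauss.
by apply: eq_cintegral => t _; rewrite tf_shift_kernel mulrCA.
Qed.

Lemma inner_tf_shift u z : L2 u ->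
  inner (tf_shift z (@gaussian_window R)) u = (stft (@gaussian_window R) u z)^*.
Proof.
move=> lu; rewrite /stft /inner -cintegralJ//; last first.
  have := cintegrableZ (gauss_const * expR (- (pi * z.1 ^+ 2)))%:C measurableT
    (cintegrable_laplace_gauss (conj_point z) lu).
  by congr (cintegrable _ _ _); apply/funext => t; rewrite tf_shift_kernel mulrCA.
by apply: eq_cintegral => t _; rewrite [RHS]rmorphM /= conjCK mulrC.
Qed.

End Bargmann.

(** * Hermite functions *)

Section GaussianFunctional.
Context {R : realType}.
Notation mu := (@lebesgue_measure R).

(** The weight is the square of [gauss_half]: one factor comes from a Hermite function, the other
    from the window. *)
Definition gauss_functional (p : {poly R}) : R :=
  \int[mu]_t (p.[t] * expR (- (2 * pi * t ^+ 2))).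

Let pi20 : 0 < 2 * pi :> R. Proof. by rewrite mulr_gt0 ?pi_gt0. Qed.

Lemma integrable_poly_gauss (p : {poly R}) :
  mu.-integrable setT (EFin \o (fun t => p.[t] * expR (- (2 * pi * t ^+ 2)))).
Proof.
have := integrable_lincomb measurableT (index_enum 'I_(size p)) (fun i => p`_i)
  (fun i => integrable_gauss_monoT (i : nat) pi20).
congr (_.-integrable _ (EFin \o _)); apply/funext => t.
by rewrite horner_coef mulr_suml; apply: eq_bigr => i _; rewrite -mulrA.
Qed.

Lemma gauss_functional_lincomb I (s : seq I) (c : I -> R) (p : I -> {poly R}) :
  gauss_functional (\sum_(i <- s) c i *: p i) = \sum_(i <- s) c i * gauss_functional (p i).
Proof.
rewrite /gauss_functional -Rintegral_lincomb//; last by move=> i; exact: integrable_poly_gauss.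
apply: eq_Rintegral => t _; rewrite horner_sum mulr_suml; apply: eq_bigr => i _.
by rewrite hornerZ -mulrA.
Qed.

Lemma gauss_functionalD p q :
  gauss_functional (p + q) = gauss_functional p + gauss_functional q.
Proof.
rewrite /gauss_functional -RintegralD//; [|exact: integrable_poly_gauss..].
by apply: eq_Rintegral => t _; rewrite hornerD mulrDl.
Qed.

Lemma gauss_functionalZ c p : gauss_functional (c *: p) = c * gauss_functional p.
Proof.
rewrite /gauss_functional -RintegralZl//; last exact: integrable_poly_gauss.
by apply: eq_Rintegral => t _; rewrite hornerZ -mulrA.
Qed.

Lemma gauss_functionalXn n :
  gauss_functional 'X^n = \int[mu]_t gauss_mono (2 * pi) n t.
Proof. by apply: eq_Rintegral => t _; rewrite hornerXn. Qed.

(** Integration by parts, obtained on monomials from [Rintegral_gauss_mono_rec] and extended by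
    linearity. *)
Lemma gauss_functional_deriv p :
  gauss_functional p^`() = 4 * pi * gauss_functional ('X * p).
Proof.
rewrite -(coefK p) poly_def linear_sum mulr_sumr.
under eq_bigr do rewrite /= derivZ.
under [in RHS]eq_bigr do rewrite -scalerAr.
rewrite !gauss_functional_lincomb mulr_sumr; apply: eq_bigr => i _.
rewrite mulrCA; congr (_ * _).
rewrite derivXn -scaler_nat gauss_functionalZ -exprS !gauss_functionalXn.
by rewrite -Rintegral_gauss_mono_rec//; ring.
Qed.

Lemma gauss_functional1 : gauss_functional 'X^0 = (Num.sqrt 2)^-1.
Proof.
rewrite gauss_functionalXn.
have pi0 := pi_gt0 R; have sp0 : 0 < Num.sqrt pi :> R by rewrite sqrtr_gt0.
have s20 : 0 < Num.sqrt 2 :> R by rewrite sqrtr_gt0.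
(* The standard deviation for which the normal density has exponent - 2 pi t^2. *)
pose s : R := (2 * Num.sqrt pi)^-1.
have s0 : 0 < s by rewrite invr_gt0 mulr_gt0.
have h : \int[mu]_t normal_pdf 0 s t = 1 by rewrite /Rintegral integral_normal_pdf.
have e : normal_peak s * \int[mu]_t gauss_mono (2 * pi) 0 t = 1.
  rewrite -[RHS]h -RintegralZl//; last exact: (integrable_gauss_monoT 0 pi20).
  apply: eq_Rintegral => t _; rewrite normal_pdfE ?gt_eqF// /gauss_mono expr0 mul1r.
  congr (_ * expR _); rewrite subr0 /s exprVn exprMn sqr_sqrtr ?pi_ge0// -[_ *+ 2]mulr_natr.
  rewrite -[_ *+ 2 in RHS]mulr_natr; move: (pi : R) (lt0r_neq0 pi0) => q q0.
  by field.
have p0 : normal_peak s = Num.sqrt 2.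
  rewrite /normal_peak /s exprVn exprMn sqr_sqrtr ?pi_ge0//.
  rewrite (_ : _ *+ 2 = 2^-1); last first.
    rewrite -[_ *+ 2]mulr_natr; move: (pi : R) (lt0r_neq0 pi0) => q q0.
    by field.
  by rewrite sqrtrV// invrK.
by rewrite p0 in e; apply: (mulfI (lt0r_neq0 s20)); rewrite e divff// gt_eqF.
Qed.

Lemma gauss_functional_odd n : gauss_functional 'X^(n.*2.+1) = 0.
Proof.
have pi0 := pi_gt0 R.
elim: n => [|n ih].
  have := gauss_functional_deriv 1%:P; rewrite derivC polyC1 mulr1 => /esym/eqP.
  have -> : gauss_functional 0 = 0 by rewrite -(scale0r 0) gauss_functionalZ mul0r.
  by rewrite !mulf_eq0 pnatr_eq0 (gt_eqF pi0) => /eqP.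
have := gauss_functional_deriv 'X^(n.+1.*2); rewrite derivXn -exprS doubleS /=.
rewrite -scaler_nat gauss_functionalZ ih mulr0 => /esym/eqP.
by rewrite !mulf_eq0 pnatr_eq0 (gt_eqF pi0) => /eqP.
Qed.

Lemma gauss_functional_even n : gauss_functional 'X^(n.*2) =
  (Num.sqrt 2)^-1 * (n.*2)`!%:R / (n`!%:R * (8 * pi) ^+ n).
Proof.
have pi0 := pi_gt0 R.
elim: n => [|n ih]; first by rewrite gauss_functional1 fact0 expr0 !mulr1 invr1 mulr1.
have := gauss_functional_deriv 'X^(n.*2.+1); rewrite derivXn -exprS /=.
rewrite -scaler_nat gauss_functionalZ ih doubleS => h.
apply: (@mulfI _ (4 * pi)); first by rewrite mulf_neq0 ?gt_eqF.
rewrite -h !factS !natrM exprS.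
have e : (n.*2.+2)%:R = 2 * n.+1%:R :> R by rewrite -natrM mul2n doubleS.
rewrite e.
have f0 : n`!%:R != 0 :> R by rewrite pnatr_eq0 -lt0n fact_gt0.
have s0 : Num.sqrt 2 != 0 :> R by rewrite gt_eqF// sqrtr_gt0.
have n0 : n.+1%:R != 0 :> R by rewrite pnatr_eq0.
have p0 : 8 * pi != 0 :> R by rewrite gt_eqF// mulr_gt0.
have p1 := expf_neq0 n p0.
move: (n`!%:R) ((8 * pi) ^+ n) (Num.sqrt 2) n.+1%:R (n.*2.+1%:R) ((n.*2)`!%:R) f0 p1 s0 n0 => a b c d e' g a0 b0 c0 d0.
have q0 : pi != 0 :> R by rewrite gt_eqF.
move: (pi : R) q0 => q q0.
field.
by rewrite a0 b0 c0 d0 q0.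
Qed.

End GaussianFunctional.

Section Hermite.
Context {R : realType}.
Notation C := R[i].
Notation RR := (measurableTypeR R).

(* Coefficients of the generating function exp (2 pi t w - pi w^2 / 2). *)
Definition herm_exp (k n : nat) : R :=
  if (n <= k)%N && ~~ odd (k - n) then
    (- (pi / 2)) ^+ (k - n)./2 / ((k - n)./2)`!%:R else 0.

Definition herm_lin (n : nat) : R := (2 * pi) ^+ n / n`!%:R.

Lemma herm_linS n : n.+1%:R * herm_lin n.+1 = 2 * pi * herm_lin n.
Proof.
rewrite /herm_lin exprS factS natrM; field.
by rewrite pnatr_eq0 -lt0n fact_gt0 nat1r pnatr_eq0.
Qed.

Lemma herm_exp_gt k n : (k < n)%N -> herm_exp k n = 0.
Proof. by move=> kn; rewrite /herm_exp leqNgt kn. Qed.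

Lemma herm_expSS k n : herm_exp k.+1 n.+1 = herm_exp k n.
Proof. by rewrite /herm_exp ltnS subSS. Qed.

Lemma herm_exp_diag k : herm_exp k k = 1.
Proof. by rewrite /herm_exp leqnn subnn /= expr0 fact0 divr1. Qed.

(** Coefficient form of w (d/dw) E = - pi w^2 E for E = exp (- pi w^2 / 2), whose coefficient of
    w^(k-n) is [herm_exp k n]. *)
Lemma herm_exp_rec k n : (k%:R - n%:R) * herm_exp k n = - pi * herm_exp k n.+2.
Proof.
have [nk|kn] := leqP n k; last first.
  by rewrite !herm_exp_gt ?mulr0//; apply: (leq_trans kn); rewrite -addn2 leq_addr.
have [d kE] : exists d, k = (n + d)%N by exists (k - n)%N; rewrite subnKC.
rewrite kE natrD addrAC subrr add0r.
case: d {kE} => [|[|d]].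
- by rewrite mul0r herm_exp_gt ?mulr0// addn0.
- rewrite {1}/herm_exp addKn /= andbF mulr0 herm_exp_gt ?mulr0//.
  by rewrite addn1.
- rewrite /herm_exp leq_addr addKn /= negbK.
  have -> : (n.+2 <= n + d.+2)%N by rewrite -addn2 leq_add2l.
  have -> : (n + d.+2 - n.+2 = d)%N by rewrite -[n.+2]addn2 subnDl -addn2 addnK.
  have [od|ed] := boolP (odd d); first by rewrite !mulr0.
  have dE : d = (d./2).*2 by rewrite even_halfK.
  have e : d.+2%:R = 2 * (d./2).+1%:R :> R.
    by rewrite {1}dE -natrM mul2n doubleS.
  rewrite e /= exprS factS natrM; field.
  by rewrite pnatr_eq0 -lt0n fact_gt0 nat1r pnatr_eq0.
Qed.

Definition herm_poly (k : nat) : {poly R} :=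
  \poly_(n < k.+1) (herm_exp k n * herm_lin n).

Lemma coef_herm_poly k n : (herm_poly k)`_n = herm_exp k n * herm_lin n.
Proof. by rewrite coef_poly ltnS; case: leqP => // kn; rewrite herm_exp_gt ?mul0r. Qed.

(** The creation operator. With G the generating function, it expresses d/dw G = (2 pi t - pi w) G,
    where w G is rewritten by d/dt G = 2 pi w G. *)
Lemma herm_polyS k : k.+1%:R *: herm_poly k.+1 =
  (2 * pi) *: ('X * herm_poly k) - 2^-1 *: (herm_poly k)^`().
Proof.
apply/polyP => n; rewrite coefB !coefZ coefXM coef_deriv !coef_herm_poly.
rewrite -[_ *+ n.+1]mulr_natl [n.+1%:R * (herm_exp k n.+1 * _)]mulrCA herm_linS.
case: n => [|n] /=.
  have := herm_exp_rec k.+1 0; rewrite subr0 herm_expSS => h.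
  by rewrite mulrA h; field.
have := herm_exp_rec k n => h.
rewrite herm_expSS.
have -> : k.+1%:R = (k%:R - n%:R) + n.+1%:R :> R by rewrite -!natr1; ring.
rewrite mulrDl [_ * (_ * herm_lin n.+1)]mulrA h [n.+1%:R * _]mulrCA herm_linS.
by field.
Qed.

Definition hermite (k : nat) (t : R) : C :=
  (gauss_const * ((herm_poly k).[t] * gauss_half t))%:C.

Lemma measurable_poly (p : {poly R}) : measurable_fun [set: RR] (fun t => p.[t]).
Proof. by apply: continuous_measurable_fun; exact: continuous_horner. Qed.

Lemma cmeasurable_hermite k : cmeasurable [set: RR] (hermite k).
Proof.
apply: cmeasurable_real; apply: measurable_funM => //.
by apply: measurable_funM; [exact: measurable_poly|exact: measurable_gauss_half].
Qed.

Lemma gauss_half_sqr (t : R) : gauss_half t * gauss_half t = expR (- (2 * pi * t ^+ 2)).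
Proof. by rewrite -expRD; congr expR; ring. Qed.

Lemma L2_hermite k : L2 (hermite k).
Proof.
apply: L2_norm1_sqr; first exact: cmeasurable_hermite.
have := integrable_realZ measurableT (gauss_const ^+ 2) (integrable_poly_gauss (herm_poly k ^+ 2)).
congr (_.-integrable _ (EFin \o _)); apply/funext => t.
by rewrite /hermite norm1_real real_normK ?num_real// !exprMn horner_exp -gauss_half_sqr -expr2.
Qed.

Lemma cintegral_real d (T : measurableType d) (nu : {measure set T -> \bar R}) (D : set T) (f : T -> R) :
  cintegral nu D (fun t => (f t)%:C) = (\int[nu]_(t in D) f t)%:C.
Proof. by rewrite /cintegral /=; congr (_ +i* _); rewrite /Rintegral integral0. Qed.

Definition herm_moment k n : R := gauss_const * gauss_functional ('X^n * herm_poly k).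

Lemma moment_hermite k n : moment (hermite k) n = (herm_moment k n)%:C.
Proof.
rewrite /moment /herm_moment -RintegralZl//; last exact: integrable_poly_gauss.
rewrite -cintegral_real; apply: eq_cintegral => t _.
rewrite -rmorphM; congr (_%:C); rewrite hornerM hornerXn -gauss_half_sqr; ring.
Qed.

(** Integration by parts turns the creation operator into differentiation of the test monomial; the
    terms containing the derivative of [herm_poly k] cancel. At n = 0 the truncated [n.-1] carries
    the coefficient 0. *)
Lemma herm_momentS k n :
  herm_moment k.+1 n = n%:R / (2 * k.+1%:R) * herm_moment k n.-1.
Proof.
have k0 : k.+1%:R != 0 :> R by rewrite pnatr_eq0.
rewrite /herm_moment mulrCA; congr (_ * _).
have h1 : k.+1%:R * gauss_functional ('X^n * herm_poly k.+1) =
    2 * pi * gauss_functional ('X^(n.+1) * herm_poly k) - 2^-1 * gauss_functional ('X^n * (herm_poly k)^`()).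
  rewrite -gauss_functionalZ scalerAr herm_polyS mulrBr -!scalerAr mulrA -exprSr.
  by rewrite gauss_functionalD -scaleNr !gauss_functionalZ mulNr.
have h2 := gauss_functional_deriv ('X^n * herm_poly k).
rewrite derivM derivXn mulrA -exprS gauss_functionalD mulrnAl -scaler_nat gauss_functionalZ in h2.
apply: (mulfI k0); rewrite h1.
have -> : 2 * pi * gauss_functional ('X^(n.+1) * herm_poly k) =
   2^-1 * (4 * pi * gauss_functional ('X^(n.+1) * herm_poly k)) by field.
by rewrite -h2; field; rewrite nat1r.
Qed.

Lemma exp_termE (a : R) n (w : C) :
  (a%:C * w) ^+ n / n`!%:R = (a ^+ n / n`!%:R)%:C * w ^+ n.
Proof.
rewrite (exprMn n) -(rmorph_nat (real_complex R)) !rmorphM rmorphXn fmorphV /=.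
by rewrite mulrAC.
Qed.

Lemma laplace_gauss_sum_hermite N k w : laplace_gauss_sum N (hermite k) w =
  \sum_(n < N) (herm_lin n * herm_moment k n)%:C * w ^+ n.
Proof.
apply: eq_bigr => n _; rewrite moment_hermite /herm_lin.
rewrite exp_termE [in RHS]rmorphM; exact: mulrAC.
Qed.

(** The transform turns creation into multiplication by pi w / (k + 1). On truncations this is
    exact, provided the multiplication is matched by one more term on the left. *)
Lemma laplace_gauss_sum_hermiteS N k w :
  laplace_gauss_sum N.+1 (hermite k.+1) w =
  (pi / k.+1%:R)%:C * w * laplace_gauss_sum N (hermite k) w.
Proof.
rewrite !laplace_gauss_sum_hermite big_ord_recl herm_momentS !mul0r mulr0 mul0r add0r.
rewrite mulr_sumr; apply: eq_bigr => i _; rewrite lift0.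
have -> : herm_lin i.+1 * herm_moment k.+1 i.+1 = pi / k.+1%:R * (herm_lin i * herm_moment k i).
  rewrite herm_momentS (_ : i.+1.-1 = i)//.
  rewrite [LHS](_ : _ = i.+1%:R * herm_lin i.+1 / (2 * k.+1%:R) * herm_moment k i); last by ring.
  rewrite herm_linS; have : k.+1%:R != 0 :> R by rewrite pnatr_eq0.
  by move: (k.+1%:R) (pi : R) (herm_lin i) (herm_moment k i) => a b c e a0; field.
by rewrite rmorphM exprS; ring.
Qed.

Lemma laplace_gauss_hermiteS k w :
  laplace_gauss (hermite k.+1) w = (pi / k.+1%:R)%:C * w * laplace_gauss (hermite k) w.
Proof.
have [K1 K10 h1] := laplace_gauss_approx (norm1 w) (L2_hermite k.+1).
have [K2 K20 h2] := laplace_gauss_approx (norm1 w) (L2_hermite k).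
set c := (_%:C * w).
apply: (@geometric_bound_eq _ _ _ (K1 + norm1 c * K2)) => N.
have -> : laplace_gauss (hermite k.+1) w - c * laplace_gauss (hermite k) w =
  (laplace_gauss (hermite k.+1) w - laplace_gauss_sum N.+1 (hermite k.+1) w) -
  c * (laplace_gauss (hermite k) w - laplace_gauss_sum N (hermite k) w).
  by rewrite laplace_gauss_sum_hermiteS -/c; ring.
apply: (le_trans (norm1D _ _)); rewrite norm1N [leRHS]mulrDr; apply: lerD.
  apply: (le_trans (h1 w N.+1 _)) => //; rewrite exprS -mulrA ler_piMl ?mulr_ge0 ?exprn_ge0//.
  by rewrite invf_le1// ler1n.
apply: (le_trans (norm1M _ _)); rewrite mulrCA ler_wpM2l ?norm1_ge0//.
exact: h2.
Qed.

(** Odd Gaussian moments vanish, so 2 N terms in w are N terms in w^2. *)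
Lemma laplace_gauss_sum_hermite0 N w :
  gauss_const%:C * laplace_gauss_sum N.*2 (hermite 0) w = cexp_sum N ((pi / 2)%:C * w ^+ 2).
Proof.
have pi0 := pi_gt0 R.
have m0 n : gauss_const * herm_moment 0 n = Num.sqrt 2 * gauss_functional 'X^n.
  rewrite /herm_moment mulrA -expr2 gauss_const_sqr; congr (_ * gauss_functional _).
  rewrite (_ : herm_poly 0 = 1) ?mulr1//.
  by apply/polyP => i; rewrite coef_herm_poly coef1; case: i => [|i];
    rewrite ?herm_exp_diag ?herm_exp_gt// /herm_lin ?expr0 ?fact0 ?divr1 ?mulr1 ?mul0r.
have s20 : 0 < Num.sqrt 2 :> R by rewrite sqrtr_gt0.
elim: N => [|N ih]; first by rewrite /laplace_gauss_sum /cexp_sum !big_ord0 mulr0.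
rewrite doubleS laplace_gauss_sum_hermite !big_ord_recr !mulrDr -laplace_gauss_sum_hermite ih.
rewrite /cexp_sum big_ord_recr.
have odd0 : herm_moment 0 N.*2.+1 = 0.
  apply: (mulfI (lt0r_neq0 gauss_const_gt0)).
  by rewrite m0 gauss_functional_odd !mulr0.
rewrite (_ : nat_of_ord ord_max = N.*2.+1)// odd0 [herm_lin N.*2.+1 * 0]mulr0 mul0r mulr0 addr0; congr (_ + _).
have -> : nat_of_ord (widen_ord (leqnSn N.*2.+1) (@ord_max N.*2)) = N.*2 by [].
have -> : nat_of_ord (@ord_max N) = N by [].
rewrite mulrA -rmorphM mulrCA m0 gauss_functional_even exp_termE -exprM mul2n /herm_lin.
congr (_%:C * _).
have f0 : N`!%:R != 0 :> R by rewrite pnatr_eq0 -lt0n fact_gt0.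
have f1 : (N.*2)`!%:R != 0 :> R by rewrite pnatr_eq0 -lt0n fact_gt0.
have q0 : pi != 0 :> R by rewrite gt_eqF.
have -> : (2 * pi) ^+ N.*2 = (pi / 2) ^+ N * (8 * pi) ^+ N :> R.
  rewrite -mul2n exprM -exprMn; congr (_ ^+ _).
  by move: (pi : R) q0 => q q0; field.
have p1 : (8 * pi) ^+ N != 0 :> R by rewrite expf_neq0// mulf_neq0.
move: (Num.sqrt 2) (lt0r_neq0 s20) ((8 * pi) ^+ N) p1 ((pi / 2) ^+ N) N`!%:R (N.*2)`!%:R f0 f1 => a a0 b b0 c d e d0 e0.
by field; rewrite a0 b0 d0 e0.
Qed.

Lemma laplace_gauss_hermite k w : gauss_const%:C * laplace_gauss (hermite k) w =
  cexp ((pi / 2)%:C * w ^+ 2) * ((pi ^+ k / k`!%:R)%:C * w ^+ k).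
Proof.
elim: k => [|k ih].
  rewrite !expr0 fact0 divr1 !mulr1.
  have [K K0 h] := laplace_gauss_approx (norm1 w) (L2_hermite 0).
  set z := (pi / 2)%:C * _.
  apply: (@geometric_bound_eq _ _ _ (gauss_const * K + 2 * expR (5 * norm1 z))) => N.
  have -> : gauss_const%:C * laplace_gauss (hermite 0) w - cexp z =
    gauss_const%:C * (laplace_gauss (hermite 0) w - laplace_gauss_sum N.*2 (hermite 0) w)
    - (cexp z - cexp_sum N z).
    by rewrite mulrBr laplace_gauss_sum_hermite0 -/z; ring.
  apply: (le_trans (norm1D _ _)); rewrite norm1N [leRHS]mulrDr; apply: lerD; last exact: cexp_sum_approx.
  rewrite norm1_realM (ger0_norm (ltW gauss_const_gt0)) mulrCA ler_wpM2l// ?(ltW gauss_const_gt0)//.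
  apply: (le_trans (h w _ (lexx _))); rewrite ler_wpM2r//.
  rewrite -addnn exprD ler_piMl ?exprn_ge0// exprn_ile1 ?invr_ge0//.
  by rewrite invf_le1// ler1n.
rewrite laplace_gauss_hermiteS mulrCA ih.
have -> : pi ^+ k.+1 / k.+1`!%:R = pi / k.+1%:R * (pi ^+ k / k`!%:R) :> R.
  rewrite exprS factS natrM.
  have f0 : k`!%:R != 0 :> R by rewrite pnatr_eq0 -lt0n fact_gt0.
  have k0 : k.+1%:R != 0 :> R by rewrite pnatr_eq0.
  by move: (pi : R) k`!%:R f0 k.+1%:R k0 => q a a0 b b0; field; rewrite a0 b0.
move: (cexp _) (pi / k.+1%:R) (pi ^+ k / k`!%:R) => a b c; set d := w ^+ k.
rewrite rmorphM [w ^+ k.+1]exprS -/d; ring.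
Qed.

(** The terms beyond k are zero; allowing any N > k lets the sum be matched with a transform
    truncated at level N. *)
Lemma inner_hermite N k u : L2 u -> (k < N)%N -> inner (hermite k) u =
  gauss_const%:C * \sum_(n < N) (herm_exp k n * herm_lin n)%:C * (moment u n)^*.
Proof.
move=> lu kN; rewrite mulr_sumr.
have ci n := cintegrableJ measurableT (cintegrable_moment n lu).
rewrite (_ : \sum_(n < N) _ = \sum_(n < N) (gauss_const * (herm_exp k n * herm_lin n))%:C *
   cintegral (mu1 R) setT (fun t => (u t * (t ^+ n * gauss_half t)%:C)^*)); last first.
  apply: eq_bigr => n _; rewrite mulrA -rmorphM cintegralJ//; exact: cintegrable_moment.
rewrite -cintegral_lincomb//.
apply: eq_cintegral => t _.
rewrite /hermite (horner_coef_wide _ (leq_trans (size_poly _ _) kN)) mulr_suml mulr_sumr rmorph_sum mulr_suml; apply: eq_bigr => n _.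
rewrite coef_herm_poly.
have -> : (u t * (t ^+ n * gauss_half t)%:C)^* = (t ^+ n * gauss_half t)%:C * (u t)^*.
  rewrite mulrC; apply: complex_ext; rewrite ?cReJ ?cImJ ?cReM ?cImM ?cReJ ?cImJ /=; ring.
rewrite mulrA -rmorphM; congr (_%:C * _); ring.
Qed.

Lemma herm_lin_gt0 n : 0 < herm_lin n.
Proof. by rewrite divr_gt0 ?exprn_gt0 ?mulr_gt0 ?pi_gt0 ?ltr0n ?fact_gt0. Qed.

(* [moment u n] enters [inner (hermite n) u] with a nonzero coefficient, together
   with lower moments only. *)
Lemma inner_hermite_moment u : L2 u -> (forall k, inner (hermite k) u = 0) ->
  forall n, moment u n = 0.
Proof.
move=> lu h n; elim/ltn_ind: n => n ih.
have := h n; rewrite (inner_hermite lu (ltnSn n)) big_ord_recr big1 => [|i _]; last first.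
  by rewrite (ih _ (ltn_ord i)) conjC0 mulr0.
have -> : nat_of_ord (@ord_max n) = n by [].
rewrite [X in _ * X]add0r herm_exp_diag mul1r => /eqP; rewrite !mulf_eq0.
have ne (x : R) : 0 < x -> (x%:C == 0) = false.
  by move=> x0; rewrite (fmorph_eq0 (real_complex R)) gt_eqF.
rewrite !ne ?gauss_const_gt0 ?herm_lin_gt0//= => /eqP/(congr1 Num.conj).
by rewrite conjCK rmorph0.
Qed.

Lemma inner_hermite_stft u : L2 u -> (forall k, inner (hermite k) u = 0) ->
  forall z, stft (@gaussian_window R) u z = 0.
Proof.
move=> lu h z; rewrite stftE//.
have [K K0 hK] := laplace_gauss_approx (norm1 (conj_point z)) lu.
rewrite (@geometric_bound_eq _ (laplace_gauss u (conj_point z)) 0 K) ?mulr0// => N.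
have := hK _ N (lexx _); rewrite [laplace_gauss_sum _ _ _]big1// => i _.
by rewrite inner_hermite_moment ?mulr0.
Qed.

End Hermite.

(** * The localization form on Hermite functions *)

Section Eigenfunctions.
Context {R : realType}.
Notation C := R[i].
Notation RR := (measurableTypeR R).
Notation g0 := (@gaussian_window R).

(** By [laplace_gauss_hermite], the extra factor exp (- pi w^2 / 2) makes the images of the Hermite
    functions exact multiples of monomials: this is the Bargmann normalization. *)
Definition herm_trans (u : R -> C) (w : C) : C :=
  cexp ((- (pi / 2))%:C * w ^+ 2) * (gauss_const%:C * laplace_gauss u w).

Definition herm_trans_sum (N : nat) (u : R -> C) (w : C) : C :=
  cexp_sum N ((- (pi / 2))%:C * w ^+ 2) * (gauss_const%:C * laplace_gauss_sum N u w).

Lemma conj_realM (x : R) (z : C) : (x%:C * z)^* = x%:C * z^*.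
Proof. by apply: complex_ext; rewrite ?cReJ ?cImJ ?cReM ?cImM ?cReJ ?cImJ /=; ring. Qed.

Lemma conj_exp (z : C) n : (z ^+ n)^* = z^* ^+ n.
Proof. exact: rmorphXn. Qed.

Lemma conj_mul (z w : C) : (z * w)^* = z^* * w^*.
Proof. exact: rmorphM. Qed.

Lemma stft_hermite_tf_shift k u z : L2 u ->
  stft g0 (hermite k) z * inner (tf_shift z g0) u =
  (pi ^+ k / k`!%:R)%:C *
  (conj_point z ^+ k * (herm_trans u (conj_point z))^* * (gauss_weight z)%:C).
Proof.
move=> lu; rewrite inner_tf_shift// !stftE//; last exact: L2_hermite.
set w := conj_point z; rewrite conj_realM (rmorphM (real_complex R) gauss_const).
(* With w = x - i omega, w^2 + conj (w)^2 = 2 (x^2 - omega^2), which combines with exp (- 2 pi x^2)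
   into the radial weight. *)
have key : (expR (- (pi * z.1 ^+ 2)))%:C * (expR (- (pi * z.1 ^+ 2)))%:C * cexp ((pi / 2)%:C * w ^+ 2) =
    (cexp ((- (pi / 2))%:C * w ^+ 2))^* * (gauss_weight z)%:C :> C.
  rewrite -cexpJ -!cexp_real -!cexpD; congr cexp; rewrite /pi_sqnorm.
  have cw : (w ^+ 2)^* = w^* * w^* by rewrite expr2 rmorphM.
  rewrite conj_realM cw !expr2.
  move: (pi : R) => q; rewrite /w; case: (z) => x y.
  apply: complex_ext; rewrite ?cReD ?cImD ?cReM ?cImM ?cReJ ?cImJ ?cReM ?cImM ?cReJ ?cImJ /=; by field.
have -> : (herm_trans u w)^* = (cexp ((- (pi / 2))%:C * w ^+ 2))^* * (gauss_const%:C * (laplace_gauss u w)^*).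
  by rewrite -conj_realM -rmorphM.
transitivity ((expR (- (pi * z.1 ^+ 2)))%:C * (expR (- (pi * z.1 ^+ 2)))%:C *
   (gauss_const%:C * laplace_gauss (hermite k) w) * (gauss_const%:C * (laplace_gauss u w)^*)); first ring.
rewrite laplace_gauss_hermite [_ * (cexp _ * _)]mulrA key; ring.
Qed.

Lemma herm_trans_sumE N u w : herm_trans_sum N u w = \sum_(p : 'I_N * 'I_N)
  ((- (pi / 2)) ^+ p.2 / p.2`!%:R * (gauss_const * herm_lin p.1))%:C * moment u p.1 *
  w ^+ (p.2.*2 + p.1).
Proof.
rewrite /herm_trans_sum mulrC /cexp_sum /laplace_gauss_sum [gauss_const%:C * _]mulr_sumr.
rewrite big_distrlr pair_bigA; apply: eq_bigr => -[n j] _.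
rewrite /= !exp_termE -/(herm_lin n) -exprM exprD mul2n !(rmorphM (real_complex R)) /=.
ring.
Qed.

Lemma herm_trans_approx u (B : R) : L2 u -> exists2 K : R, 0 <= K &
  forall w N, norm1 w <= B -> norm1 (herm_trans u w - herm_trans_sum N u w) <= 2^-1 ^+ N * K.
Proof.
move=> lu; have [K K0 hK] := laplace_gauss_approx B lu.
have g0 := ltW (@gauss_const_gt0 R).
pose E : R := 2 * expR (5 * (pi / 2 * B ^+ 2)).
have E0 : 0 <= E by rewrite mulr_ge0 ?expR_ge0.
(* A product of approximations: [E] bounds the exponential and, up to 2^-N, its error; [E + E]
   bounds its partial sum, and [K] bounds both the transform and, up to 2^-N, its error. *)
exists (E * (gauss_const * K) + (E + E) * (gauss_const * K)).
  by rewrite addr_ge0 ?mulr_ge0 ?addr_ge0.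
move=> w N wB; rewrite /herm_trans /herm_trans_sum.
set y := _%:C * w ^+ 2; set b := laplace_gauss u w; set bN := laplace_gauss_sum N u w.
have yB : norm1 y <= pi / 2 * B ^+ 2.
  rewrite norm1_realM normrN ger0_norm ?divr_ge0 ?pi_ge0// ler_wpM2l ?divr_ge0 ?pi_ge0//.
  apply: (le_trans (norm1X _ _)); rewrite ler_pXn2r ?nnegrE ?norm1_ge0//.
  exact: le_trans (norm1_ge0 _) wB.
have e1 : norm1 (cexp y - cexp_sum N y) <= 2^-1 ^+ N * E.
  apply: (le_trans (cexp_sum_approx _ _)); rewrite ler_wpM2l ?exprn_ge0// ler_wpM2l// ler_expR.
  by rewrite ler_wpM2l.
have e2 : norm1 (cexp y) <= E.
  apply: (le_trans (norm1_cexp _)); rewrite ler_wpM2l// ler_expR.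
  have := norm1_ge0 y; lra.
have e3 : norm1 (cexp_sum N y) <= E + E.
  rewrite (_ : cexp_sum N y = cexp y - (cexp y - cexp_sum N y)); last by ring.
  apply: (le_trans (norm1D _ _)); rewrite norm1N lerD//; apply: (le_trans e1).
  by rewrite ler_piMl// exprn_ile1 ?invr_ge0// invf_le1// ler1n.
have e4 : norm1 b <= K.
  by have := hK w 0 wB; rewrite /laplace_gauss_sum big_ord0 subr0 expr0 mul1r.
rewrite (_ : _ - _ = (cexp y - cexp_sum N y) * (gauss_const%:C * b) +
   cexp_sum N y * (gauss_const%:C * (b - bN))); last by ring.
apply: (le_trans (norm1D _ _)); rewrite [leRHS]mulrDr; apply: lerD.
  apply: (le_trans (norm1M _ _)); rewrite [leRHS]mulrA; apply: ler_pM; rewrite ?norm1_ge0//.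
  by rewrite norm1_realM ger0_norm// ler_wpM2l.
apply: (le_trans (norm1M _ _)); rewrite mulrCA; apply: ler_pM; rewrite ?norm1_ge0//.
rewrite norm1_realM ger0_norm// mulrCA ler_wpM2l//; exact: hK.
Qed.

Lemma cmeasurable_herm_trans_sum N u :
  cmeasurable [set: RR * RR] (fun z => herm_trans_sum N u (conj_point z)).
Proof.
have mw := @cmeasurable_conj_point R.
apply: cmeasurableM.
  apply: cmeasurable_sum => i; apply: cmeasurableM; last exact: cmeasurable_cst.
  by apply: cmeasurableX; apply: cmeasurableM; [exact: cmeasurable_cst|exact: cmeasurableX].
apply: cmeasurableM; first exact: cmeasurable_cst.
apply: cmeasurable_sum => i; apply: cmeasurableM; last exact: cmeasurable_cst.
apply: cmeasurableM; last exact: cmeasurable_cst.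
by apply: cmeasurableX; apply: cmeasurableM; [exact: cmeasurable_cst|].
Qed.

Lemma herm_exp_sum N k n : (k < N)%N ->
  \sum_(j < N | (j.*2 + n == k)%N) ((- (pi / 2)) ^+ j / j`!%:R) = herm_exp k n :> R.
Proof.
move=> kN; rewrite /herm_exp; case: ifPn => [/andP[nk ev]|h].
  have jN : ((k - n)./2 < N)%N.
    by apply: leq_ltn_trans kN; apply: leq_trans (leq_subr n k); rewrite -divn2 leq_div.
  rewrite (bigD1 (Ordinal jN))/=; last by rewrite even_halfK// subnK.
  rewrite big1 ?addr0// => j /andP[/eqP jk] /eqP; case.
  apply: val_inj => /=; rewrite -jk addnK doubleK//.
rewrite big1// => j /eqP jk; move: h; rewrite -jk leq_addl addnK odd_double //.
Qed.

Definition disk_eigenvalue (r : R) (k : nat) : R := 1 - gamma_tail k (pi * r ^+ 2).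

(** The integrand is a double sum of w^k conj (w)^(2 j + n) with Gaussian weight. Orthogonality
    keeps 2 j + n = k, and the surviving coefficients are those of the k-th Hermite function; k < N
    ensures that none of them is truncated. *)
Lemma cintegral_herm_trans_sum (r : R) N k u : 0 < r -> L2 u -> (k < N)%N ->
  let F z := conj_point z ^+ k * (herm_trans_sum N u (conj_point z))^* * (gauss_weight z)%:C in
  cintegrable (mu2 R) (disk r) F /\
  cintegral (mu2 R) (disk r) F =
    (k`!%:R / pi ^+ k * disk_eigenvalue r k)%:C * inner (hermite k) u.
Proof.
move=> r0 lu kN F.
pose c (p : 'I_N * 'I_N) : C :=
  ((- (pi / 2)) ^+ p.2 / p.2`!%:R * (gauss_const * herm_lin p.1))%:C * (moment u p.1)^*.
have mD := @measurable_disk R r.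
have FE : F = fun z => \sum_(p : 'I_N * 'I_N) c p * disk_mono k (p.2.*2 + p.1) z.
  apply/funext => z.
  have term (p : 'I_N * 'I_N) : (((- (pi / 2)) ^+ p.2 / p.2`!%:R * (gauss_const * herm_lin p.1))%:C *
      moment u p.1 * conj_point z ^+ (p.2.*2 + p.1))^* = c p * (conj_point z)^* ^+ (p.2.*2 + p.1).
    by rewrite -mulrA conj_realM conj_mul conj_exp mulrA.
  have -> : F z = conj_point z ^+ k *
      (\sum_(p : 'I_N * 'I_N) c p * (conj_point z)^* ^+ (p.2.*2 + p.1)) * (gauss_weight z)%:C.
    congr (_ * _ * _); rewrite herm_trans_sumE rmorph_sum; apply: eq_bigr => p _; exact: term.
  rewrite mulr_sumr mulr_suml; apply: eq_bigr => p _; rewrite /disk_mono; ring.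
have iF (p : 'I_N * 'I_N) : cintegrable (mu2 R) (disk r) (disk_mono k (p.2.*2 + p.1)) := cintegrable_disk_mono k _ r0.
split; first by rewrite FE; exact: (cintegrable_lincomb _ c mD iF).
rewrite FE (cintegral_lincomb _ _ mD)//.
rewrite (bigID (fun p : 'I_N * 'I_N => (p.2.*2 + p.1 == k)%N))/= [X in _ + X]big1 ?addr0; last first.
  by move=> p pk; rewrite cintegral_disk_mono_neq ?mulr0// eq_sym.
rewrite (inner_hermite lu kN) !mulr_sumr.
transitivity (\sum_(p : 'I_N * 'I_N | (p.2.*2 + p.1 == k)%N) c p * (k`!%:R / pi ^+ k * disk_eigenvalue r k)%:C).
  by apply: eq_bigr => p /eqP ->; rewrite cintegral_disk_mono_diag.
set v := (_ * disk_eigenvalue r k)%:C.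
have -> : \sum_(p : 'I_N * 'I_N | (p.2.*2 + p.1 == k)%N) c p * v =
    \sum_(n < N) \sum_(j < N | (j.*2 + n == k)%N) c (n, j) * v.
  rewrite (pair_big_dep xpredT (fun n j : 'I_N => (j.*2 + n == k)%N) (fun n j => c (n, j) * v)).
  by apply: eq_bigr => -[n j].
apply: eq_bigr => n _; rewrite -(herm_exp_sum n kN) mulr_suml rmorph_sum !mulr_suml !mulr_sumr.
apply: eq_bigr => j _; rewrite /c /= mulrC; congr (v * _).
rewrite mulrA -rmorphM; congr (_%:C * _); ring.
Qed.

Lemma locform_hermite (r : R) k u : 0 < r -> L2 u ->
  let F z := stft g0 (hermite k) z * inner (tf_shift z g0) u in
  cintegrable (mu2 R) (disk r) F /\
  cintegral (mu2 R) (disk r) F = (disk_eigenvalue r k)%:C * inner (hermite k) u.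
Proof.
move=> r0 lu F; have mD := @measurable_disk R r.
have [K K0 hK] := herm_trans_approx (2 * r) lu.
pose G z := conj_point z ^+ k * (herm_trans u (conj_point z))^* * (gauss_weight z)%:C.
pose GN N z := conj_point z ^+ k * (herm_trans_sum N u (conj_point z))^* * (gauss_weight z)%:C.
have hb (a : C) z M : disk r z -> norm1 a <= M ->
    norm1 (conj_point z ^+ k * a^* * (gauss_weight z)%:C) <= (2 * r) ^+ k * M.
  move=> zr aM; have /andP[w0 w1] := gauss_weight_le1 z.
  rewrite mulrC norm1_realM ger0_norm//; apply: (@le_trans _ _ (norm1 (conj_point z ^+ k * a^*))).
    by rewrite ler_piMl ?norm1_ge0.
  apply: (le_trans (norm1M _ _)); rewrite norm1J; apply: ler_pM; rewrite ?norm1_ge0//.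
  apply: (le_trans (norm1X _ _)); case: (k) => [//|m].
  by rewrite ler_pXn2r ?nnegrE ?norm1_ge0 ?mulr_ge0 ?(ltW r0)// norm1_conj_point.
have hd z N : disk r z -> norm1 (G z - GN N z) <= (2 * r) ^+ k * (2^-1 ^+ N * K).
  move=> zr; rewrite (_ : G z - GN N z = conj_point z ^+ k *
    (herm_trans u (conj_point z) - herm_trans_sum N u (conj_point z))^* * (gauss_weight z)%:C); last first.
    by rewrite rmorphB /G /GN; ring.
  by apply: hb => //; apply: hK; exact: norm1_conj_point.
have mW : cmeasurable (disk r) (fun z => conj_point z : C).
  by apply: (cmeasurableS measurableT _ (@cmeasurable_conj_point R)).
have mGw (a : RR * RR -> C) : cmeasurable (disk r) a ->
    cmeasurable (disk r) (fun z => conj_point z ^+ k * (a z)^* * (gauss_weight z)%:C).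
  move=> ma; apply: cmeasurableM.
    by apply: cmeasurableM; [exact: cmeasurableX|exact: cmeasurableJ].
  apply: (cmeasurableS (E := setT)) => //; apply: cmeasurable_real; exact: measurable_gauss_weight.
have mG : cmeasurable (disk r) G.
  apply: mGw; apply: (@cmeasurable_geometric_limit _ _ _ _ _ (fun N z => herm_trans_sum N u (conj_point z)) K mD).
    move=> N; apply: (cmeasurableS (E := setT)) => //; exact: cmeasurable_herm_trans_sum.
  by move=> z N zr; apply: hK; exact: norm1_conj_point.
have iG : cintegrable (mu2 R) (disk r) G.
  apply: (cintegrable_disk_bounded mG (M := (2 * r) ^+ k * K)) => z zr.
  apply: hb => //; have := hK (conj_point z) 0 (norm1_conj_point r0 zr).
  by rewrite /herm_trans_sum /cexp_sum big_ord0 mul0r subr0 expr0 mul1r.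
have FE : F = fun z => (pi ^+ k / k`!%:R)%:C * G z.
  by apply/funext => z; rewrite /F stft_hermite_tf_shift.
have iF : cintegrable (mu2 R) (disk r) F by rewrite FE; exact: cintegrableZ.
split=> //; rewrite FE cintegralZ//.
set c := (k`!%:R / pi ^+ k * disk_eigenvalue r k)%:C.
have -> : cintegral (mu2 R) (disk r) G = c * inner (hermite k) u.
  pose M := \int[mu2 R]_(z in disk r) ((2 * r) ^+ k * K).
  have M0 : 0 <= M by apply: Rintegral_ge0 => z _; rewrite mulr_ge0// exprn_ge0// mulr_ge0// ltW.
  apply: (@geometric_bound_eq _ _ _ M) => N.
  (* The shift by [k.+1] keeps the truncation level above k for every N, at no loss in the geometric
     error. *)
  have kN : (k < N + k.+1)%N by rewrite addnS ltnS leq_addl.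
  have [iN eN] := cintegral_herm_trans_sum r0 lu kN.
  have iD : cintegrable (mu2 R) (disk r) (fun z => G z - GN (N + k.+1)%N z).
    have := cintegrableD mD iG (cintegrableZ (-1) mD iN).
    by congr (cintegrable _ _ _); apply/funext => z; rewrite mulN1r.
  have -> : cintegral (mu2 R) (disk r) G - c * inner (hermite k) u =
      cintegral (mu2 R) (disk r) (fun z => G z - GN (N + k.+1)%N z).
    apply/eqP; rewrite subr_eq -eN -cintegralD//; apply/eqP.
    by apply: eq_cintegral => z _; rewrite subrK.
  apply: (le_trans (le_norm1_cintegral mD iD)).
  rewrite /M -RintegralZl//; last exact: integrable_disk_cst.
  apply: le_Rintegral => //.
  - exact: cintegrable_norm1.
  - exact: integrable_disk_cst.
  - move=> z zr; apply: (le_trans (hd z _ zr)).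
    rewrite mulrCA ler_wpM2r ?mulr_ge0 ?exprn_ge0 ?mulr_ge0 ?(ltW r0)//.
    rewrite exprD ler_piMr ?exprn_ge0// exprn_ile1 ?invr_ge0// invf_le1// ?ler1n//.
rewrite mulrA -rmorphM; congr (_%:C * _).
have f0 : k`!%:R != 0 :> R by rewrite pnatr_eq0 -lt0n fact_gt0.
have p0 : pi ^+ k != 0 :> R by rewrite expf_neq0// gt_eqF// pi_gt0.
move: (pi ^+ k) p0 k`!%:R f0 => a a0 b b0; field; by rewrite a0 b0.
Qed.

End Eigenfunctions.

(** * Eigenspaces and uniqueness of the eigenvalue listing *)

Section InnerProduct.
Context {R : realType}.
Notation C := R[i].
Notation RR := (measurableTypeR R).
Implicit Types f h u : R -> C.

Lemma cintegrable_L2M f u : L2 f -> L2 u ->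
  cintegrable (mu1 R) setT (fun t => f t * (u t)^*).
Proof.
move=> lf lu; apply: (cintegrable_le measurableT _ _
  (integrable_realD measurableT (L2_integrable_sqr lf) (L2_integrable_sqr lu))).
  by apply: cmeasurableM; [exact: L2_cmeasurable|apply: cmeasurableJ; exact: L2_cmeasurable].
move=> t _; apply: (le_trans (norm1M _ _)); rewrite norm1J.
move: (norm1 _) (norm1 _) => a b.
have := sqr_ge0 (a - b); have := sqr_ge0 a; have := sqr_ge0 b; nra.
Qed.

Lemma innerJ f u : L2 f -> L2 u -> inner f u = (inner u f)^*.
Proof.
move=> lf lu; rewrite /inner -cintegralJ//; last exact: cintegrable_L2M.
by apply: eq_cintegral => t _; rewrite conj_mul conjCK mulrC.
Qed.

Lemma innerZ (c : C) f u : L2 f -> L2 u -> inner (fun t => c * f t) u = c * inner f u.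
Proof.
move=> lf lu; rewrite /inner -cintegralZ//; last exact: cintegrable_L2M.
by apply: eq_cintegral => t _; rewrite mulrA.
Qed.

Lemma L2_scale (c : C) f : L2 f -> L2 (fun t => c * f t).
Proof.
move=> lf; have mcf : cmeasurable [set: RR] (fun t => c * f t).
  by apply: cmeasurableM; [exact: cmeasurable_cst|exact: L2_cmeasurable].
apply: L2_norm1_sqr => //.
apply: (le_integrable_real measurableT _ _ (integrable_realZ measurableT (norm1 c ^+ 2) (L2_integrable_sqr lf))).
  by case: mcf => m1 m2; apply: measurable_funX; apply: measurable_funD; apply: measurableT_comp.
move=> t _; rewrite ger0_norm ?sqr_ge0// -exprMn ler_pXn2r ?nnegrE ?mulr_ge0 ?norm1_ge0//.
exact: norm1M.
Qed.

Lemma L2_sub f h : L2 f -> L2 h -> L2 (fun t => f t - h t).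
Proof.
move=> lf lh; have mfh : cmeasurable [set: RR] (fun t => f t - h t).
  apply: cmeasurableD; first exact: L2_cmeasurable.
  under eq_fun do rewrite -mulN1r.
  by apply: cmeasurableM; [exact: cmeasurable_cst|exact: L2_cmeasurable].
apply: L2_norm1_sqr => //.
apply: (le_integrable_real measurableT _ _ (integrable_realZ measurableT 2
  (integrable_realD measurableT (L2_integrable_sqr lf) (L2_integrable_sqr lh)))).
  by case: mfh => m1 m2; apply: measurable_funX; apply: measurable_funD; apply: measurableT_comp.
move=> t _; rewrite ger0_norm ?sqr_ge0//.
have h0 := norm1_ge0 (f t - h t).
have := norm1D (f t) (- h t); rewrite norm1N.
move: (norm1 (f t - h t)) (norm1 (f t)) (norm1 (h t)) h0 => a b c a0 h1.
have := sqr_ge0 (b - c); have : a ^+ 2 <= (b + c) ^+ 2 by rewrite ler_pXn2r ?nnegrE// (le_trans a0).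
nra.
Qed.

Lemma inner_sub f h u : L2 f -> L2 h -> L2 u ->
  inner (fun t => f t - h t) u = inner f u - inner h u.
Proof.
move=> lf lh lu; apply/eqP; rewrite -subr_eq opprK; apply/eqP/esym.
rewrite /inner -cintegralD//; [|apply: cintegrable_L2M => //; exact: L2_sub|exact: cintegrable_L2M].
by apply: eq_cintegral => t _; rewrite -mulrDl subrK.
Qed.

#[export] Instance ae_filter_mu1 : Filter (nbhs (almost_everywhere (mu1 R))).
Proof. exact: ae_filter_ringOfSetsType. Qed.

Lemma inner_self_eq0 f : L2 f -> inner f f = 0 -> Defs.ae_eq0 f.
Proof.
move=> lf /(congr1 (@complex.Re R)) h.
have [i1 _] := cintegrable_L2M lf lf.
pose q t := complex.Re (f t) ^+ 2 + complex.Im (f t) ^+ 2.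
have qE : q = fun t => complex.Re (f t * (f t)^*).
  by apply/funext => t; rewrite cReM cReJ cImJ /q; ring.
have h' : \int[mu1 R]_t q t = 0 by rewrite qE.
have iq : (mu1 R).-integrable setT (EFin \o q) by rewrite qE.
have q0 t : 0 <= q t by rewrite addr_ge0 ?sqr_ge0.
have : (\int[mu1 R]_(t in setT) `|(EFin \o q) t| = 0)%E.
  transitivity (\int[mu1 R]_(t in setT) (q t)%:E)%E.
    by apply: eq_integral => t _ /=; rewrite ger0_norm.
  rewrite -[LHS]fineK; last exact: integrable_fin_num.
  by move: h'; rewrite /Rintegral => ->.
move/(ae_eq_integral_abs _ measurableT (measurable_int _ iq)).
apply: filterS => t /(_ I) [] /eqP.
rewrite paddr_eq0 ?sqr_ge0// !sqrf_eq0 => /andP[/eqP a /eqP b].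
exact: complex_ext.
Qed.

Lemma ae_eq0_inner f u : L2 f -> L2 u -> Defs.ae_eq0 f -> inner f u = 0.
Proof.
move=> lf lu f0; have [i1 i2] := cintegrable_L2M lf lu.
have aux (g : R -> R) : (mu1 R).-integrable setT (EFin \o g) -> (forall t, f t = 0 -> g t = 0) ->
    \int[mu1 R]_t g t = 0.
  move=> ig g0; rewrite /Rintegral (@ae_eq_integral _ _ _ (mu1 R) setT (cst 0%E))//.
  - by rewrite integral0.
  - exact: measurable_int ig.
  - by move: f0; apply: filterS => t ft _ /=; rewrite g0.
by apply: complex_ext; rewrite /inner /cintegral /=; apply: aux => // t ->; rewrite mul0r.
Qed.

Lemma ae_eq0_lincomb n (c : 'I_n -> C) (F : 'I_n -> R -> C) :
  (forall i, Defs.ae_eq0 (F i)) -> Defs.ae_eq0 (fun t => \sum_i c i * F i t).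
Proof.
move=> F0.
have : {ae mu1 R, forall t, forall i, F i t = 0} by exact: filter_forall.
by apply: filterS => t Ft; rewrite big1// => i _; rewrite Ft mulr0.
Qed.

(** Steinitz's argument modulo null sets: if m < n, the n by m matrix of coordinates has a nonzero
    left kernel vector, which is a linear relation holding almost everywhere. *)
Lemma has_dim_leq (E : set (R -> C)) n m : has_dim E n -> has_dim E m -> (n <= m)%N.
Proof.
move=> [e [eE efree _]] [b [_ _ bspan]]; rewrite leqNgt; apply/negP => mn.
have /choice[M hM] i := bspan _ (eE i).
pose A : 'M[C]_(n, m) := \matrix_(i, j) M i j.
have : kermx A != 0.
  rewrite -mxrank_eq0 mxrank_ker -lt0n subn_gt0.
  exact: leq_ltn_trans (rank_leq_col _) mn.
case/rowV0Pn => v /sub_kermxP vA v0.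
move/negP: v0; apply; apply/eqP/rowP => i; rewrite mxE.
apply: (efree (fun i => v 0 i)) => {i}.
have := @ae_eq0_lincomb _ (fun i => v 0 i) _ hM.
apply: filterS => t.
under eq_bigr do rewrite mulrBr mulr_sumr.
rewrite sumrB exchange_big/= [X in _ - X]big1 ?subr0// => j _.
have /rowP/(_ j) := vA; rewrite !mxE => s0.
transitivity ((\sum_j0 v 0 j0 * A j0 j) * b j t); last by rewrite s0 mul0r.
rewrite mulr_suml; apply: eq_bigr => i _.
by rewrite mxE mulrA.
Qed.

Lemma has_dim_inj (E : set (R -> C)) n m : has_dim E n -> has_dim E m -> n = m.
Proof. by move=> hn hm; apply/eqP; rewrite eqn_leq !(has_dim_leq hn, has_dim_leq hm). Qed.

End InnerProduct.

Section Listing.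
Context {R : realType}.
Implicit Types lam : nat -> R.

(* The indices at which [lam'] takes the values lam 0 > lam 1 > ... increase. *)
Lemma listing_le lam lam' : (forall n, lam n.+1 < lam n) -> (forall n, 0 < lam n) ->
  (forall j k, (j <= k)%N -> lam' k <= lam' j) ->
  (forall k, exists n, lam' n = lam k) -> forall n, lam n <= lam' n.
Proof.
move=> dec pos ninc /choice[s hs] n.
have sS k : (s k < s k.+1)%N.
  rewrite ltnNge; apply/negP => /ninc; rewrite !hs leNgt => /negP; apply; exact: dec.
have ns : (n <= s n)%N by elim: n => // n ih; exact: leq_ltn_trans (sS n).
by rewrite -hs ninc.
Qed.

(** By [has_dim_inj] the two lists have equinumerous fibers over each nonzero value. Since [lam']
    attains every value of [lam], it stays above [lam] and is positive: the padding value 0 cannot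
    occur in it, and the roles can be exchanged in [listing_le]. *)
Lemma eigenvalue_listing_unique (A : (R -> R[i]) -> (R -> R[i]) -> Prop) lam lam' :
  (forall n, lam n.+1 < lam n) -> (forall n, 0 < lam n) ->
  eigenvalue_listing A lam -> eigenvalue_listing A lam' -> lam' = lam.
Proof.
move=> dec pos [_ h] [ninc' h'].
have mono := Order.NatMonotonyTheory.decnP dec.
have inj : injective lam.
  by move=> i j ij; apply/eqP; rewrite eqn_leq -!leEnat -!mono ij lexx.
have inC (x y : R) : x%:C = y%:C -> x = y by case.
have fib (x : R) : x != 0 -> ([set k | lam k = x] #= [set k | lam' k = x])%card.
  move=> x0; have xC : x%:C != 0 by rewrite (fmorph_eq0 (real_complex R)).
  have [n [c1 d1]] := h _ xC; have [m [c2 d2]] := h' _ xC.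
  have e (l : nat -> R) : [set k | (l k)%:C = x%:C] = [set k | l k = x].
    by apply/seteqP; split => k /= => [/inC|->].
  rewrite !e in c1 c2; rewrite (has_dim_inj d1 d2) in c1.
  exact: card_eq_trans c1 (card_esym c2).
have ex' k : exists n, lam' n = lam k.
  have := fib _ (lt0r_neq0 (pos k)).
  rewrite card_eq_sym => /card_set_bijP[f [_ _ fs]].
  by have [n /= nk _] := fs k erefl; exists n.
have le1 := listing_le dec pos ninc' ex'.
have pos' n : 0 < lam' n by exact: lt_le_trans (pos n) (le1 n).
have ex n : exists k, lam k = lam' n.
  have := fib _ (lt0r_neq0 (pos' n)) => /card_set_bijP[f [_ _ fs]].
  by have [k /= kn _] := fs n erefl; exists k.
(* Two equal consecutive values would give a fiber of [lam'] with two elements, which cannot inject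
   into a fiber of the injective [lam]. *)
have dec' n : lam' n.+1 < lam' n.
  rewrite lt_neqAle ninc'// andbT; apply/eqP => e.
  have := fib _ (lt0r_neq0 (pos' n)).
  rewrite card_eq_sym => /card_set_bijP[f [fm fi _]].
  have : n = n.+1.
    apply: fi; rewrite ?inE//=; apply: inj.
    by rewrite (fm n)//= (fm n.+1)//= e.
  by move/eqP; rewrite -addn1 -[X in X == _]addn0 eqn_add2l.
have ninc j k : (j <= k)%N -> lam k <= lam j by rewrite mono.
apply/funext => n; apply: le_anti; rewrite le1 andbT.
exact: (listing_le dec' pos' ninc ex).
Qed.

Lemma kth_eigenvalueE (A : (R -> R[i]) -> (R -> R[i]) -> Prop) lam :
  (forall n, lam n.+1 < lam n) -> (forall n, 0 < lam n) ->
  eigenvalue_listing A lam -> kth_eigenvalue A = lam.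
Proof.
move=> dec pos h; apply: (@xget_unique _ _ [set l | eigenvalue_listing A l] lam) => //= l hl.
exact: (eigenvalue_listing_unique dec pos h hl).
Qed.

End Listing.

(** * Spectrum of the localization operator on a disk *)

Section Spectrum.
Context {R : realType}.
Notation C := R[i].
Notation RR := (measurableTypeR R).
Notation g0 := (@gaussian_window R).
Implicit Types (r : R) (f h u : R -> C).

Definition locform r f u : C :=
  cintegral (mu2 R) (disk r) (fun z => stft g0 f z * inner (tf_shift z g0) u).

(** The form is Hermitian, so the Hermite function may be moved to the second slot; testing an
    eigenvector then needs no adjoint operator. *)
Lemma locform_hermiter r k f : 0 < r -> L2 f ->
  locform r f (hermite k) = (disk_eigenvalue r k)%:C * inner f (hermite k).
Proof.
move=> r0 lf; have lH := @L2_hermite R k.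
have [iF eF] := locform_hermite k r0 lf.
rewrite (innerJ lf lH) -conj_realM -eF -cintegralJ//; last exact: measurable_disk.
apply: eq_cintegral => z _.
by rewrite !inner_tf_shift// conj_mul conjCK mulrC.
Qed.

Lemma disk_eigenvalue_dec r : 0 < r ->
  forall k, disk_eigenvalue r k.+1 < disk_eigenvalue r k.
Proof.
move=> r0 k; rewrite /disk_eigenvalue ltrD2l ltrN2 /gamma_tail [ltRHS]big_ord_recr ltrDl.
by rewrite divr_gt0 ?mulr_gt0 ?exprn_gt0 ?expR_gt0 ?mulr_gt0 ?pi_gt0 ?exprn_gt0// ltr0n fact_gt0.
Qed.

Lemma disk_eigenvalue_gt0 r : 0 < r -> forall k, 0 < disk_eigenvalue r k.
Proof.
move=> r0 k; apply: le_lt_trans (disk_eigenvalue_dec r0 k).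
have L0 : 0 < pi * r ^+ 2 by rewrite mulr_gt0 ?pi_gt0 ?exprn_gt0.
rewrite /disk_eigenvalue -Rintegral_gamma_pdf//.
by apply: Rintegral_ge0 => s /=; rewrite in_itv/= => /andP[s0 _]; exact: gamma_pdf_ge0.
Qed.

Lemma disk_eigenvalue_inj r : 0 < r -> injective (disk_eigenvalue r).
Proof.
move=> r0 i j ij; apply/eqP; rewrite eqn_leq -!leEnat.
by rewrite -!(Order.NatMonotonyTheory.decnP (disk_eigenvalue_dec r0)) ij lexx.
Qed.

Lemma complexI (x y : R) : x%:C = y%:C -> x = y.
Proof. by case. Qed.

(* The eigenvalues of a single disk are distinct, so symmetry forces
   orthogonality; no integral of Hermite functions is computed. *)
Lemma inner_hermite_neq j k : j != k -> inner (hermite j) (hermite k : R -> C) = 0.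
Proof.
move=> jk; have r0 : 0 < 1 :> R by [].
have [_ e1] := locform_hermite j r0 (@L2_hermite R k).
have := locform_hermiter k r0 (@L2_hermite R j).
rewrite /locform e1 => /eqP; rewrite -subr_eq0 -mulrBl mulf_eq0 subr_eq0.
case/orP => /eqP// /complexI/(disk_eigenvalue_inj r0) e.
by rewrite e eqxx in jk.
Qed.

Lemma cexp_neq0 (z : C) : cexp z != 0.
Proof.
apply/eqP => z0; have : cexp z * cexp (- z) = 1.
  by rewrite -cexpD subrr (_ : 0 = 0%:C)// cexp_real expR0.
by rewrite z0 mul0r => /esym/eqP; rewrite oner_eq0.
Qed.

Lemma inner_hermite_self k : inner (hermite k) (hermite k : R -> C) != 0.
Proof.
apply/eqP => Hk; have lH := @L2_hermite R k.
have h j : inner (hermite j) (hermite k : R -> C) = 0.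
  by have [->//|jk] := eqVneq j k; exact: inner_hermite_neq.
(* A Hermite function of norm 0 would be orthogonal to all of them, so its transform would vanish;
   at w = 1 the explicit formula is a product of nonzero factors. *)
have := inner_hermite_stft lH h (1, 0); rewrite stftE// => /eqP.
rewrite [gauss_const * _]mulrC (rmorphM (real_complex R)) -mulrA laplace_gauss_hermite.
rewrite mulf_eq0 (fmorph_eq0 (real_complex R)) (gt_eqF (expR_gt0 _)) orFb.
rewrite mulf_eq0 (negbTE (cexp_neq0 _)) orFb mulf_eq0 (fmorph_eq0 (real_complex R)).
rewrite (gt_eqF (_ : 0 < pi ^+ k / k`!%:R)) ?divr_gt0 ?exprn_gt0 ?pi_gt0 ?ltr0n ?fact_gt0// orFb.
rewrite expf_eq0 => /andP[_].
by rewrite /conj_point /= oppr0 (fmorph_eq0 (real_complex R)) oner_eq0.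
Qed.

Lemma eigen_inner_hermite r mu f k : 0 < r -> L2 f ->
  localization g0 (disk r) f (fun t => mu * f t) ->
  mu != (disk_eigenvalue r k)%:C -> inner (hermite k) f = 0.
Proof.
move=> r0 lf [_ _ loc] muk; have lH := @L2_hermite R k.
have := loc _ lH; rewrite innerZ// -/(locform r f _) locform_hermiter// => /eqP.
rewrite -subr_eq0 -mulrBl mulf_eq0 subr_eq0 (negbTE muk) => /eqP f0.
by rewrite innerJ// f0 conjC0.
Qed.

(** An eigenfunction is orthogonal to every Hermite function, so its transform is zero, and the weak
    equation tested against f itself reads mu <f, f> = 0. *)
Lemma eigenspace_trivial r mu : 0 < r -> mu != 0 ->
  (forall k, mu != (disk_eigenvalue r k)%:C) ->
  has_dim (eigenspace_L2 (localization g0 (disk r)) mu) 0.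
Proof.
move=> r0 mu0 muk; exists (fun i t => 0); split; [by case|by move=> ? ? []|].
move=> f [lf loc]; exists (fun=> 0).
have [_ _ hf] := loc.
have := hf _ lf; rewrite innerZ// (_ : cintegral _ _ _ = 0); last first.
  rewrite -[RHS](cintegral0 (mu2 R) (disk r)); apply: eq_cintegral => z _.
  by rewrite inner_hermite_stft ?mul0r// => k; exact: (eigen_inner_hermite r0 lf loc).
move=> /eqP; rewrite mulf_eq0 (negbTE mu0) => /eqP /(inner_self_eq0 lf).
by apply: filterS => t ft; rewrite ft big_ord0 subr0.
Qed.

Lemma laplace_gauss_sub (c : C) f h w : L2 f -> L2 h ->
  laplace_gauss (fun t => f t - c * h t) w = laplace_gauss f w - c * laplace_gauss h w.
Proof.
move=> lf lh; apply/eqP; rewrite -subr_eq opprK; apply/eqP/esym.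
have ih := cintegrable_laplace_gauss w lh.
have i' := cintegrable_laplace_gauss w (L2_sub lf (L2_scale c lh)).
rewrite /laplace_gauss -cintegralZ// -cintegralD//; last exact: cintegrableZ.
by apply: eq_cintegral => t _; ring.
Qed.

Lemma eigenspace_hermite r k : 0 < r ->
  has_dim (eigenspace_L2 (localization g0 (disk r)) (disk_eigenvalue r k)%:C) 1.
Proof.
move=> r0; have lH := @L2_hermite R k; set lam := (disk_eigenvalue r k)%:C.
have lam0 : lam != 0 by rewrite (fmorph_eq0 (real_complex R)) gt_eqF// disk_eigenvalue_gt0.
have H0 := inner_hermite_self k.
exists (fun=> hermite k); split.
- move=> _; split=> //; split=> //; first exact: L2_scale.
  by move=> u lu; rewrite innerZ//; have [_ ->] := locform_hermite k r0 lu.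
- move=> c h i; rewrite ord1; apply/eqP; apply: contraNT H0 => c0; apply/eqP.
  apply: ae_eq0_inner => //; move: h; apply: filterS => t.
  by rewrite big_ord1 => /eqP; rewrite mulf_eq0 (negbTE c0) => /eqP.
- move=> f [lf loc]; pose c := inner f (hermite k) / inner (hermite k) (hermite k : R -> C).
  exists (fun=> c); pose f' t := f t - c * hermite k t.
  have lf' : L2 f' by apply: L2_sub => //; exact: L2_scale.
  have ff' j : inner (hermite j) f' = 0.
    have lj := @L2_hermite R j.
    rewrite (innerJ lj lf') inner_sub ?innerZ//; last exact: L2_scale.
    have [->|jk] := eqVneq j k; first by rewrite /c divfK// subrr conjC0.
    rewrite (inner_hermite_neq (_ : k != j)) 1?eq_sym// mulr0 subr0.
    rewrite -innerJ//; apply: (eigen_inner_hermite r0 lf loc).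
    by apply: contraNN jk => /eqP/complexI/(disk_eigenvalue_inj r0)->.
  have st z : stft g0 f z = c * stft g0 (hermite k) z.
    have := inner_hermite_stft lf' ff' z; rewrite !stftE// laplace_gauss_sub// mulrBr => /eqP.
    by rewrite subr_eq0 => /eqP ->; rewrite mulrCA.
  have [_ _ hf] := loc.
  (* [f] and its projection have the same transform by [st]. Testing against f', the eigenvalue
     equation gives lam <f, f'> and lam <c H_k, f'> as the same integral, and lam is nonzero. *)
  have e : inner f' f' = 0.
    rewrite inner_sub// ?innerZ//; last exact: L2_scale.
    apply: (mulfI lam0); rewrite mulr0 mulrBr -(innerZ lam lf lf') hf//.
    have [iH eH] := locform_hermite k r0 lf'.
    have -> : lam * (c * inner (hermite k) f') = c * (lam * inner (hermite k) f') by ring.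
    rewrite -eH -cintegralZ//; last exact: measurable_disk.
    apply/eqP; rewrite subr_eq0; apply/eqP; apply: eq_cintegral => z _.
    by rewrite st mulrA.
  have := inner_self_eq0 lf' e; apply: filterS => t.
  by rewrite big_ord1.
Qed.

Lemma disk_eigenvalue_listing r : 0 < r ->
  eigenvalue_listing (localization g0 (disk r)) (disk_eigenvalue r).
Proof.
move=> r0; split.
  by move=> j k; rewrite (Order.NatMonotonyTheory.decnP (disk_eigenvalue_dec r0)).
move=> mu mu0; have [[k kmu]|nk] := pselect (exists k, (disk_eigenvalue r k)%:C = mu).
  exists 1%N; split; last by rewrite -kmu; exact: eigenspace_hermite.
  rewrite (_ : [set _ | _] = [set k]); first exact: card_set1.
  apply/seteqP; split => j /=; rewrite -kmu; last by move=> ->.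
  by move/complexI/(disk_eigenvalue_inj r0).
exists 0%N; split.
  rewrite (_ : [set _ | _] = set0) ?II0//.
  by apply/seteqP; split => j //= jmu; apply: nk; exists j.
apply: eigenspace_trivial => // k; apply/eqP => e; apply: nk; exists k; exact: esym.
Qed.

End Spectrum.

Theorem theorem2p1 (R : realType) :
  exists C R0 : R, [/\ 0 < C, 0 < R0 &
    forall (r : R) (k : nat), R0 <= r ->
      `| kth_eigenvalue (localization (@gaussian_window R) (disk r)) k
         - 2^-1 * erfc ((k%:R - pi * r ^+ 2) / (Num.sqrt (2 * pi) * r)) |
      <= C / r].
Proof.
(* 12 comes from [gamma_tail_erfc], where sqrt L = sqrt pi r >= r; r >= 1 guarantees L >= 1. *)
exists 12, 1; split=> // r k r1.
have r0 : 0 < r by exact: lt_le_trans r1.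
rewrite (kth_eigenvalueE (disk_eigenvalue_dec r0) (disk_eigenvalue_gt0 r0) (disk_eigenvalue_listing r0)).
have sp1 := @sqrt_pi_ge1 R; have sp0 : 0 < Num.sqrt pi :> R by exact: lt_le_trans sp1.
set L := pi * r ^+ 2.
have sL : Num.sqrt L = Num.sqrt pi * r by rewrite sqrtrM ?pi_ge0// sqrtr_sqr ger0_norm ?ltW.
have L0 : 0 <= L by rewrite mulr_ge0 ?pi_ge0 ?sqr_ge0.
have L1 : 1 <= L.
  rewrite -(sqr_sqrtr L0) sL exprn_ege1//.
  by rewrite -[1]mulr1 ler_pM.
have := gamma_tail_erfc k L1; rewrite sL mulrA -sqrtrM//.
set x := (L - k%:R) / _ => h.
have -> : (k%:R - L) / (Num.sqrt (2 * pi) * r) = - x by rewrite /x -[k%:R - L]opprB mulNr.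
rewrite erfcE /disk_eigenvalue -/L.
(* By [gauss_tail_symm], half of erfc (- x) is 1 minus the normalized tail at x, so the two
   complements to 1 cancel. *)
have -> : 1 - gamma_tail k L - 2^-1 * (2 / Num.sqrt pi * gauss_tail (- x)) =
    - (gamma_tail k L - (Num.sqrt pi)^-1 * gauss_tail x).
  have := gauss_tail_symm x; move: (gauss_tail x) (gauss_tail (- x)) => a b ab.
  have -> : b = Num.sqrt pi - a by rewrite -ab; ring.
  move: (Num.sqrt pi) sp0 => s s0; field; by rewrite gt_eqF.
rewrite normrN; apply: (le_trans h).
rewrite ler_pM2l// lef_pV2 ?posrE ?mulr_gt0//.
by rewrite ler_peMl// ltW.
Qed.
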